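(* For the problem $u_{xt}+uu_{xx}-\lambda u_x^2=-(\lambda+1)\int_0^1u_x^2\,dx$, $u(x,0)=u_0(x)$, with $1$-periodic boundary conditions, there exist smooth $1$-periodic initial data $u_0$ such that, letting $t_*$ be the finite $L^\infty$ blow-up time of $u_x$ when $\lambda\in\mathbb{R}\setminus[0,1]$ and $t_*=+\infty$ when $\lambda\in[0,1]$ (in which case the solution is global), the following hold: (1) For $p\ge1$ and $\frac{2}{1-2p}<\lambda\le1$, $\lim_{t\uparrow t_*}\|u_x(\cdot,t)\|_{L^p(0,1)}<+\infty$. (2) For $p>1$ and $\lambda\in(-\infty,-2]\cup(1,+\infty)$, $\lim_{t\uparrow t_*}\|u_x(\cdot,t)\|_{L^p(0,1)}=+\infty$; likewise for $p\in(1,+\infty)$ and $\lambda\in(-2,-2/p]$. (3) The energy $E(t)=\|u_x(\cdot,t)\|_{L^2(0,1)}^2$ diverges as $t\uparrow t_*$ if $\lambda\in(-\infty,-2/3]\cup(1,+\infty)$, and remains finite for $t\in[0,t_*]$ if $\lambda\in(-2/3,1]$. Moreover $\dot E(t)\to+\infty$ as $t\uparrow t_*$ if $\lambda\in(-\infty,-1/2)\cup(1,+\infty)$; $\dot E(t)\equiv0$ if $\lambda=-1/2$; $\dot E(t)\to-\infty$ as $t\uparrow t_*$ if $\lambda\in(-1/2,-2/5]$; and $\dot E(t)$ remains bounded for $t\in[0,t_*]$ if $\lambda\in(-2/5,1]$.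
   Context: $\|u_x(\cdot,t)\|_{L^p(0,1)}=\left(\int_0^1|u_x(x,t)|^p\,dx\right)^{1/p}$. *)

(* Defs.v *)
From Stdlib Require Import Reals Lra ClassicalEpsilon.
Open Scope R_scope.

Definition Rint01 (f : R -> R) (v : R) : Prop :=
  exists pr : Riemann_integrable f 0 1, RiemannInt pr = v.

Definition Int01 (f : R -> R) : R :=
  epsilon (inhabits 0) (fun v => Rint01 f v).

(* x^p for x >= 0 and real p > 0, with 0^p = 0 (Stdlib's Rpower 0 p = 1). *)
Definition rpow (x p : R) : R :=
  if Rle_dec x 0 then 0 else Rpower x p.

Definition Lpnorm (ux : R -> R -> R) (p t : R) : R :=
  rpow (Int01 (fun x => rpow (Rabs (ux x t)) p)) (/ p).

Definition energy (ux : R -> R -> R) (t : R) : R :=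
  Int01 (fun x => (ux x t) ^ 2).

(* Existence interval [0,T): T = None means T = +infinity. *)
Definition before (T : option R) (t : R) : Prop :=
  match T with None => True | Some s => t < s end.

Definition periodic1 (f : R -> R) : Prop := forall x, f (x + 1) = f x.

Definition smooth (f : R -> R) : Prop :=
  exists D : nat -> R -> R, D 0%nat = f /\
    forall n x, derivable_pt_lim (D n) x (D (S n) x).

Definition cont_on_strip (T : option R) (f : R -> R -> R) : Prop :=
  forall x t, 0 <= t -> before T t ->
    forall eps, 0 < eps -> exists delta, 0 < delta /\
      forall y s, 0 <= s -> before T s -> Rabs (y - x) < delta ->
        Rabs (s - t) < delta -> Rabs (f y s - f x t) < eps.

Definition is_solution (lam : R) (u0 : R -> R) (T : option R)
  (u ux uxx uxt : R -> R -> R) : Prop :=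
  (forall s, T = Some s -> 0 < s) /\
  (forall x t, 0 <= t -> before T t ->
     derivable_pt_lim (fun y => u y t) x (ux x t) /\
     derivable_pt_lim (fun y => ux y t) x (uxx x t)) /\
  (forall x t, 0 < t -> before T t ->
     derivable_pt_lim (fun s => ux x s) t (uxt x t)) /\
  cont_on_strip T u /\ cont_on_strip T ux /\ cont_on_strip T uxx /\
  (forall x t, 0 <= t -> before T t -> u (x + 1) t = u x t) /\
  (forall x, u x 0 = u0 x) /\
  (forall x t, 0 < t -> before T t ->
     uxt x t + u x t * uxx x t - lam * (ux x t) ^ 2
       = - (lam + 1) * Int01 (fun y => (ux y t) ^ 2)).

Definition Linf_blowup (ux : R -> R -> R) (s : R) : Prop :=
  forall M t0, t0 < s -> exists t, t0 < t /\ t < s /\ 0 <= t /\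
    exists x, M < Rabs (ux x t).

Definition near_end (T : option R) (P : R -> Prop) : Prop :=
  exists t0, 0 <= t0 /\ before T t0 /\
    forall t, t0 < t -> before T t -> P t.

Definition lim_finite (T : option R) (g : R -> R) : Prop :=
  exists L, forall eps, 0 < eps -> near_end T (fun t => Rabs (g t - L) < eps).

Definition lim_pinf (T : option R) (g : R -> R) : Prop :=
  forall M, near_end T (fun t => M < g t).

Definition lim_minf (T : option R) (g : R -> R) : Prop :=
  forall M, near_end T (fun t => g t < M).

Definition bounded_on (T : option R) (g : R -> R) : Prop :=
  exists M, forall t, 0 <= t -> before T t -> Rabs (g t) <= M.

(* Main.v *)
Require Import Defs.
From Stdlib Require Import Reals Lra Psatz ClassicalEpsilon FunctionalExtensionality.
From Coquelicot Require Import Coquelicot.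
Open Scope R_scope.

(** Take [u0 = sin (2 pi x) / (2 pi)]. Along the characteristics the equation is integrated explicitly
    (Sarria and Saxton): with [J = 1 - lam eta cos (2 pi a)], [W = J^(-1/lam)] ([exp (eta cos)] for
    [lam = 0]) and [S_i] the integral of [W (cos / J)^i], the Jacobian of the flow is [W / S_0] and
    [u_x = S_0^(-2 lam) (cos / J - S_1 / S_0)] along it, where [eta' = S_0^(-2 lam)]. The Eulerian
    solution comes back by inverting the flow, and the energy satisfies [E' = (1 + 2 lam) int u_x^3].
    For [lam <> 0], [u_x] is up to a factor [X - EX], where [X = 1/J] has density [J^(-1/lam) / S_0];
    hence all norms are central moments of [X], expressed by the Legendre-type integrals
    [F s r = int (1 - r cos)^(-s)] as [r = |lam| eta] tends to 1. Elementary two-sided bounds on [F]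
    settle [lam < 1]; for [lam > 1] the three-term recurrence of [F] gives the sign and the size of the
    second and third central moments. *)

(** The equation integrates because, with [g] the Jacobian, [g^(-lam)] solves along each
    characteristic the linear equation [w'' = lam (lam + 1) (int u_x^2) w], whose coefficient does
    not depend on the label. So [g^(-lam)] is a function of time times [1 - lam eta cos], the
    Wronskian ties that function to [eta'], and the mass 1 of [g] fixes both. The extrema of the
    cosine are quadratic, so [F s r] grows like [(1 - r)^(1/2 - s)] for [s > 1/2] and stays bounded
    for [s < 1/2]. For [lam <> 0] and [b = 1/lam], this makes the time [int S_0^(2 lam) d eta]
    needed to reach [|lam| eta = 1] infinite exactly when [0 < lam <= 1]. As [E X^p] is
    [F (b + p) / F b], it also puts the threshold for [lam < 0] at [b + p = 1/2], that is
    [lam = -2/(2p - 1)]: [-2/3] for the energy, [-2/5] for its derivative. The obstacle for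
    [lam > 1] is cancellation: after scaling, the terms of a central moment of [X] can have the same
    order, and bounds up to a constant do not give the sign of their sum. *)

(** * Continuity and differentiation in two variables *)

Lemma cont2d_compose (F f g : R -> R -> R) (x y : R) :
  continuity_2d_pt F (f x y) (g x y) ->
  continuity_2d_pt f x y -> continuity_2d_pt g x y ->
  continuity_2d_pt (fun u v => F (f u v) (g u v)) x y.
Proof.
  intros HF Hf Hg eps.
  destruct (HF eps) as [d Hd].
  destruct (Hf d) as [d1 H1]. destruct (Hg d) as [d2 H2].
  assert (P : 0 < Rmin d1 d2) by (apply Rmin_pos; apply cond_pos).
  exists (mkposreal _ P). simpl. intros u v Hu Hv.
  apply Hd.
  - apply H1; eapply Rlt_le_trans; eauto; apply Rmin_l.
  - apply H2; eapply Rlt_le_trans; eauto; apply Rmin_r.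
Qed.

Lemma cont2d_swap (f : R -> R -> R) (x y : R) :
  continuity_2d_pt f x y -> continuity_2d_pt (fun u v => f v u) y x.
Proof.
  intros H eps. destruct (H eps) as [d Hd]. exists d. intros u v Hu Hv. now apply Hd.
Qed.

Lemma cont2d_fst (f : R -> R -> R) (x y : R) :
  continuity_2d_pt f x y -> continuous (fun u => f u y) x.
Proof.
  intros H. apply filterlim_locally. intros eps. destruct (H eps) as [d Hd].
  exists d. intros u Hu. apply Hd; [exact Hu|].
  rewrite Rminus_diag, Rabs_R0. apply cond_pos.
Qed.

Lemma cont2d_snd (f : R -> R -> R) (x y : R) :
  continuity_2d_pt f x y -> continuous (fun v => f x v) y.
Proof. intros H. apply (cont2d_fst (fun u v => f v u)). now apply cont2d_swap. Qed.

Lemma cont2d_of_fst (f : R -> R) (x y : R) :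
  continuous f x -> continuity_2d_pt (fun u _ => f u) x y.
Proof.
  intros H. apply (continuity_1d_2d_pt_comp f (fun u _ => u)).
  - now apply continuity_pt_filterlim.
  - apply continuity_2d_pt_id1.
Qed.

Lemma cont2d_of_snd (f : R -> R) (x y : R) :
  continuous f y -> continuity_2d_pt (fun _ v => f v) x y.
Proof.
  intros H. apply (continuity_1d_2d_pt_comp f (fun _ v => v)).
  - now apply continuity_pt_filterlim.
  - apply continuity_2d_pt_id2.
Qed.

(** Caratheodory's form of the derivative: a slope function that is merely continuous at the point
    can be added, multiplied and inverted without any remainder term. *)
Lemma is_derive_iff_slope (f : R -> R) (x l : R) :
  (exists s : R -> R, continuous s x /\ s x = l /\
     locally x (fun y => f y = f x + s y * (y - x))) ->
  is_derive f x l.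
Proof.
  intros (s & Hs & Hl & He).
  apply is_derive_Reals. intros eps Heps.
  assert (Hs' := proj1 (filterlim_locally s (s x)) Hs (mkposreal _ Heps)).
  destruct (filter_and _ _ Hs' He) as [d Hd].
  exists d. intros h Hh0 Hh.
  destruct (Hd (x + h)) as [H1 H2].
  { change (Rabs (x + h - x) < d). now replace (x + h - x) with h by ring. }
  rewrite H2. replace ((f x + s (x + h) * (x + h - x) - f x) / h) with (s (x + h)) by (field; exact Hh0).
  rewrite <- Hl. exact H1.
Qed.

Lemma slope_of_is_derive (f : R -> R) (x l : R) :
  is_derive f x l ->
  exists s : R -> R, continuous s x /\ s x = l /\ forall y, f y = f x + s y * (y - x).
Proof.
  intros H. apply is_derive_Reals in H.
  exists (fun y => match Req_EM_T y x with left _ => l | right _ => (f y - f x) / (y - x) end).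
  split; [|split].
  - apply filterlim_locally. intros eps.
    destruct (H eps (cond_pos eps)) as [d Hd]. exists d. intros y Hy.
    change (Rabs (y - x) < d) in Hy.
    change (Rabs (match Req_EM_T y x with left _ => l | right _ => (f y - f x) / (y - x) end
            - match Req_EM_T x x with left _ => l | right _ => (f x - f x) / (x - x) end) < eps).
    destruct (Req_EM_T x x) as [_|n]; [|now elim n].
    destruct (Req_EM_T y x) as [->|n].
    + rewrite Rminus_diag, Rabs_R0. apply cond_pos.
    + replace y with (x + (y - x)) at 1 by ring. apply Hd; [lra|exact Hy].
  - destruct (Req_EM_T x x) as [_|n]; [reflexivity|now elim n].
  - intros y. destruct (Req_EM_T y x) as [->|n]; [ring|field; lra].
Qed.

(* Caratheodory slopes avoid any differentiability in the pair of variables. *)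
Lemma slope_fst (F Fx : R -> R -> R) (a : R -> R) (t0 : R) :
  locally_2d (fun x t => is_derive (fun y => F y t) x (Fx x t)) (a t0) t0 ->
  continuity_2d_pt Fx (a t0) t0 ->
  continuous a t0 ->
  exists s : R -> R, continuous s t0 /\ s t0 = Fx (a t0) t0 /\
    locally t0 (fun t => F (a t) t = F (a t0) t + s t * (a t - a t0)).
Proof.
  intros HF Hc Ha.
  set (s := fun t => match Req_EM_T (a t) (a t0) with
     | left _ => Fx (a t0) t | right _ => (F (a t) t - F (a t0) t) / (a t - a t0) end).
  destruct HF as [d0 Hd0].
  exists s. split; [|split].
  - apply filterlim_locally. intros eps.
    destruct (Hc eps) as [d Hd].
    assert (P : 0 < Rmin d d0) by (apply Rmin_pos; apply cond_pos).
    destruct (proj1 (filterlim_locally a (a t0)) Ha (mkposreal _ P)) as [d1 H1].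
    assert (P1 : 0 < Rmin d1 (Rmin d d0)) by (apply Rmin_pos; [apply cond_pos|exact P]).
    exists (mkposreal _ P1). intros t Ht.
    change (Rabs (t - t0) < Rmin d1 (Rmin d d0)) in Ht.
    assert (Ht1 : Rabs (t - t0) < d1) by (eapply Rlt_le_trans; [exact Ht|apply Rmin_l]).
    assert (Ht2 : Rabs (t - t0) < Rmin d d0) by (eapply Rlt_le_trans; [exact Ht|apply Rmin_r]).
    assert (Ht3 : Rabs (t - t0) < d) by (eapply Rlt_le_trans; [exact Ht2|apply Rmin_l]).
    assert (Ht4 : Rabs (t - t0) < d0) by (eapply Rlt_le_trans; [exact Ht2|apply Rmin_r]).
    assert (Hat : Rabs (a t - a t0) < Rmin d d0) by exact (H1 t Ht1).
    assert (Hat1 : Rabs (a t - a t0) < d) by (eapply Rlt_le_trans; [exact Hat|apply Rmin_l]).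
    assert (Hat2 : Rabs (a t - a t0) < d0) by (eapply Rlt_le_trans; [exact Hat|apply Rmin_r]).
    assert (Hs0 : s t0 = Fx (a t0) t0).
    { unfold s. destruct (Req_EM_T (a t0) (a t0)) as [_|n]; [reflexivity|now elim n]. }
    change (Rabs (s t - s t0) < eps). rewrite Hs0. unfold s.
    destruct (Req_EM_T (a t) (a t0)) as [_|n].
    + apply Hd; [rewrite Rminus_diag, Rabs_R0; apply cond_pos|exact Ht3].
    + assert (Hin : forall x, Rmin (a t0) (a t) <= x <= Rmax (a t0) (a t) ->
                Rabs (x - a t0) <= Rabs (a t - a t0)).
      { intros x. unfold Rmin, Rmax. destruct (Rle_dec (a t0) (a t)); intros [? ?];
        [rewrite !Rabs_pos_eq; lra | rewrite !Rabs_left1; lra]. }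
      assert (Hder : forall x, Rmin (a t0) (a t) <= x <= Rmax (a t0) (a t) ->
                is_derive (fun y => F y t) x (Fx x t)).
      { intros x Hx. apply Hd0; [eapply Rle_lt_trans; [apply Hin, Hx|exact Hat2]|exact Ht4]. }
      destruct (MVT_gen (fun y => F y t) (a t0) (a t) (fun x => Fx x t)) as [xi [Hxi He]].
      * intros x Hx. apply Hder. lra.
      * intros x Hx. apply continuity_pt_filterlim. apply (ex_derive_continuous (fun y => F y t)).
        eexists. apply Hder, Hx.
      * cbv beta in He. rewrite He.
        replace (Fx xi t * (a t - a t0) / (a t - a t0)) with (Fx xi t) by (field; lra).
        apply Hd; [eapply Rle_lt_trans; [apply Hin, Hxi|exact Hat1]|exact Ht3].
  - unfold s. destruct (Req_EM_T (a t0) (a t0)) as [_|n]; [reflexivity|now elim n].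
  - exists d0. intros t _. unfold s. destruct (Req_EM_T (a t) (a t0)) as [e|n].
    + rewrite e. ring.
    + field. lra.
Qed.

(** The increment is split at [F (a t0) t]: its spatial half has the slope of [slope_fst], and its
    temporal half needs a time derivative only at the single position [a t0]. *)
Lemma is_derive_chain2 (F Fx : R -> R -> R) (a : R -> R) (t0 da l : R) :
  locally_2d (fun x t => is_derive (fun y => F y t) x (Fx x t)) (a t0) t0 ->
  continuity_2d_pt Fx (a t0) t0 ->
  is_derive a t0 da ->
  is_derive (fun t => F (a t0) t) t0 l ->
  is_derive (fun t => F (a t) t) t0 (Fx (a t0) t0 * da + l).
Proof.
  intros HF Hc Ha Hl.
  assert (Hca : continuous a t0) by (apply (ex_derive_continuous a); now exists da).
  destruct (slope_fst F Fx a t0 HF Hc Hca) as (s & Hs & Hs0 & He).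
  destruct (slope_of_is_derive _ _ _ Ha) as (sa & Hsa & Hsa0 & Hea).
  destruct (slope_of_is_derive _ _ _ Hl) as (sl & Hsl & Hsl0 & Hel).
  apply is_derive_iff_slope.
  exists (fun t => s t * sa t + sl t). split; [|split].
  - apply (continuous_plus (fun t => s t * sa t) sl); [|exact Hsl].
    now apply (continuous_mult s sa).
  - now rewrite Hs0, Hsa0, Hsl0.
  - revert He. apply filter_imp. intros t Ht. rewrite Ht, (Hel t), (Hea t). ring.
Qed.

(** Constancy along the curve turns the two slope identities into
    [s t * (a t - a t0) = - sl t * (t - t0)], and [s] does not vanish near [t0]. This differentiates
    both the inverse flow and the inverse clock. *)
Lemma is_derive_implicit (F Fx : R -> R -> R) (a : R -> R) (t0 l : R) :
  locally_2d (fun x t => is_derive (fun y => F y t) x (Fx x t)) (a t0) t0 ->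
  continuity_2d_pt Fx (a t0) t0 ->
  continuous a t0 ->
  is_derive (fun t => F (a t0) t) t0 l ->
  locally t0 (fun t => F (a t) t = F (a t0) t0) ->
  Fx (a t0) t0 <> 0 ->
  is_derive a t0 (- l / Fx (a t0) t0).
Proof.
  intros HF Hc Hca Hl Hcst Hn.
  destruct (slope_fst F Fx a t0 HF Hc Hca) as (s & Hs & Hs0 & He).
  destruct (slope_of_is_derive _ _ _ Hl) as (sl & Hsl & Hsl0 & Hel).
  apply is_derive_iff_slope.
  exists (fun t => - sl t / s t). split; [|split].
  - apply (continuous_mult (fun t => - sl t) (fun t => / s t)).
    + now apply (continuous_opp sl).
    + apply continuous_Rinv_comp; [exact Hs|now rewrite Hs0].
  - now rewrite Hs0, Hsl0.
  - assert (Hnz : locally t0 (fun t => s t <> 0)).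
    { assert (Hp : 0 < Rabs (s t0)) by (apply Rabs_pos_lt; now rewrite Hs0).
      generalize (proj1 (filterlim_locally s (s t0)) Hs (mkposreal _ Hp)).
      apply filter_imp. intros t Ht E. change (Rabs (s t - s t0) < Rabs (s t0)) in Ht.
      rewrite E in Ht. replace (0 - s t0) with (- s t0) in Ht by ring. rewrite Rabs_Ropp in Ht. lra. }
    generalize (filter_and _ _ He (filter_and _ _ Hcst Hnz)).
    apply filter_imp. intros t (H1 & H2 & H3).
    rewrite H2, (Hel t) in H1.
    apply (Rmult_eq_reg_l (s t)); [|exact H3].
    replace (s t * (a t0 + - sl t / s t * (t - t0))) with (s t * a t0 - sl t * (t - t0)) by (field; exact H3).
    lra.
Qed.

(** Near the point the spatial derivative is bounded by [M], so by the mean value theorem moving in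
    space costs at most [M] times the distance; continuity in time is then needed at [x0] only. *)
Lemma cont2d_of_is_derive_fst (F Fx : R -> R -> R) (x0 t0 : R) :
  locally_2d (fun x t => is_derive (fun y => F y t) x (Fx x t)) x0 t0 ->
  continuity_2d_pt Fx x0 t0 ->
  continuous (fun t => F x0 t) t0 ->
  continuity_2d_pt F x0 t0.
Proof.
  intros [d0 Hd0] Hc Ht eps.
  destruct (Hc (mkposreal 1 Rlt_0_1)) as [d1 Hd1]. simpl in Hd1.
  set (M := Rabs (Fx x0 t0) + 1).
  assert (HM : 0 < M) by (unfold M; generalize (Rabs_pos (Fx x0 t0)); lra).
  assert (He2 : 0 < eps / 2) by (generalize (cond_pos eps); lra).
  destruct (proj1 (filterlim_locally _ _) Ht (mkposreal _ He2)) as [d2 Hd2].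
  assert (He3 : 0 < eps / 2 / M) by now apply Rdiv_lt_0_compat.
  assert (P : 0 < Rmin (Rmin d0 d1) (Rmin d2 (eps / 2 / M)))
    by (repeat apply Rmin_pos; try apply cond_pos; exact He3).
  exists (mkposreal _ P). simpl. intros u v Hu Hv.
  assert (B : forall z, z < Rmin (Rmin d0 d1) (Rmin d2 (eps / 2 / M)) ->
     z < d0 /\ z < d1 /\ z < d2 /\ z < eps / 2 / M).
  { intros z Hz. repeat split; eapply Rlt_le_trans; try exact Hz.
    - eapply Rle_trans; [apply Rmin_l|apply Rmin_l].
    - eapply Rle_trans; [apply Rmin_l|apply Rmin_r].
    - eapply Rle_trans; [apply Rmin_r|apply Rmin_l].
    - eapply Rle_trans; [apply Rmin_r|apply Rmin_r]. }
  destruct (B _ Hu) as (U0 & U1 & U2 & U3). destruct (B _ Hv) as (V0 & V1 & V2 & V3).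
  assert (Hin : forall x, Rmin x0 u <= x <= Rmax x0 u -> Rabs (x - x0) <= Rabs (u - x0)).
  { intros x. unfold Rmin, Rmax. destruct (Rle_dec x0 u); intros [? ?];
      [rewrite !Rabs_pos_eq; lra | rewrite !Rabs_left1; lra]. }
  assert (Hder : forall x, Rmin x0 u <= x <= Rmax x0 u -> is_derive (fun y => F y v) x (Fx x v)).
  { intros x Hx. apply Hd0; [eapply Rle_lt_trans; [apply Hin, Hx|exact U0]|exact V0]. }
  destruct (MVT_gen (fun y => F y v) x0 u (fun x => Fx x v)) as [xi [Hxi He]].
  - intros x Hx. apply Hder. lra.
  - intros x Hx. apply continuity_pt_filterlim. apply (ex_derive_continuous (fun y => F y v)).
    eexists. apply Hder, Hx.
  - cbv beta in He.
    assert (H1 : Rabs (Fx xi v - Fx x0 t0) < 1).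
    { apply Hd1; [eapply Rle_lt_trans; [apply Hin, Hxi|exact U1]|exact V1]. }
    assert (H2 : Rabs (F x0 v - F x0 t0) < eps / 2) by exact (Hd2 v V2).
    replace (F u v - F x0 t0) with (Fx xi v * (u - x0) + (F x0 v - F x0 t0)) by lra.
    eapply Rle_lt_trans; [apply Rabs_triang|].
    assert (H3 : Rabs (Fx xi v) <= M).
    { unfold M. replace (Fx xi v) with (Fx xi v - Fx x0 t0 + Fx x0 t0) by ring.
      eapply Rle_trans; [apply Rabs_triang|]. lra. }
    rewrite Rabs_mult.
    assert (H4 : Rabs (Fx xi v) * Rabs (u - x0) <= M * (eps / 2 / M)).
    { apply Rmult_le_compat; try apply Rabs_pos; lra. }
    replace (M * (eps / 2 / M)) with (eps / 2) in H4 by (field; lra).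
    lra.
Qed.

(* [F] is increasing in its first variable, so [A x t] is trapped where [F] changes sign. *)
Lemma cont2d_implicit (D : R -> Prop) (F A : R -> R -> R) (x0 t0 : R) :
  locally t0 D ->
  (forall t, D t -> forall y z, y < z -> F y t < F z t) ->
  (forall y, continuous (fun t => F y t) t0) ->
  (forall x t, D t -> F (A x t) t = x) ->
  continuity_2d_pt A x0 t0.
Proof.
  intros HD Hm Hc HA eps.
  assert (D0 : D t0) by now apply locally_singleton.
  set (a := A x0 t0).
  assert (H1 : F (a - eps) t0 < x0).
  { rewrite <- (HA x0 t0 D0). apply Hm; [exact D0|]. unfold a. generalize (cond_pos eps); lra. }
  assert (H2 : x0 < F (a + eps) t0).
  { rewrite <- (HA x0 t0 D0) at 1. apply Hm; [exact D0|]. unfold a. generalize (cond_pos eps); lra. }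
  set (g := Rmin (x0 - F (a - eps) t0) (F (a + eps) t0 - x0) / 2).
  assert (Hg : 0 < g) by (unfold g; apply Rdiv_lt_0_compat; [apply Rmin_pos; lra|lra]).
  assert (Hg1 : 2 * g <= x0 - F (a - eps) t0) by (unfold g; generalize (Rmin_l (x0 - F (a - eps) t0) (F (a + eps) t0 - x0)); lra).
  assert (Hg2 : 2 * g <= F (a + eps) t0 - x0) by (unfold g; generalize (Rmin_r (x0 - F (a - eps) t0) (F (a + eps) t0 - x0)); lra).
  assert (L1 := proj1 (filterlim_locally _ _) (Hc (a - eps)) (mkposreal _ Hg)).
  assert (L2 := proj1 (filterlim_locally _ _) (Hc (a + eps)) (mkposreal _ Hg)).
  destruct (filter_and _ _ HD (filter_and _ _ L1 L2)) as [d Hd].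
  assert (P : 0 < Rmin d g) by (apply Rmin_pos; [apply cond_pos|exact Hg]).
  exists (mkposreal _ P). simpl. intros x t Hx Ht.
  destruct (Hd t) as (Dt & B1 & B2); [eapply Rlt_le_trans; [exact Ht|apply Rmin_l]|].
  change (Rabs (F (a - eps) t - F (a - eps) t0) < g) in B1.
  change (Rabs (F (a + eps) t - F (a + eps) t0) < g) in B2.
  assert (Hx' : Rabs (x - x0) < g) by (eapply Rlt_le_trans; [exact Hx|apply Rmin_r]).
  apply Rabs_def2 in B1. apply Rabs_def2 in B2. apply Rabs_def2 in Hx'.
  apply Rabs_def1.
  - apply Rnot_le_lt. intros N.
    assert (F (a + eps) t <= F (A x t) t).
    { destruct (Rle_lt_or_eq_dec (a + eps) (A x t)) as [h|h]; [fold a in N; lra| |rewrite <- h; lra].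
      left. now apply Hm. }
    rewrite HA in H by exact Dt. lra.
  - apply Rnot_le_lt. intros N.
    assert (F (A x t) t <= F (a - eps) t).
    { destruct (Rle_lt_or_eq_dec (A x t) (a - eps)) as [h|h]; [fold a in N; lra| |rewrite <- h; lra].
      left. now apply Hm. }
    rewrite HA in H by exact Dt. lra.
Qed.

(** * Integrals of continuous functions and integrals with a parameter *)

Lemma is_derive_val (f : R -> R) (x l l' : R) : is_derive f x l -> l = l' -> is_derive f x l'.
Proof. now intros H <-. Qed.

Lemma RInt_extR (f h : R -> R) (a b : R) : (forall x, f x = h x) -> RInt f a b = RInt h a b.
Proof. intros H. apply RInt_ext. intros x _. apply H. Qed.

Lemma ex_RInt_cont (f : R -> R) (a b : R) :
  (forall x, continuous f x) -> ex_RInt f a b.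
Proof. intros H. apply (ex_RInt_continuous (V := R_CompleteNormedModule)). intros; apply H. Qed.

Lemma is_derive_RInt_cont (f : R -> R) (a x : R) :
  (forall y, continuous f y) -> is_derive (fun y => RInt f a y) x (f x).
Proof.
  intros H. apply (is_derive_RInt f _ a); [|apply H].
  apply filter_forall. intros y. apply (RInt_correct (V := R_CompleteNormedModule)).
  now apply ex_RInt_cont.
Qed.

Lemma is_derive_RInt_param_cont (f ft : R -> R -> R) (a b t0 : R) :
  locally t0 (fun t => forall x, is_derive (fun s => f x s) t (ft x t)) ->
  (forall x, continuity_2d_pt ft x t0) ->
  locally t0 (fun t => forall x, continuous (fun y => f y t) x) ->
  is_derive (fun t => RInt (fun x => f x t) a b) t0 (RInt (fun x => ft x t0) a b).
Proof.
  intros Hd Hc Hf.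
  rewrite (RInt_ext (fun x => ft x t0) (fun x => Derive (fun s => f x s) t0)).
  - apply (is_derive_RInt_param (fun t x => f x t)).
    + revert Hd. apply filter_imp. intros t Ht x _. eexists. apply Ht.
    + intros x _. apply (continuity_2d_pt_ext_loc (fun t y => ft y t)).
      * destruct Hd as [d Hd]. exists d. intros u v Hu Hv. symmetry.
        apply is_derive_unique. now apply Hd.
      * now apply cont2d_swap.
    + revert Hf. apply filter_imp. intros t Ht. now apply ex_RInt_cont.
  - intros x _. symmetry. apply is_derive_unique. now apply (locally_singleton _ _ Hd).
Qed.

Lemma continuous_RInt_param (f : R -> R -> R) (t0 : R) :
  (forall x, continuity_2d_pt f x t0) ->
  locally t0 (fun t => forall x, continuous (fun y => f y t) x) ->
  continuous (fun t => RInt (fun x => f x t) 0 1) t0.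
Proof.
  intros Hc Hf. apply filterlim_locally. intros eps.
  assert (He : 0 < eps / 2) by (generalize (cond_pos eps); lra).
  destruct (uniform_continuity_2d_1d f 0 1 t0 (fun x _ => Hc x) (mkposreal _ He)) as [d Hd].
  assert (Hl : locally t0 (fun t => Rabs (t - t0) < d)) by (exists d; now intros).
  generalize (filter_and _ _ Hl Hf). apply filter_imp. intros t [Ht Hft].
  assert (Hf0 := locally_singleton _ _ Hf). cbv beta in Hf0.
  change (Rabs (RInt (fun x => f x t) 0 1 - RInt (fun x => f x t0) 0 1) < eps).
  apply Rabs_def2 in Ht.
  assert (Hb : forall x, 0 <= x <= 1 -> Rabs (f x t - f x t0) < eps / 2).
  { intros x Hx. apply (Hd x t0 x t); try lra.
    rewrite Rminus_diag, Rabs_R0. apply cond_pos. }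
  assert (E : RInt (fun x => f x t) 0 1 - RInt (fun x => f x t0) 0 1 = RInt (fun x => f x t - f x t0) 0 1).
  { symmetry. apply (RInt_minus (V := R_CompleteNormedModule)); now apply ex_RInt_cont. }
  rewrite E.
  assert (Hx : ex_RInt (fun x => f x t - f x t0) 0 1).
  { apply ex_RInt_cont. intros x. apply (continuous_minus (fun x => f x t) (fun x => f x t0)); auto. }
  eapply Rle_lt_trans.
  - apply (abs_RInt_le_const _ 0 1 (eps / 2)); [lra|exact Hx|].
    intros x Hx'. left. now apply Hb.
  - generalize (cond_pos eps); lra.
Qed.

(** The choice made by [epsilon] is harmless: whichever proof of integrability it returns, the value
    is [RInt f 0 1]. *)
Lemma Int01_RInt (f : R -> R) : ex_RInt f 0 1 -> Int01 f = RInt f 0 1.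
Proof.
  intros H. unfold Int01.
  destruct (epsilon_spec (inhabits 0) (fun v => Rint01 f v)) as [pr Hpr].
  { exists (RInt f 0 1). exists (ex_RInt_Reals_0 _ _ _ H). symmetry. apply RInt_Reals. }
  rewrite <- Hpr. symmetry. apply RInt_Reals.
Qed.

Lemma incr_of_derive_pos (f df : R -> R) :
  (forall x, is_derive f x (df x)) -> (forall x, 0 < df x) ->
  forall x y, x < y -> f x < f y.
Proof.
  intros Hd Hp x y Hxy.
  destruct (MVT_gen f x y df) as [c [_ Hc]].
  - intros; apply Hd.
  - intros z _. apply continuity_pt_filterlim. apply (ex_derive_continuous f). eexists. apply Hd.
  - assert (0 < df c * (y - x)) by (apply Rmult_lt_0_compat; [apply Hp|lra]). lra.
Qed.

Lemma const_of_derive_0 (f : R -> R) :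
  (forall x, is_derive f x 0) -> forall x y, f x = f y.
Proof.
  intros Hd x y.
  destruct (MVT_gen f x y (fun _ => 0)) as [c [_ Hc]].
  - intros; apply Hd.
  - intros z _. apply continuity_pt_filterlim. apply (ex_derive_continuous f). eexists. apply Hd.
  - lra.
Qed.

(** * The flow of a Lagrangian velocity gradient *)

(* [g] is the Jacobian of the characteristics and [V] the gradient [u_x] along them. *)
Record lagrangian (lam : R) (D : R -> Prop) (V Vx g : R -> R -> R) : Prop := {
  lag_open : forall t, D t -> locally t D;
  lag_g_pos : forall x t, D t -> 0 < g x t;
  lag_g_mass : forall t, D t -> RInt (fun x => g x t) 0 1 = 1;
  lag_g_periodic : forall x t, D t -> g (x + 1) t = g x t;
  lag_V_periodic : forall x t, D t -> V (x + 1) t = V x t;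
  lag_g_cont : forall x t, D t -> continuity_2d_pt g x t;
  lag_V_cont : forall x t, D t -> continuity_2d_pt V x t;
  lag_Vx_cont : forall x t, D t -> continuity_2d_pt Vx x t;
  lag_g_derive : forall x t, D t -> is_derive (fun s => g x s) t (V x t * g x t);
  lag_V_derive : forall x t, D t -> is_derive (fun s => V x s) t
     (lam * V x t ^ 2 - (lam + 1) * RInt (fun y => V y t ^ 2 * g y t) 0 1);
  lag_V_derive_x : forall x t, D t -> is_derive (fun y => V y t) x (Vx x t) }.

Section Flow.
Variables (lam : R) (D : R -> Prop) (V Vx g : R -> R -> R).
Hypothesis L : lagrangian lam D V Vx g.

(** Integrating from 0 keeps the characteristic of label 0 at rest, which normalises the velocity to
    [u 0 t = 0]. *)
Definition flow (x t : R) : R := RInt (fun a => g a t) 0 x.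
Definition flow_vel (x t : R) : R := RInt (fun a => V a t * g a t) 0 x.
Definition flow_inv (x t : R) : R := epsilon (inhabits 0) (fun a => flow a t = x).
Definition euler_u (x t : R) : R := flow_vel (flow_inv x t) t.
Definition euler_ux (x t : R) : R := V (flow_inv x t) t.
Definition euler_uxx (x t : R) : R := Vx (flow_inv x t) t / g (flow_inv x t) t.
(** The equation solved for [u_xt]. Its content lies in [euler_ux_derive_t], which shows that this
    is the time derivative of [euler_ux]. *)
Definition euler_uxt (x t : R) : R :=
  lam * euler_ux x t ^ 2 - (lam + 1) * RInt (fun y => V y t ^ 2 * g y t) 0 1
  - euler_u x t * euler_uxx x t.

Let g_cx x t : D t -> continuous (fun y => g y t) x.
Proof. intros H. apply cont2d_fst, (lag_g_cont _ _ _ _ _ L); exact H. Qed.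

Let V_cx x t : D t -> continuous (fun y => V y t) x.
Proof. intros H. apply cont2d_fst, (lag_V_cont _ _ _ _ _ L); exact H. Qed.

Let Vg_cont x t : D t -> continuity_2d_pt (fun x t => V x t * g x t) x t.
Proof.
  intros H. apply continuity_2d_pt_mult; [apply (lag_V_cont _ _ _ _ _ L)|apply (lag_g_cont _ _ _ _ _ L)]; exact H.
Qed.

Let locD t (P : R -> Prop) : D t -> (forall s, D s -> P s) -> locally t P.
Proof. intros H HP. generalize (lag_open _ _ _ _ _ L t H). now apply filter_imp. Qed.

Lemma flow_derive_x x t : D t -> is_derive (fun y => flow y t) x (g x t).
Proof. intros H. apply (is_derive_RInt_cont (fun a => g a t)). intros y; now apply g_cx. Qed.

Lemma flow_vel_derive_x x t : D t -> is_derive (fun y => flow_vel y t) x (V x t * g x t).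
Proof.
  intros H. apply (is_derive_RInt_cont (fun a => V a t * g a t)). intros y.
  apply (cont2d_fst (fun x t => V x t * g x t)). now apply Vg_cont.
Qed.

Lemma flow_derive_t x t : D t -> is_derive (fun s => flow x s) t (flow_vel x t).
Proof.
  intros H. apply (is_derive_RInt_param_cont g (fun a s => V a s * g a s)).
  - apply locD; [exact H|]. intros s Hs y. now apply (lag_g_derive _ _ _ _ _ L).
  - intros y. now apply Vg_cont.
  - apply locD; [exact H|]. intros s Hs y. now apply g_cx.
Qed.

Lemma flow_incr t : D t -> forall x y, x < y -> flow x t < flow y t.
Proof.
  intros H. apply (incr_of_derive_pos (fun y => flow y t) (fun y => g y t)).
  - intros; now apply flow_derive_x.
  - intros; now apply (lag_g_pos _ _ _ _ _ L).
Qed.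

Lemma flow_inj t x y : D t -> flow x t = flow y t -> x = y.
Proof.
  intros H E. destruct (Rtotal_order x y) as [h|[h|h]]; [|exact h|];
    apply (flow_incr t H) in h; lra.
Qed.

Lemma RInt_shift_period (f : R -> R) (x : R) :
  (forall y, continuous f y) -> (forall y, f (y + 1) = f y) ->
  RInt f 0 (x + 1) = RInt f 0 x + RInt f 0 1.
Proof.
  intros Hc Hp.
  assert (E := const_of_derive_0 (fun y => RInt f 0 (y + 1) - RInt f 0 y)).
  assert (H0 : RInt f 0 (x + 1) - RInt f 0 x = RInt f 0 (0 + 1) - RInt f 0 0).
  { apply E. intros y.
    apply (is_derive_val _ _ (f (y + 1) - f y)); [|rewrite Hp; ring].
    apply (is_derive_minus (fun y => RInt f 0 (y + 1)) (fun y => RInt f 0 y)).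
    - replace (f (y + 1)) with (scal 1 (f (y + 1))) by (unfold scal; simpl; unfold mult; simpl; ring).
      apply (is_derive_comp (fun y => RInt f 0 y) (fun y => y + 1)).
      + now apply is_derive_RInt_cont.
      + auto_derive; auto.
    - now apply is_derive_RInt_cont. }
  rewrite Rplus_0_l in H0. rewrite (RInt_point 0 f) in H0. unfold zero in H0; simpl in H0. lra.
Qed.

Lemma flow_shift x t : D t -> flow (x + 1) t = flow x t + 1.
Proof.
  intros H. unfold flow. rewrite RInt_shift_period.
  - now rewrite (lag_g_mass _ _ _ _ _ L).
  - intros y; now apply g_cx.
  - intros y; now apply (lag_g_periodic _ _ _ _ _ L).
Qed.

Lemma flow_0 t : flow 0 t = 0.
Proof. unfold flow. now rewrite RInt_point. Qed.

Lemma flow_INR n t : D t -> flow (INR n) t = INR n /\ flow (- INR n) t = - INR n.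
Proof.
  intros H. induction n as [|n [I1 I2]].
  - simpl. rewrite Ropp_0, flow_0. auto.
  - rewrite S_INR. split.
    + rewrite flow_shift by exact H. lra.
    + assert (E := flow_shift (- (INR n + 1)) t H).
      replace (- (INR n + 1) + 1) with (- INR n) in E by ring. lra.
Qed.

Lemma flow_surj x t : D t -> exists a, flow a t = x.
Proof.
  intros H. destruct (INR_unbounded (Rabs x)) as [n Hn].
  destruct (flow_INR n t H) as [H1 H2].
  apply Rabs_def2 in Hn.
  destruct (IVT_gen (fun y => flow y t) (- INR n) (INR n) x) as [a [_ Ha]].
  - intros y. apply continuity_pt_filterlim. apply (ex_derive_continuous (fun y => flow y t)).
    eexists. now apply flow_derive_x.
  - rewrite H1, H2, Rmin_left, Rmax_right by lra. lra.
  - now exists a.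
Qed.

Lemma flow_flow_inv x t : D t -> flow (flow_inv x t) t = x.
Proof.
  intros H. apply (epsilon_spec (inhabits 0) (fun a => flow a t = x)). now apply flow_surj.
Qed.

Lemma flow_inv_flow x t : D t -> flow_inv (flow x t) t = x.
Proof. intros H. apply (flow_inj t); [exact H|]. now apply flow_flow_inv. Qed.

Lemma flow_inv_shift x t : D t -> flow_inv (x + 1) t = flow_inv x t + 1.
Proof.
  intros H. apply (flow_inj t); [exact H|]. rewrite flow_shift, !flow_flow_inv by exact H. reflexivity.
Qed.

Lemma flow_inv_cont x t : D t -> continuity_2d_pt flow_inv x t.
Proof.
  intros H. apply (cont2d_implicit D flow).
  - now apply (lag_open _ _ _ _ _ L).
  - apply flow_incr.
  - intros y. apply (ex_derive_continuous (fun t => flow y t)). eexists. now apply flow_derive_t.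
  - intros; now apply flow_flow_inv.
Qed.

Let loc2D x t (P : R -> R -> Prop) : D t -> (forall y s, D s -> P y s) -> locally_2d P x t.
Proof.
  intros H HP. destruct (lag_open _ _ _ _ _ L t H) as [d Hd]. exists d. intros u v _ Hv.
  apply HP. now apply Hd.
Qed.

Lemma flow_inv_derive_x x t : D t ->
  is_derive (fun y => flow_inv y t) x (/ g (flow_inv x t) t).
Proof.
  intros H. assert (Hp := lag_g_pos _ _ _ _ _ L (flow_inv x t) t H).
  replace (/ g (flow_inv x t) t) with (- (-1) / g (flow_inv x t) t) by (field; lra).
  (* The Eulerian position takes the role of the time variable, at the fixed time [t]. *)
  apply (is_derive_implicit (fun y z => flow y t - z) (fun y _ => g y t) (fun y => flow_inv y t)).
  - exists (mkposreal 1 Rlt_0_1). intros u v _ _.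
    replace (g u t) with (g u t - 0) by ring.
    apply (is_derive_minus (fun y => flow y t) (fun _ => v)); [now apply flow_derive_x|].
    apply (is_derive_const (V := R_NormedModule)).
  - apply (cont2d_of_fst (fun y => g y t)). now apply g_cx.
  - apply (cont2d_fst flow_inv). now apply flow_inv_cont.
  - auto_derive; auto; ring.
  - apply filter_forall. intros y. rewrite !flow_flow_inv by exact H. ring.
  - lra.
Qed.

Lemma flow_inv_derive_t x t : D t ->
  is_derive (fun s => flow_inv x s) t (- euler_u x t / g (flow_inv x t) t).
Proof.
  intros H. assert (Hp := lag_g_pos _ _ _ _ _ L (flow_inv x t) t H).
  apply (is_derive_implicit flow g (fun s => flow_inv x s)).
  - apply loc2D; [exact H|]. intros; now apply flow_derive_x.
  - now apply (lag_g_cont _ _ _ _ _ L).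
  - apply (cont2d_snd flow_inv). now apply flow_inv_cont.
  - now apply flow_derive_t.
  - apply locD; [exact H|]. intros s Hs. now rewrite !flow_flow_inv.
  - lra.
Qed.

Lemma euler_u_derive_x x t : D t -> is_derive (fun y => euler_u y t) x (euler_ux x t).
Proof.
  intros H. assert (Hp := lag_g_pos _ _ _ _ _ L (flow_inv x t) t H).
  replace (euler_ux x t) with (scal (/ g (flow_inv x t) t) (V (flow_inv x t) t * g (flow_inv x t) t)).
  - apply (is_derive_comp (fun y => flow_vel y t) (fun y => flow_inv y t)).
    + now apply flow_vel_derive_x.
    + now apply flow_inv_derive_x.
  - unfold scal; simpl; unfold mult; simpl. unfold euler_ux. field. lra.
Qed.

Lemma euler_ux_derive_x x t : D t -> is_derive (fun y => euler_ux y t) x (euler_uxx x t).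
Proof.
  intros H. assert (Hp := lag_g_pos _ _ _ _ _ L (flow_inv x t) t H).
  replace (euler_uxx x t) with (scal (/ g (flow_inv x t) t) (Vx (flow_inv x t) t)).
  - apply (is_derive_comp (fun y => V y t) (fun y => flow_inv y t)).
    + now apply (lag_V_derive_x _ _ _ _ _ L).
    + now apply flow_inv_derive_x.
  - unfold scal; simpl; unfold mult; simpl. unfold euler_uxx. field. lra.
Qed.

Lemma euler_ux_derive_t x t : D t -> is_derive (fun s => euler_ux x s) t (euler_uxt x t).
Proof.
  intros H. assert (Hp := lag_g_pos _ _ _ _ _ L (flow_inv x t) t H).
  replace (euler_uxt x t) with
    (Vx (flow_inv x t) t * (- euler_u x t / g (flow_inv x t) t) +
     (lam * V (flow_inv x t) t ^ 2 - (lam + 1) * RInt (fun y => V y t ^ 2 * g y t) 0 1)).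
  - apply (is_derive_chain2 V Vx (fun s => flow_inv x s)).
    + apply loc2D; [exact H|]. intros; now apply (lag_V_derive_x _ _ _ _ _ L).
    + now apply (lag_Vx_cont _ _ _ _ _ L).
    + now apply flow_inv_derive_t.
    + now apply (lag_V_derive _ _ _ _ _ L).
  - unfold euler_uxt, euler_ux, euler_uxx. field. lra.
Qed.

Lemma cont2d_along_flow_inv (f : R -> R -> R) x t :
  D t -> continuity_2d_pt f (flow_inv x t) t -> continuity_2d_pt (fun x t => f (flow_inv x t) t) x t.
Proof.
  intros H Hf. apply (cont2d_compose f flow_inv (fun _ t => t)).
  - exact Hf.
  - now apply flow_inv_cont.
  - apply continuity_2d_pt_id2.
Qed.

Let sq_cont x t : D t -> continuity_2d_pt (fun x t => V x t ^ 2 * g x t) x t.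
Proof.
  intros H.
  apply (continuity_2d_pt_ext (fun x t => V x t * (V x t * g x t))); [intros; ring|].
  apply continuity_2d_pt_mult; [now apply (lag_V_cont _ _ _ _ _ L)|now apply Vg_cont].
Qed.

Lemma lag_energy_cont t : D t -> continuous (fun t => RInt (fun y => V y t ^ 2 * g y t) 0 1) t.
Proof.
  intros H. apply continuous_RInt_param.
  - intros; now apply sq_cont.
  - apply locD; [exact H|]. intros s Hs x. apply (cont2d_fst (fun x t => V x t ^ 2 * g x t)). now apply sq_cont.
Qed.

Let dVg x t : D t -> is_derive (fun s => V x s * g x s) t
   ((lam * V x t ^ 2 - (lam + 1) * RInt (fun y => V y t ^ 2 * g y t) 0 1) * g x t + V x t * (V x t * g x t)).
Proof.
  intros H. apply (is_derive_mult (fun s => V x s) (fun s => g x s)).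
  - now apply (lag_V_derive _ _ _ _ _ L).
  - now apply (lag_g_derive _ _ _ _ _ L).
  - intros; apply Rmult_comm.
Qed.

Let V2_cont x t : D t -> continuity_2d_pt (fun x t => lam * V x t ^ 2 - (lam + 1) * RInt (fun y => V y t ^ 2 * g y t) 0 1) x t.
Proof.
  intros H.
  apply (continuity_2d_pt_ext (fun x t => lam * (V x t * V x t) - (lam + 1) * RInt (fun y => V y t ^ 2 * g y t) 0 1)); [intros; ring|].
  apply continuity_2d_pt_minus; (apply continuity_2d_pt_mult; [apply continuity_2d_pt_const|]).
  - apply continuity_2d_pt_mult; now apply (lag_V_cont _ _ _ _ _ L).
  - apply (cont2d_of_snd (fun t => RInt (fun y => V y t ^ 2 * g y t) 0 1)). now apply lag_energy_cont.
Qed.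

(** Its spatial derivative [V g] is jointly continuous, and continuity in time follows by
    differentiating under the integral. *)
Lemma flow_vel_cont x t : D t -> continuity_2d_pt flow_vel x t.
Proof.
  intros H. apply (cont2d_of_is_derive_fst flow_vel (fun x t => V x t * g x t)).
  - apply loc2D; [exact H|]. intros; now apply flow_vel_derive_x.
  - now apply Vg_cont.
  - apply (ex_derive_continuous (fun t => flow_vel x t)). eexists.
    apply (is_derive_RInt_param_cont (fun a s => V a s * g a s) (fun x t =>
     (lam * V x t ^ 2 - (lam + 1) * RInt (fun y => V y t ^ 2 * g y t) 0 1) * g x t + V x t * (V x t * g x t))).
    + apply locD; [exact H|]. intros s Hs y. now apply dVg.
    + intros y. apply continuity_2d_pt_plus; apply continuity_2d_pt_mult.
      * now apply V2_cont.
      * now apply (lag_g_cont _ _ _ _ _ L).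
      * now apply (lag_V_cont _ _ _ _ _ L).
      * now apply Vg_cont.
    + apply locD; [exact H|]. intros s Hs y. apply (cont2d_fst (fun x t => V x t * g x t)). now apply Vg_cont.
Qed.

(** The integral is the time derivative of the total mass of [g], which is constantly 1. It makes
    [u] periodic and removes the linear term from the derivative of the energy. *)
Lemma lag_mean_zero t : D t -> RInt (fun a => V a t * g a t) 0 1 = 0.
Proof.
  intros H. change (flow_vel 1 t = 0).
  assert (H1 := flow_derive_t 1 t H).
  assert (H2 : is_derive (fun s => flow 1 s) t 0).
  { apply (is_derive_ext_loc (fun _ => 1)).
    - apply locD; [exact H|]. intros s Hs. symmetry. apply (lag_g_mass _ _ _ _ _ L); exact Hs.
    - apply (is_derive_const (V := R_NormedModule)). }
  rewrite <- (is_derive_unique _ _ _ H1). now apply is_derive_unique.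
Qed.

Lemma euler_u_periodic x t : D t -> euler_u (x + 1) t = euler_u x t.
Proof.
  intros H. unfold euler_u. rewrite flow_inv_shift by exact H. unfold flow_vel.
  rewrite RInt_shift_period.
  - rewrite lag_mean_zero by exact H. ring.
  - intros y. apply (cont2d_fst (fun x t => V x t * g x t)). now apply Vg_cont.
  - intros y. rewrite (lag_V_periodic _ _ _ _ _ L), (lag_g_periodic _ _ _ _ _ L) by exact H. reflexivity.
Qed.

(** Substituting [x = flow a t] turns every integral of [u_x] into an average over labels weighted
    by the Jacobian, so the inverse flow disappears from all norms. *)
Lemma euler_ux_change_var (phi : R -> R) t : D t -> (forall x, continuous phi x) ->
  Int01 (fun x => phi (euler_ux x t)) = RInt (fun a => phi (V a t) * g a t) 0 1.
Proof.
  intros H Hphi.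
  assert (Hc : forall x, continuous (fun y => phi (euler_ux y t)) x).
  { intros x. apply (continuous_comp (fun y => euler_ux y t) phi); [|apply Hphi].
    apply (ex_derive_continuous (fun y => euler_ux y t)). eexists. now apply euler_ux_derive_x. }
  rewrite Int01_RInt by now apply ex_RInt_cont.
  assert (E := RInt_comp (fun y => phi (euler_ux y t)) (fun y => flow y t) (fun y => g y t) 0 1).
  destruct (flow_INR 1 t H) as [E1 _]. simpl in E1.
  cbv beta in E. rewrite E1, flow_0 in E. rewrite <- E.
  - apply RInt_ext. intros x _. unfold euler_ux. rewrite flow_inv_flow by exact H.
    unfold scal; simpl; unfold mult; simpl. ring.
  - intros x _. apply Hc.
  - intros x _. split; [now apply flow_derive_x|now apply g_cx].
Qed.

Lemma continuous_pow_id n x : continuous (fun y => y ^ n) x.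
Proof. apply (ex_derive_continuous (fun y => y ^ n)). auto_derive. auto. Qed.

Lemma energy_euler t : D t -> energy euler_ux t = RInt (fun y => V y t ^ 2 * g y t) 0 1.
Proof.
  intros H. apply (euler_ux_change_var (fun y => y ^ 2)); [exact H|]. intros; apply continuous_pow_id.
Qed.

Lemma energy_euler_derive t : D t ->
  is_derive (energy euler_ux) t ((1 + 2 * lam) * RInt (fun y => V y t ^ 3 * g y t) 0 1).
Proof.
  intros H.
  apply (is_derive_ext_loc (fun t => RInt (fun y => V y t ^ 2 * g y t) 0 1)).
  { apply locD; [exact H|]. intros s Hs. symmetry. now apply energy_euler. }
  set (E := RInt (fun y => V y t ^ 2 * g y t) 0 1).
  assert (V3c : forall x, continuous (fun y => V y t ^ 3 * g y t) x).
  { intros x. apply (continuous_mult (fun y => V y t ^ 3) (fun y => g y t)); [|now apply g_cx].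
    apply (continuous_comp (fun y => V y t) (fun z => z ^ 3)); [now apply V_cx|apply continuous_pow_id]. }
  assert (Vgc : forall x, continuous (fun y => V y t * g y t) x).
  { intros x. apply (cont2d_fst (fun x t => V x t * g x t)). now apply Vg_cont. }
  replace ((1 + 2 * lam) * RInt (fun y => V y t ^ 3 * g y t) 0 1) with
    (RInt (fun x => ((lam * V x t ^ 2 - (lam + 1) * E) * (V x t * g x t)
      + V x t * ((lam * V x t ^ 2 - (lam + 1) * E) * g x t + V x t * (V x t * g x t)))) 0 1).
  - apply (is_derive_RInt_param_cont (fun x t => V x t ^ 2 * g x t) (fun x t =>
      ((lam * V x t ^ 2 - (lam + 1) * RInt (fun y => V y t ^ 2 * g y t) 0 1) * (V x t * g x t)
      + V x t * ((lam * V x t ^ 2 - (lam + 1) * RInt (fun y => V y t ^ 2 * g y t) 0 1) * g x t + V x t * (V x t * g x t))))).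
    + apply locD; [exact H|]. intros s Hs y.
      apply (is_derive_ext (fun s => V y s * (V y s * g y s))); [intros r; change (V y r * (V y r * g y r) = V y r ^ 2 * g y r); ring|].
      apply (is_derive_mult (fun s => V y s) (fun s => V y s * g y s)).
      * now apply (lag_V_derive _ _ _ _ _ L).
      * now apply dVg.
      * intros; apply Rmult_comm.
    + intros x. apply continuity_2d_pt_plus; apply continuity_2d_pt_mult.
      * now apply V2_cont.
      * now apply Vg_cont.
      * now apply (lag_V_cont _ _ _ _ _ L).
      * apply continuity_2d_pt_plus; apply continuity_2d_pt_mult.
        -- now apply V2_cont.
        -- now apply (lag_g_cont _ _ _ _ _ L).
        -- now apply (lag_V_cont _ _ _ _ _ L).
        -- now apply Vg_cont.
    + apply locD; [exact H|]. intros s Hs x. apply (cont2d_fst (fun x t => V x t ^ 2 * g x t)). now apply sq_cont.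
  (* Two thirds-order contributions, [2 lam V^3 g] from the growth of [V] and [V^3 g] from that of
     the Jacobian, make the factor [1 + 2 lam]. The nonlocal part is a multiple of [V g], whose mean
     is zero. *)
  - rewrite (RInt_extR _ (fun x => (1 + 2 * lam) * (V x t ^ 3 * g x t) - (2 * (lam + 1) * E) * (V x t * g x t)))
      by (intros; ring).
    rewrite (RInt_minus (V := R_CompleteNormedModule) (fun x => (1 + 2 * lam) * (V x t ^ 3 * g x t)) (fun x => (2 * (lam + 1) * E) * (V x t * g x t))).
    + rewrite (RInt_scal (V := R_CompleteNormedModule) (fun x => V x t ^ 3 * g x t)) by now apply ex_RInt_cont.
      rewrite (RInt_scal (V := R_CompleteNormedModule) (fun x => V x t * g x t)) by now apply ex_RInt_cont.
      rewrite lag_mean_zero by exact H.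
      unfold minus, plus, opp, scal; simpl. unfold mult; simpl. ring.
    + apply (ex_RInt_scal (V := R_CompleteNormedModule) (fun x => V x t ^ 3 * g x t)). now apply ex_RInt_cont.
    + apply (ex_RInt_scal (V := R_CompleteNormedModule) (fun x => V x t * g x t)). now apply ex_RInt_cont.
Qed.

Lemma cont_on_strip_of_cont2d (T : option R) (f : R -> R -> R) :
  (forall x t, 0 <= t -> before T t -> continuity_2d_pt f x t) -> cont_on_strip T f.
Proof.
  intros H x t H0 Ht eps Heps. destruct (H x t H0 Ht (mkposreal _ Heps)) as [d Hd].
  exists d. split; [apply cond_pos|]. intros y s _ _ Hy Hs. now apply Hd.
Qed.

Lemma euler_is_solution (T : option R) (u0 : R -> R) :
  (forall s, T = Some s -> 0 < s) ->
  (forall t, 0 <= t -> before T t -> D t) ->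
  D 0 ->
  (forall x, g x 0 = 1) ->
  u0 0 = 0 -> (forall x, is_derive u0 x (V x 0)) ->
  is_solution lam u0 T euler_u euler_ux euler_uxx euler_uxt.
Proof.
  intros HT HD D0 Hg0 Hu0 Hdu0.
  split; [exact HT|]. split.
  { intros x t H0 Ht. split; apply is_derive_Reals.
    - apply euler_u_derive_x; auto.
    - apply euler_ux_derive_x; auto. }
  split.
  { intros x t H0 Ht. apply is_derive_Reals. apply euler_ux_derive_t. apply HD; [lra|exact Ht]. }
  split.
  { apply cont_on_strip_of_cont2d. intros x t H0 Ht. assert (H := HD t H0 Ht).
    apply cont2d_along_flow_inv; [exact H|]. now apply flow_vel_cont. }
  split.
  { apply cont_on_strip_of_cont2d. intros x t H0 Ht. assert (H := HD t H0 Ht).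
    apply cont2d_along_flow_inv; [exact H|]. now apply (lag_V_cont _ _ _ _ _ L). }
  split.
  { apply cont_on_strip_of_cont2d. intros x t H0 Ht. assert (H := HD t H0 Ht).
    apply (cont2d_along_flow_inv (fun x t => Vx x t / g x t)); [exact H|].
    apply continuity_2d_pt_mult; [now apply (lag_Vx_cont _ _ _ _ _ L)|].
    apply continuity_2d_pt_inv; [now apply (lag_g_cont _ _ _ _ _ L)|].
    generalize (lag_g_pos _ _ _ _ _ L (flow_inv x t) t H); lra. }
  split.
  { intros x t H0 Ht. apply euler_u_periodic; auto. }
  split.
  { intros x.
    assert (F0 : forall y, flow y 0 = y).
    { intros y. unfold flow. rewrite (RInt_ext _ (fun _ => 1)) by (intros; apply Hg0).
      rewrite (RInt_const (V := R_CompleteNormedModule)). unfold scal; simpl; unfold mult; simpl. ring. }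
    assert (A0 : flow_inv x 0 = x) by (rewrite <- (F0 x) at 1; now apply flow_inv_flow).
    unfold euler_u. rewrite A0.
    (* At time 0 the flow is the identity, and [flow_vel] and [u0] have the same derivative and both
       vanish at 0. *)
    assert (E := const_of_derive_0 (fun y => flow_vel y 0 - u0 y)).
    assert (E1 : flow_vel x 0 - u0 x = flow_vel 0 0 - u0 0).
    { apply E. intros y. apply (is_derive_val _ _ (V y 0 * g y 0 - V y 0)); [|rewrite Hg0; ring].
      apply (is_derive_minus (fun y => flow_vel y 0) u0); [now apply flow_vel_derive_x|apply Hdu0]. }
    unfold flow_vel in E1 at 2. rewrite RInt_point in E1. unfold zero in E1; simpl in E1. lra. }
  intros x t H0 Ht.
  assert (H : D t) by (apply HD; [lra|exact Ht]).
  change (Int01 (fun y => euler_ux y t ^ 2)) with (energy euler_ux t).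
  rewrite energy_euler by exact H. unfold euler_uxt. ring.
Qed.

End Flow.

(** * The explicit kernel in the variable [eta] *)

Lemma is_derive_Rpower_comp (f : R -> R) (x l a : R) :
  0 < f x -> is_derive f x l ->
  is_derive (fun y => Rpower (f y) a) x (a * Rpower (f x) a * (l / f x)).
Proof.
  intros Hf Hd. unfold Rpower.
  assert (Hx : ex_derive f x) by (now exists l).
  assert (E : Derive (fun y => f y) x = l) by (now apply is_derive_unique).
  auto_derive; [auto|]. rewrite E. field. lra.
Qed.

Lemma continuous_Rpower (a x : R) : 0 < x -> continuous (fun y => Rpower y a) x.
Proof.
  intros H. apply (ex_derive_continuous (fun y => Rpower y a)). eexists.
  apply (is_derive_Rpower_comp (fun y => y) x 1); [exact H|]. apply (is_derive_id (K := R_AbsRing)).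
Qed.

Lemma Rpower_pos (x a : R) : 0 < Rpower x a.
Proof. apply exp_pos. Qed.

Definition cs (x : R) : R := cos (2 * PI * x).

Lemma cs_bound x : -1 <= cs x <= 1.
Proof. apply COS_bound. Qed.

Lemma cs_shift x : cs (x + 1) = cs x.
Proof.
  unfold cs. replace (2 * PI * (x + 1)) with (2 * PI * x + 2 * INR 1 * PI) by (simpl; ring).
  apply cos_period.
Qed.

Lemma cs_derive x : is_derive cs x (- (2 * PI) * sin (2 * PI * x)).
Proof. unfold cs. auto_derive; auto. ring. Qed.

Lemma cs_cont x : continuous cs x.
Proof. apply (ex_derive_continuous cs). eexists. apply cs_derive. Qed.

Section Kernel.
Variable lam : R.

Definition dom (e : R) : Prop := -1 < lam * e < 1.
Definition jac (x e : R) : R := 1 - lam * e * cs x.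
(** The exponential is the limit of the power as [lam] tends to 0. Both branches satisfy [W' = W h]
    in [e], with [h = hq], and only this relation is used to build the solution. *)
Definition wgt (x e : R) : R :=
  if Req_EM_T lam 0 then exp (e * cs x) else Rpower (jac x e) (- / lam).
Definition hq (x e : R) : R := cs x / jac x e.
Definition mom (i : nat) (e : R) : R := RInt (fun x => wgt x e * hq x e ^ i) 0 1.

Lemma dom_open e : dom e -> locally e dom.
Proof.
  intros [H1 H2].
  assert (Hc : continuous (fun e => lam * e) e).
  { apply (ex_derive_continuous (fun e => lam * e)). auto_derive; auto. }
  assert (P : 0 < Rmin (lam * e + 1) (1 - lam * e)) by (apply Rmin_pos; lra).
  generalize (proj1 (filterlim_locally _ _) Hc (mkposreal _ P)). apply filter_imp. intros y Hy.
  change (Rabs (lam * y - lam * e) < Rmin (lam * e + 1) (1 - lam * e)) in Hy.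
  assert (A1 := Rmin_l (lam * e + 1) (1 - lam * e)). assert (A2 := Rmin_r (lam * e + 1) (1 - lam * e)).
  apply Rabs_def2 in Hy. unfold dom. lra.
Qed.

Lemma dom_between e e' y : dom e -> dom e' -> Rmin e e' <= y <= Rmax e e' -> dom y.
Proof.
  intros H H' Hy.
  assert (Hw : forall u v, dom u -> dom v -> u <= y <= v -> dom y).
  { unfold dom. intros u v Hu Hv Huv. destruct (Rle_lt_dec 0 lam) as [P|P].
    - assert (0 <= lam * (y - u)) by (apply Rmult_le_pos; lra).
      assert (0 <= lam * (v - y)) by (apply Rmult_le_pos; lra). lra.
    - assert (0 <= - lam * (y - u)) by (apply Rmult_le_pos; lra).
      assert (0 <= - lam * (v - y)) by (apply Rmult_le_pos; lra). lra. }
  unfold Rmin, Rmax in Hy. destruct (Rle_dec e e'); eauto.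
Qed.

Lemma dom_0 : dom 0.
Proof. unfold dom. lra. Qed.

Lemma jac_pos x e : dom e -> 0 < jac x e.
Proof.
  intros [H1 H2]. unfold jac. destruct (cs_bound x) as [B1 B2].
  assert (H : Rabs (lam * e * cs x) < 1).
  { rewrite Rabs_mult. apply Rle_lt_trans with (Rabs (lam * e) * 1).
    - apply Rmult_le_compat_l; [apply Rabs_pos|]. apply Rabs_le. lra.
    - rewrite Rmult_1_r. apply Rabs_def1; lra. }
  apply Rabs_def2 in H. lra.
Qed.

Lemma jac_cont x e : continuity_2d_pt jac x e.
Proof.
  unfold jac. apply continuity_2d_pt_minus; [apply continuity_2d_pt_const|].
  apply continuity_2d_pt_mult.
  - apply continuity_2d_pt_mult; [apply continuity_2d_pt_const|apply continuity_2d_pt_id2].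
  - apply (cont2d_of_fst cs). apply cs_cont.
Qed.

Lemma hq_cont x e : dom e -> continuity_2d_pt hq x e.
Proof.
  intros H. apply continuity_2d_pt_mult; [apply (cont2d_of_fst cs), cs_cont|].
  apply continuity_2d_pt_inv; [apply jac_cont|]. generalize (jac_pos x e H); lra.
Qed.

Lemma wgt_pos x e : 0 < wgt x e.
Proof. unfold wgt. destruct (Req_EM_T lam 0); [apply exp_pos|apply Rpower_pos]. Qed.

Lemma wgt_cont x e : dom e -> continuity_2d_pt wgt x e.
Proof.
  intros H. unfold wgt. destruct (Req_EM_T lam 0) as [E|N].
  - apply (continuity_1d_2d_pt_comp exp (fun x e => e * cs x)).
    + apply derivable_continuous_pt, derivable_pt_exp.
    + apply continuity_2d_pt_mult; [apply continuity_2d_pt_id2|apply (cont2d_of_fst cs), cs_cont].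
  - apply (continuity_1d_2d_pt_comp (fun y => Rpower y (- / lam)) jac).
    + apply continuity_pt_filterlim. apply continuous_Rpower. now apply jac_pos.
    + apply jac_cont.
Qed.

Lemma wgt_derive x e : dom e -> is_derive (fun s => wgt x s) e (wgt x e * hq x e).
Proof.
  intros H. assert (J := jac_pos x e H). unfold wgt, hq. destruct (Req_EM_T lam 0) as [E|N].
  - assert (J1 : jac x e = 1) by (unfold jac; rewrite E; ring).
    rewrite J1. auto_derive; auto. field.
  - eapply is_derive_val.
    + apply (is_derive_Rpower_comp (fun s => jac x s) e (- lam * cs x) (- / lam)); [exact J|].
      unfold jac. auto_derive; auto. ring.
    + cbv beta. field. split; [lra|exact N].
Qed.

Lemma hq_derive x e : dom e -> is_derive (fun s => hq x s) e (lam * hq x e ^ 2).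
Proof.
  intros H. assert (J := jac_pos x e H). unfold hq, jac in *. auto_derive; [lra|]. field. lra.
Qed.

Lemma hq_derive_x x e : dom e ->
  is_derive (fun y => hq y e) x (- (2 * PI) * sin (2 * PI * x) / jac x e ^ 2).
Proof.
  intros H. assert (J := jac_pos x e H). unfold hq, jac, cs in *.
  auto_derive; [lra|]. field. lra.
Qed.

Lemma wgt_shift x e : wgt (x + 1) e = wgt x e.
Proof. unfold wgt, jac. now rewrite cs_shift. Qed.

Lemma hq_shift x e : hq (x + 1) e = hq x e.
Proof. unfold hq, jac. now rewrite cs_shift. Qed.

Lemma wgt_0 x : wgt x 0 = 1.
Proof.
  unfold wgt, jac. destruct (Req_EM_T lam 0).
  - now rewrite Rmult_0_l, exp_0.
  - unfold Rpower. replace (1 - lam * 0 * cs x) with 1 by ring. now rewrite ln_1, Rmult_0_r, exp_0.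
Qed.

Lemma hq_pow_cont i x e : dom e -> continuity_2d_pt (fun x e => hq x e ^ i) x e.
Proof.
  intros H. apply (continuity_1d_2d_pt_comp (fun y => y ^ i) hq).
  - apply continuity_pt_filterlim. apply continuous_pow_id.
  - now apply hq_cont.
Qed.

Lemma mom_integrand_cont i x e : dom e -> continuity_2d_pt (fun x e => wgt x e * hq x e ^ i) x e.
Proof. intros H. apply continuity_2d_pt_mult; [now apply wgt_cont|now apply hq_pow_cont]. Qed.

Lemma mom_integrand_cx i x e : dom e -> continuous (fun y => wgt y e * hq y e ^ i) x.
Proof. intros H. apply (cont2d_fst (fun x e => wgt x e * hq x e ^ i)). now apply mom_integrand_cont. Qed.

(** From [W' = W h] and [h' = lam h^2], the integrand [W h^i] has the derivative
    [(1 + i lam) W h^(i+1)]: the moments form a closed chain. *)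
Lemma mom_derive i e : dom e -> is_derive (mom i) e ((1 + INR i * lam) * mom (S i) e).
Proof.
  intros H.
  eapply is_derive_val.
  - apply (is_derive_RInt_param_cont (fun x e => wgt x e * hq x e ^ i)
      (fun x e => (1 + INR i * lam) * (wgt x e * hq x e ^ (S i)))).
    + generalize (dom_open e H). apply filter_imp. intros s Hs x.
      eapply is_derive_val.
      * apply (is_derive_mult (fun s => wgt x s) (fun s => hq x s ^ i)).
        -- now apply wgt_derive.
        -- apply (is_derive_pow (fun s => hq x s)). now apply hq_derive.
        -- intros; apply Rmult_comm.
      * unfold plus, mult; simpl. destruct i as [|i]; [simpl; ring|]. rewrite <- pred_Sn.
        rewrite S_INR. simpl. ring.
    + intros x. apply continuity_2d_pt_mult; [apply continuity_2d_pt_const|now apply mom_integrand_cont].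
    + generalize (dom_open e H). apply filter_imp. intros s Hs x. now apply mom_integrand_cx.
  - apply (RInt_scal (V := R_CompleteNormedModule) (fun x => wgt x e * hq x e ^ S i)).
    apply ex_RInt_cont. intros; now apply mom_integrand_cx.
Qed.

Lemma mom_cont i e : dom e -> continuous (mom i) e.
Proof. intros H. apply (ex_derive_continuous (mom i)). eexists. now apply mom_derive. Qed.

Lemma mom0_pos e : dom e -> 0 < mom 0 e.
Proof.
  intros H. apply RInt_gt_0; [lra| |].
  - intros x _. simpl. rewrite Rmult_1_r. apply wgt_pos.
  - intros x _. now apply mom_integrand_cx.
Qed.

(** [kap] is the mean of [hq] under the density [kerg], and [spd] is [d eta / dt]. The logarithmic
    derivative of [kerg] in [e] is [hq - kap], so [kerV] is its logarithmic derivative in time, as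
    [u_x] must be along the flow. *)
Definition kap (e : R) : R := mom 1 e / mom 0 e.
Definition spd (e : R) : R := Rpower (mom 0 e) (- (2 * lam)).
Definition kerg (x e : R) : R := wgt x e / mom 0 e.
Definition kerV (x e : R) : R := spd e * (hq x e - kap e).
Definition kerVx (x e : R) : R := spd e * (- (2 * PI) * sin (2 * PI * x) / jac x e ^ 2).

Lemma kernel_mass e : dom e -> RInt (fun x => kerg x e) 0 1 = 1.
Proof.
  intros De. assert (P := mom0_pos e De).
  rewrite (RInt_extR _ (fun x => / mom 0 e * (wgt x e * hq x e ^ 0))).
  2: { intros x. unfold kerg. simpl. field. lra. }
  rewrite (RInt_scal (V := R_CompleteNormedModule) (fun x => wgt x e * hq x e ^ 0)).
  - apply Rinv_l. apply Rgt_not_eq, P.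
  - apply ex_RInt_cont. intros; now apply mom_integrand_cx.
Qed.

Lemma spd_derive e : dom e -> is_derive spd e (- (2 * lam) * kap e * spd e).
Proof.
  intros H. assert (P := mom0_pos e H). eapply is_derive_val.
  - apply (is_derive_Rpower_comp (mom 0)); [exact P|now apply mom_derive].
  - unfold kap, spd. simpl INR. field. lra.
Qed.

Lemma kap_derive e : dom e -> is_derive kap e ((1 + lam) * (mom 2 e / mom 0 e) - kap e ^ 2).
Proof.
  intros H. assert (P := mom0_pos e H). eapply is_derive_val.
  - apply (is_derive_div (mom 1) (mom 0)); [now apply mom_derive|now apply mom_derive|lra].
  - unfold kap, minus, plus, opp, mult, scal; simpl. field. lra.
Qed.

Lemma kerg_derive x e : dom e -> is_derive (fun s => kerg x s) e (kerg x e * (hq x e - kap e)).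
Proof.
  intros H. assert (P := mom0_pos e H). eapply is_derive_val.
  - apply (is_derive_div (fun s => wgt x s) (mom 0)); [now apply wgt_derive|now apply mom_derive|lra].
  - unfold kerg, kap, minus, plus, opp, mult, scal; simpl. field. lra.
Qed.

Lemma kerV_derive x e : dom e -> is_derive (fun s => kerV x s) e
  (- (2 * lam) * kap e * spd e * (hq x e - kap e)
   + spd e * (lam * hq x e ^ 2 - ((1 + lam) * (mom 2 e / mom 0 e) - kap e ^ 2))).
Proof.
  intros H. eapply is_derive_val.
  - apply (is_derive_mult spd (fun s => hq x s - kap s)).
    + now apply spd_derive.
    + apply (is_derive_minus (fun s => hq x s) kap); [now apply hq_derive|now apply kap_derive].
    + intros; apply Rmult_comm.
  - unfold minus, plus, opp, mult; simpl. ring.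
Qed.

(** This is the nonlocal term of the equation. With it, [spd] times the derivative of [kerV] in [e]
    becomes the right-hand side required by [lag_V_derive]. *)
Lemma kerV_second_moment e : dom e ->
  RInt (fun x => kerV x e ^ 2 * kerg x e) 0 1 = spd e ^ 2 * (mom 2 e / mom 0 e - kap e ^ 2).
Proof.
  intros H. assert (P := mom0_pos e H).
  rewrite (RInt_extR _ (fun x => spd e ^ 2 / mom 0 e * (wgt x e * hq x e ^ 2)
     + (- (2 * kap e * spd e ^ 2 / mom 0 e) * (wgt x e * hq x e ^ 1)
     + spd e ^ 2 * kap e ^ 2 / mom 0 e * (wgt x e * hq x e ^ 0)))).
  2: { intros x. unfold kerV, kerg. field. lra. }
  assert (Ei : forall c i, ex_RInt (fun x => c * (wgt x e * hq x e ^ i)) 0 1).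
  { intros c i. apply (ex_RInt_scal (V := R_CompleteNormedModule) (fun x => wgt x e * hq x e ^ i)).
    apply ex_RInt_cont. intros; now apply mom_integrand_cx. }
  rewrite (RInt_plus (V := R_CompleteNormedModule) (fun x => spd e ^ 2 / mom 0 e * (wgt x e * hq x e ^ 2)));
    [|apply Ei|apply (ex_RInt_plus (V := R_CompleteNormedModule)); apply Ei].
  rewrite (RInt_plus (V := R_CompleteNormedModule) (fun x => - (2 * kap e * spd e ^ 2 / mom 0 e) * (wgt x e * hq x e ^ 1)));
    [|apply Ei|apply Ei].
  assert (Er : forall c i, RInt (fun x => c * (wgt x e * hq x e ^ i)) 0 1 = c * mom i e).
  { intros c i. apply (RInt_scal (V := R_CompleteNormedModule) (fun x => wgt x e * hq x e ^ i)).
    apply ex_RInt_cont. intros; now apply mom_integrand_cx. }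
  rewrite !Er. unfold plus; simpl. unfold kap. field. lra.
Qed.

(** * Time as a function of [eta], and the lifespan *)

(** Separation of variables: the inverse of this integral solves [eta' = spd eta], so no existence
    theorem for differential equations is called upon. *)
Definition clock (e : R) : R := RInt (fun s => Rpower (mom 0 s) (2 * lam)) 0 e.

Lemma clock_integrand_cont e : dom e -> continuous (fun s => Rpower (mom 0 s) (2 * lam)) e.
Proof.
  intros H. apply (continuous_comp (mom 0) (fun y => Rpower y (2 * lam))).
  - now apply mom_cont.
  - apply continuous_Rpower. now apply mom0_pos.
Qed.

Lemma ex_RInt_clock e e' : dom e -> dom e' -> ex_RInt (fun s => Rpower (mom 0 s) (2 * lam)) e e'.
Proof.
  intros H H'. apply (ex_RInt_continuous (V := R_CompleteNormedModule)). intros y Hy.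
  apply clock_integrand_cont. now apply (dom_between e e').
Qed.

Lemma clock_derive e : dom e -> is_derive clock e (Rpower (mom 0 e) (2 * lam)).
Proof.
  intros H. apply (is_derive_RInt (fun s => Rpower (mom 0 s) (2 * lam)) _ 0).
  - generalize (dom_open e H). apply filter_imp. intros y Hy.
    apply (RInt_correct (V := R_CompleteNormedModule)). apply ex_RInt_clock; [apply dom_0|exact Hy].
  - now apply clock_integrand_cont.
Qed.

Lemma clock_cont e : dom e -> continuous clock e.
Proof. intros H. apply (ex_derive_continuous clock). eexists. now apply clock_derive. Qed.

Lemma clock_incr e e' : dom e -> dom e' -> e < e' -> clock e < clock e'.
Proof.
  intros H H' Hl.
  assert (HB : forall x, Rmin e e' <= x <= Rmax e e' -> dom x) by (intros; now apply (dom_between e e')).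
  destruct (MVT_gen clock e e' (fun e => Rpower (mom 0 e) (2 * lam))) as [c [Hc E]].
  - intros x Hx. apply clock_derive, HB. lra.
  - intros x Hx. apply continuity_pt_filterlim. now apply clock_cont, HB.
  - assert (0 < Rpower (mom 0 c) (2 * lam) * (e' - e)) by (apply Rmult_lt_0_compat; [apply Rpower_pos|lra]). lra.
Qed.

Lemma clock_0 : clock 0 = 0.
Proof. unfold clock. now rewrite RInt_point. Qed.

Lemma clock_inj e e' : dom e -> dom e' -> clock e = clock e' -> e = e'.
Proof.
  intros H H' E. destruct (Rtotal_order e e') as [h|[h|h]]; [|exact h|];
  apply clock_incr in h; trivial; lra.
Qed.

Lemma clock_le_inv e e' : dom e -> dom e' -> clock e < clock e' -> e < e'.
Proof.
  intros H H' E. apply Rnot_le_lt. intros N. destruct N as [N|N].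
  - apply clock_incr in N; trivial; lra.
  - subst; lra.
Qed.

Lemma clock_IVT e e' t : dom e -> dom e' -> clock e < t < clock e' ->
  exists z, dom z /\ e <= z <= e' /\ clock z = t.
Proof.
  intros H H' Ht.
  assert (Hl : e < e') by (apply clock_le_inv; trivial; lra).
  destruct (Ranalysis5.IVT_interv (fun z => clock z - t) e e') as [z [Hz E]]; try lra.
  - intros z Hz. apply continuity_pt_filterlim.
    apply (continuous_minus clock (fun _ => t)); [|apply continuous_const].
    apply clock_cont. apply (dom_between e e'); trivial. rewrite Rmin_left, Rmax_right; lra.
  - exists z. split; [|split; [exact Hz|lra]].
    apply (dom_between e e'); trivial. rewrite Rmin_left, Rmax_right; lra.
Qed.

Lemma dom_right e : dom e -> exists e', e < e' /\ dom e'.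
Proof.
  intros H. destruct (dom_open e H) as [d Hd]. exists (e + d / 2). assert (P := cond_pos d).
  split; [lra|]. apply Hd. change (Rabs (e + d / 2 - e) < d). rewrite Rabs_pos_eq; lra.
Qed.

(** The lifespan is the supremum of [clock] over the nonnegative part of [dom], and [None] when
    there is no upper bound. Since [dom] is open and [clock] increasing, the supremum is not
    attained; the intermediate value theorem reaches every earlier time. *)
Lemma lifespan_exists : exists T : option R,
  (forall s, T = Some s -> 0 < s) /\
  (forall e, dom e -> before T (clock e)) /\
  (forall t, 0 <= t -> before T t -> exists e, 0 <= e /\ dom e /\ clock e = t) /\
  (forall M, (forall e, 0 <= e -> dom e -> clock e <= M) -> exists s, T = Some s) /\
  ((forall M, exists e, 0 <= e /\ dom e /\ M < clock e) -> T = None).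
Proof.
  set (E := fun y => exists e, 0 <= e /\ dom e /\ clock e = y).
  destruct (excluded_middle_informative (bound E)) as [B|B].
  - destruct (completeness E B) as [s [Hs1 Hs2]].
    { exists (clock 0). exists 0. split; [lra|]. split; [apply dom_0|reflexivity]. }
    assert (Hlt : forall e, dom e -> clock e < s).
    { intros e He. destruct (Rle_lt_dec 0 e) as [P|N].
      - destruct (dom_right e He) as [e' [H1 H2]].
        apply Rlt_le_trans with (clock e'); [now apply clock_incr|].
        apply Hs1. exists e'. split; [lra|]. auto.
      - destruct (dom_right 0 dom_0) as [e' [H1 H2]].
        apply Rlt_le_trans with (clock e'); [apply clock_incr; trivial; lra|].
        apply Hs1. exists e'. split; [lra|]. auto. }
    exists (Some s). split; [|split; [|split; [|split]]].
    + intros s' [= <-]. rewrite <- clock_0. apply Hlt, dom_0.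
    + exact Hlt.
    + simpl. intros t H0 Ht. destruct H0 as [H0|<-].
      2: { exists 0. split; [lra|]. split; [apply dom_0|apply clock_0]. }
      assert (HE : exists e, 0 <= e /\ dom e /\ t < clock e).
      { apply NNPP. intros N. assert (s <= t); [|lra]. apply Hs2. intros y (e & He & De & <-).
        apply Rnot_lt_le. intros Hy. apply N. now exists e. }
      destruct HE as (e & He & De & Hte).
      destruct (clock_IVT 0 e t) as (z & Dz & Hz & Ez); [apply dom_0|exact De|rewrite clock_0; lra|].
      exists z. split; [lra|]. auto.
    + intros; now exists s.
    + intros HM. destruct (HM s) as (e & H1 & H2 & H3). generalize (Hlt e H2); lra.
  - assert (HM : forall M, exists e, 0 <= e /\ dom e /\ M < clock e).
    { intros M. apply NNPP. intros N. apply B. exists M. intros y (e & He & De & <-).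
      apply Rnot_lt_le. intros Hy. apply N. now exists e. }
    exists None. split; [|split; [|split; [|split]]].
    + discriminate.
    + exact (fun _ _ => I).
    + intros t H0 _. destruct H0 as [H0|<-].
      2: { exists 0. split; [lra|]. split; [apply dom_0|apply clock_0]. }
      destruct (HM t) as (e & He & De & Hte).
      destruct (clock_IVT 0 e t) as (z & Dz & Hz & Ez); [apply dom_0|exact De|rewrite clock_0; lra|].
      exists z. split; [lra|]. auto.
    + intros M H. destruct (HM M) as (e & H1 & H2 & H3). generalize (H e H1 H2); lra.
    + reflexivity.
Qed.

(* A time slightly before 0 makes every time derivative two-sided. *)
Lemma dom_left_of_0 : exists e, e < 0 /\ dom e.
Proof.
  destruct (dom_open 0 dom_0) as [d Hd]. exists (- (d / 2)). assert (P := cond_pos d).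
  split; [lra|]. apply Hd. change (Rabs (- (d / 2) - 0) < d). rewrite Rabs_left; lra.
Qed.

(** [D] is an open set of times containing the whole existence interval, so [eta] has ordinary
    derivatives at time 0 as well. *)
Record clock_inverse (T : option R) (D : R -> Prop) (eta : R -> R) : Prop := {
  ci_open : forall t, D t -> locally t D;
  ci_strip : forall t, 0 <= t -> before T t -> D t;
  ci_T_pos : forall s, T = Some s -> 0 < s;
  ci_dom : forall t, D t -> dom (eta t);
  ci_nonneg : forall t, 0 <= t -> before T t -> 0 <= eta t;
  ci_eq : forall t, D t -> clock (eta t) = t;
  ci_before : forall e, dom e -> before T (clock e);
  ci_finite : forall M, (forall e, 0 <= e -> dom e -> clock e <= M) -> exists s, T = Some s;
  ci_infinite : (forall M, exists e, 0 <= e /\ dom e /\ M < clock e) -> T = None }.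

Lemma before_open T t : before T t -> locally t (before T).
Proof.
  destruct T as [s|]; simpl; [|intros; now apply filter_forall].
  intros H. assert (P : 0 < s - t) by lra. exists (mkposreal _ P). intros y Hy.
  change (Rabs (y - t) < s - t) in Hy. apply Rabs_def2 in Hy. simpl; lra.
Qed.

Lemma clock_inverse_exists : exists T D eta, clock_inverse T D eta.
Proof.
  destruct lifespan_exists as (T & HT & HB & HS & HF & HI).
  destruct dom_left_of_0 as (e0 & He0 & De0).
  set (D := fun t => clock e0 < t /\ before T t).
  set (eta := fun t => epsilon (inhabits 0) (fun e => dom e /\ clock e = t)).
  assert (Hneg : clock e0 < 0) by (rewrite <- clock_0; apply clock_incr; trivial; apply dom_0).
  assert (Hex : forall t, D t -> exists e, dom e /\ clock e = t).
  { intros t [H1 H2]. destruct (Rle_lt_dec 0 t) as [P|N].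
    - destruct (HS t P H2) as (e & _ & E1 & E2). now exists e.
    - destruct (clock_IVT e0 0 t) as (z & Dz & Hz & Ez); [exact De0|apply dom_0|rewrite clock_0; lra|].
      now exists z. }
  assert (Hs : forall t, D t -> dom (eta t) /\ clock (eta t) = t).
  { intros t Ht. apply (epsilon_spec (inhabits 0) (fun e => dom e /\ clock e = t)). now apply Hex. }
  assert (Hstrip : forall t, 0 <= t -> before T t -> D t) by (intros t H0 Ht; split; [lra|exact Ht]).
  exists T, D, eta. constructor; trivial.
  - intros t [H1 H2]. apply filter_and; [|now apply before_open].
    assert (P : 0 < t - clock e0) by lra. exists (mkposreal _ P). intros y Hy.
    change (Rabs (y - t) < t - clock e0) in Hy. apply Rabs_def2 in Hy. lra.
  - intros t Ht. now apply Hs.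
  - intros t H0 Ht. destruct (Hs t (Hstrip t H0 Ht)) as [H1 H2].
    apply Rnot_lt_le. intros N. apply clock_incr in N; trivial; [|apply dom_0]. rewrite clock_0 in N. lra.
  - intros t Ht. now apply Hs.
Qed.

Section Time.
Variables (T : option R) (D : R -> Prop) (eta : R -> R).
Hypothesis CI : clock_inverse T D eta.

Lemma eta_0 : D 0 -> eta 0 = 0.
Proof.
  intros H. apply clock_inj; [now apply (ci_dom _ _ _ CI)|apply dom_0|].
  rewrite clock_0. now apply (ci_eq _ _ _ CI).
Qed.

Lemma eta_cont t : D t -> continuous eta t.
Proof.
  intros H. apply filterlim_locally. intros eps.
  assert (De := ci_dom _ _ _ CI t H). assert (Ee := ci_eq _ _ _ CI t H).
  destruct (dom_open _ De) as [d Hd].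
  set (h := Rmin d eps / 2).
  assert (Hh : 0 < h) by (unfold h; apply Rdiv_lt_0_compat; [apply Rmin_pos; apply cond_pos|lra]).
  assert (Hh1 : h < d) by (unfold h; generalize (Rmin_l d eps) (cond_pos d); unfold h in Hh; lra).
  assert (Hh2 : h < eps) by (unfold h; generalize (Rmin_r d eps) (cond_pos eps); unfold h in Hh; lra).
  assert (D1 : dom (eta t - h)).
  { apply Hd. change (Rabs (eta t - h - eta t) < d). rewrite Rabs_left; lra. }
  assert (D2 : dom (eta t + h)).
  { apply Hd. change (Rabs (eta t + h - eta t) < d). rewrite Rabs_pos_eq; lra. }
  assert (C1 : clock (eta t - h) < t) by (rewrite <- Ee at 2; apply clock_incr; trivial; lra).
  assert (C2 : t < clock (eta t + h)) by (rewrite <- Ee at 1; apply clock_incr; trivial; lra).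
  assert (Hl : locally t (fun y => clock (eta t - h) < y < clock (eta t + h))).
  { assert (P : 0 < Rmin (t - clock (eta t - h)) (clock (eta t + h) - t)) by (apply Rmin_pos; lra).
    exists (mkposreal _ P). intros y Hy.
    change (Rabs (y - t) < Rmin (t - clock (eta t - h)) (clock (eta t + h) - t)) in Hy.
    assert (R1 := Rmin_l (t - clock (eta t - h)) (clock (eta t + h) - t)).
    assert (R2 := Rmin_r (t - clock (eta t - h)) (clock (eta t + h) - t)).
    apply Rabs_def2 in Hy. lra. }
  generalize (filter_and _ _ Hl (ci_open _ _ _ CI t H)). apply filter_imp. intros y [Hy Dy].
  change (Rabs (eta y - eta t) < eps).
  assert (Dey := ci_dom _ _ _ CI y Dy). assert (Eey := ci_eq _ _ _ CI y Dy).
  assert (eta t - h < eta y) by (apply clock_le_inv; trivial; lra).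
  assert (eta y < eta t + h) by (apply clock_le_inv; trivial; lra).
  apply Rabs_def1; lra.
Qed.

Lemma eta_derive t : D t -> is_derive eta t (spd (eta t)).
Proof.
  intros H. assert (De := ci_dom _ _ _ CI t H).
  apply (is_derive_val _ _ (- (-1) / Rpower (mom 0 (eta t)) (2 * lam))).
  - apply (is_derive_implicit (fun e s => clock e - s) (fun e _ => Rpower (mom 0 e) (2 * lam)) eta).
    + destruct (dom_open _ De) as [d Hd]. exists d. intros u v Hu _.
      eapply is_derive_val.
      * apply (is_derive_minus clock (fun _ => v)); [apply clock_derive; now apply Hd|].
        apply (is_derive_const (V := R_NormedModule)).
      * unfold minus, plus, opp, zero; simpl. ring.
    + apply (cont2d_of_fst (fun e => Rpower (mom 0 e) (2 * lam))). now apply clock_integrand_cont.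
    + now apply eta_cont.
    + auto_derive; auto; ring.
    + generalize (ci_open _ _ _ CI t H). apply filter_imp. intros y Dy.
      rewrite !(ci_eq _ _ _ CI) by trivial. ring.
    + generalize (Rpower_pos (mom 0 (eta t)) (2 * lam)); lra.
  - unfold spd. rewrite Rpower_Ropp. field. generalize (Rpower_pos (mom 0 (eta t)) (2 * lam)); lra.
Qed.

Lemma cont2d_in_time (F : R -> R -> R) x t :
  D t -> continuity_2d_pt F x (eta t) -> continuity_2d_pt (fun x t => F x (eta t)) x t.
Proof.
  intros H HF. apply (cont2d_compose F (fun x _ => x) (fun _ t => eta t)).
  - exact HF.
  - apply continuity_2d_pt_id1.
  - apply (cont2d_of_snd eta). now apply eta_cont.
Qed.

Lemma derive_in_time (f : R -> R) t l : D t -> is_derive f (eta t) l ->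
  is_derive (fun s => f (eta s)) t (spd (eta t) * l).
Proof.
  intros H Hf. apply (is_derive_comp f eta); [exact Hf|now apply eta_derive].
Qed.

(** Since [clock] is increasing, the limit at the end of life becomes a limit at the upper end of
    [dom]; from here on asymptotics are studied in [e] alone. *)
Lemma near_end_of_clock (P : R -> Prop) (e0 : R) :
  0 <= e0 -> dom e0 -> (forall e, e0 < e -> dom e -> P e) -> near_end T (fun t => P (eta t)).
Proof.
  intros H0 De HP. exists (clock e0).
  assert (C0 : 0 <= clock e0).
  { destruct H0 as [H0|<-]; [|rewrite clock_0; lra].
    left. rewrite <- clock_0. apply clock_incr; trivial. apply dom_0. }
  split; [exact C0|]. split; [now apply (ci_before _ _ _ CI)|].
  intros t Ht Bt. assert (Dt : D t) by (apply (ci_strip _ _ _ CI); [lra|exact Bt]).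
  apply HP; [|now apply (ci_dom _ _ _ CI)].
  apply clock_le_inv; trivial; [now apply (ci_dom _ _ _ CI)|]. rewrite (ci_eq _ _ _ CI); trivial.
Qed.

Lemma kernel_lagrangian : lagrangian lam D (fun x t => kerV x (eta t)) (fun x t => kerVx x (eta t))
  (fun x t => kerg x (eta t)).
Proof.
  assert (cm : forall i x t, D t -> continuity_2d_pt (fun _ e => mom i e) x (eta t)).
  { intros i x t H. apply (cont2d_of_snd (mom i)). apply mom_cont. now apply (ci_dom _ _ _ CI). }
  assert (cspd : forall x t, D t -> continuity_2d_pt (fun _ e => spd e) x (eta t)).
  { intros x t H. apply (cont2d_of_snd spd). apply (ex_derive_continuous spd). eexists.
    apply spd_derive. now apply (ci_dom _ _ _ CI). }
  constructor.
  - apply (ci_open _ _ _ CI).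
  - intros x t H. apply Rdiv_lt_0_compat; [apply wgt_pos|]. apply mom0_pos. now apply (ci_dom _ _ _ CI).
  - intros t H. apply kernel_mass. now apply (ci_dom _ _ _ CI).
  - intros x t _. unfold kerg. now rewrite wgt_shift.
  - intros x t _. unfold kerV. now rewrite hq_shift.
  - intros x t H. apply cont2d_in_time; [exact H|]. assert (De := ci_dom _ _ _ CI t H). assert (P := mom0_pos _ De).
    apply continuity_2d_pt_mult; [now apply wgt_cont|].
    apply continuity_2d_pt_inv; [now apply cm|lra].
  - intros x t H. apply cont2d_in_time; [exact H|]. assert (De := ci_dom _ _ _ CI t H).
    apply continuity_2d_pt_mult; [now apply cspd|].
    apply continuity_2d_pt_minus; [now apply hq_cont|].
    apply (cont2d_of_snd kap). apply (ex_derive_continuous kap). eexists. now apply kap_derive.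
  - intros x t H. apply cont2d_in_time; [exact H|]. assert (De := ci_dom _ _ _ CI t H).
    apply continuity_2d_pt_mult; [now apply cspd|].
    apply continuity_2d_pt_mult.
    + apply (cont2d_of_fst (fun x => - (2 * PI) * sin (2 * PI * x))).
      apply (ex_derive_continuous (fun x => - (2 * PI) * sin (2 * PI * x))). auto_derive; auto.
    + apply continuity_2d_pt_inv.
      * apply (continuity_1d_2d_pt_comp (fun y => y ^ 2) jac); [|apply jac_cont].
        apply continuity_pt_filterlim. apply continuous_pow_id.
      * apply pow_nonzero. generalize (jac_pos x _ De); lra.
  - intros x t H. assert (De := ci_dom _ _ _ CI t H).
    eapply is_derive_val; [apply (derive_in_time (fun e => kerg x e)); [exact H|now apply kerg_derive]|].
    unfold kerV. ring.
  - intros x t H. assert (De := ci_dom _ _ _ CI t H). assert (P := mom0_pos _ De).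
    eapply is_derive_val; [apply (derive_in_time (fun e => kerV x e)); [exact H|now apply kerV_derive]|].
    rewrite kerV_second_moment by exact De. unfold kerV. ring.
  - intros x t H. assert (De := ci_dom _ _ _ CI t H).
    eapply is_derive_val.
    + apply (is_derive_scal (fun y => hq y (eta t) - kap (eta t)) x (spd (eta t))).
      apply (is_derive_minus (fun y => hq y (eta t)) (fun _ => kap (eta t))); [now apply hq_derive_x|].
      apply (is_derive_const (V := R_NormedModule)).
    + unfold kerVx, minus, plus, opp, zero; simpl. ring.
Qed.

Lemma kernel_initial x : D 0 -> kerg x (eta 0) = 1 /\ kerV x (eta 0) = cs x.
Proof.
  intros H. rewrite (eta_0 H).
  assert (E0 : mom 0 0 = 1).
  { unfold mom. rewrite (RInt_extR _ (fun _ => 1)) by (intros; rewrite wgt_0; simpl; ring).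
    rewrite (RInt_const (V := R_CompleteNormedModule)). unfold scal; simpl; unfold mult; simpl. ring. }
  assert (E1 : mom 1 0 = 0).
  { unfold mom. rewrite (RInt_extR _ cs).
    2: { intros y. rewrite wgt_0. unfold hq, jac. field. }
    rewrite (RInt_extR _ (Derive (fun y => sin (2 * PI * y) / (2 * PI)))).
    2: { intros y. symmetry. apply is_derive_unique. unfold cs. assert (P := PI_RGT_0). auto_derive; [auto|].
         field. lra. }
    rewrite RInt_Derive.
    - rewrite Rmult_1_r, sin_2PI, Rmult_0_r, sin_0. lra.
    - intros y _. auto_derive. auto.
    - intros y _. apply (continuous_ext cs); [|apply cs_cont]. intros z. symmetry. apply is_derive_unique.
      unfold cs. assert (P := PI_RGT_0). auto_derive; [auto|]. field. lra. }
  unfold kerg, kerV, kap, spd, hq, jac. rewrite wgt_0, E0, E1. split; [field|].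
  unfold Rpower. rewrite ln_1, Rmult_0_r, exp_0. rewrite Rmult_0_r, Rmult_0_l. field.
Qed.

End Time.
End Kernel.

(** * Elementary bounds on powers and on the cosine *)

Ltac to_R_eq := match goal with |- @eq _ ?a ?b => change (@eq R a b) end.

Lemma Rpower_anti (s a b : R) : 0 <= s -> 0 < a <= b -> Rpower b (- s) <= Rpower a (- s).
Proof.
  intros Hs Hab. rewrite !Rpower_Ropp. apply Rinv_le_contravar; [apply Rpower_pos|].
  now apply Rle_Rpower_l.
Qed.

Lemma Rpower_ge_1 (x a : R) : 1 <= x -> 0 <= a -> 1 <= Rpower x a.
Proof. intros Hx Ha. rewrite <- (Rpower_O x) by lra. apply Rle_Rpower; lra. Qed.

Lemma Rpower_sqr_half (x a : R) : 0 < x -> Rpower (x * x) a = Rpower x (2 * a).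
Proof.
  intros H. replace (x * x) with (Rpower x 2).
  - apply Rpower_mult.
  - replace 2 with (1 + 1) by ring. rewrite Rpower_plus, Rpower_1; trivial.
Qed.

Lemma Rpower_base_1 (a : R) : Rpower 1 a = 1.
Proof. unfold Rpower. now rewrite ln_1, Rmult_0_r, exp_0. Qed.

(** Reflection [x -> 1 - x]. On the half period the only point at which [1 - r cos] can degenerate
    as [r] tends to 1 is the endpoint 0. *)
Lemma RInt_half (f : R -> R) :
  (forall x, continuous (fun y => f (cs y)) x) ->
  RInt (fun x => f (cs x)) 0 1 = 2 * RInt (fun x => f (cs x)) 0 (1 / 2).
Proof.
  intros Hc. set (h := fun x => f (cs x)).
  assert (E1 : RInt h 0 (1 / 2) + RInt h (1 / 2) 1 = RInt h 0 1).
  { apply (RInt_Chasles (V := R_CompleteNormedModule)); now apply ex_RInt_cont. }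
  assert (E2 : RInt h (1 / 2) 1 = RInt h 0 (1 / 2)).
  { assert (E := RInt_comp_lin h (-1) 1 0 (1 / 2)).
    replace (-1 * 0 + 1) with 1 in E by ring. replace (-1 * (1 / 2) + 1) with (1 / 2) in E by field.
    rewrite <- (opp_RInt_swap (V := R_CompleteNormedModule)) by now apply ex_RInt_cont.
    rewrite <- E by now apply ex_RInt_cont.
    rewrite (RInt_extR (fun y => scal (-1) (h (-1 * y + 1))) (fun y => -1 * h y)).
    - rewrite (RInt_scal (V := R_CompleteNormedModule) h) by now apply ex_RInt_cont.
      unfold opp, scal; simpl; unfold mult; simpl. to_R_eq. ring.
    - intros y. unfold h, cs. replace (2 * PI * (-1 * y + 1)) with (- (2 * PI * y) + 2 * INR 1 * PI) by (simpl; ring).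
      now rewrite cos_period, cos_neg. }
  rewrite <- E1, E2. to_R_eq. ring.
Qed.

(** A shift by half a period changes the sign of the cosine. This is what lets negative [lam] be
    treated with the radius [r = |lam| e]. *)
Lemma RInt_cs_opp (f : R -> R) :
  (forall x, continuous (fun y => f (cs y)) x) ->
  RInt (fun x => f (- cs x)) 0 1 = RInt (fun x => f (cs x)) 0 1.
Proof.
  intros Hc. set (h := fun x => f (cs x)).
  assert (E := RInt_comp_lin h 1 (1 / 2) 0 1).
  replace (1 * 0 + 1 / 2) with (1 / 2) in E by field. replace (1 * 1 + 1 / 2) with (1 / 2 + 1) in E by field.
  rewrite (RInt_extR (fun y => scal 1 (h (1 * y + 1 / 2))) (fun x => f (- cs x))) in E.
  - rewrite E by now apply ex_RInt_cont.
    assert (E1 : RInt h 0 (1 / 2) + RInt h (1 / 2) (1 / 2 + 1) = RInt h 0 (1 / 2 + 1)).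
    { apply (RInt_Chasles (V := R_CompleteNormedModule)); now apply ex_RInt_cont. }
    rewrite (RInt_shift_period h) in E1.
    + apply (Rplus_eq_reg_l (RInt h 0 (1 / 2))). exact E1.
    + exact Hc.
    + intros y. unfold h. now rewrite cs_shift.
  - intros y. unfold h, cs, scal; simpl; unfold mult; simpl.
    replace (2 * PI * (1 * y + 1 / 2)) with (2 * PI * y + PI) by field. rewrite neg_cos. ring.
Qed.

(** Taylor's bound [z - z^3/6] together with [z^2 <= 4]. The interval up to 2 contains [PI * x] for
    [x <= 1/2] already under the crude bound [PI <= 4]. *)
Lemma sin_ge_third (z : R) : 0 <= z <= 2 -> z / 3 <= sin z.
Proof.
  intros Hz. assert (P := PI2_3_2).
  destruct (pre_sin_bound z 0) as [H _]; [lra|lra|].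
  unfold sin_approx, sum_f_R0, sin_term in H. simpl in H.
  assert (z * z <= 4) by nra. nra.
Qed.

(** [1 - cos (2 PI x) = 2 sin^2 (PI x) <= 2 PI^2 x^2], and [PI <= 4] gives the constant 32. *)
Lemma cs_upper (x : R) : 1 - cs x <= 32 * x ^ 2.
Proof.
  unfold cs. replace (2 * PI * x) with (2 * (PI * x)) by ring. rewrite cos_2a_sin.
  assert (H : sin (PI * x) * sin (PI * x) <= (PI * x) * (PI * x)).
  { apply Rsqr_le_abs_1. assert (P := Rabs_pos (PI * x)).
    assert (Hs : forall z, 0 <= z -> Rabs (sin z) <= z).
    { intros z Hz. destruct Hz as [Hz|<-]; [|rewrite sin_0, Rabs_R0; lra].
      apply Rabs_le. destruct (Rle_lt_dec z PI) as [h|h].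
      - split; [generalize (sin_ge_0 z ltac:(lra) h); lra|left; now apply sin_lt_x].
      - assert (B := SIN_bound z). assert (Q := PI2_3_2). lra. }
    destruct (Rle_lt_dec 0 (PI * x)) as [h|h].
    - rewrite (Rabs_pos_eq (PI * x)) by exact h. now apply Hs.
    - rewrite (Rabs_left (PI * x)) by exact h. rewrite <- Rabs_Ropp, <- sin_neg. apply Hs. lra. }
  assert (P := PI_4). assert (Q := PI_RGT_0).
  assert (PI * PI <= 16) by nra. assert (0 <= x * x) by nra. nra.
Qed.

(** [sin (PI x) >= PI x / 3 >= x], since [PI >= 3]. *)
Lemma cs_lower (x : R) : 0 <= x <= 1 / 2 -> 2 * x ^ 2 <= 1 - cs x.
Proof.
  intros Hx. unfold cs. replace (2 * PI * x) with (2 * (PI * x)) by ring. rewrite cos_2a_sin.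
  assert (P := PI_4). assert (Q := PI2_3_2).
  assert (H := sin_ge_third (PI * x) ltac:(nra)).
  assert (3 * x <= PI * x) by (apply Rmult_le_compat_r; lra).
  assert (x <= sin (PI * x)) by lra. nra.
Qed.

(** * Averages over one period *)

(** The functions averaged below, negative powers among them, are evaluated only at
    [1 - r cos > 0]. *)
Definition contpos (phi : R -> R) : Prop := forall j, 0 < j -> continuous phi j.

Definition avg (r : R) (phi : R -> R) : R := RInt (fun x => phi (1 - r * cs x)) 0 1.

Lemma avg_arg_bound r x : 0 <= r < 1 -> 1 - r <= 1 - r * cs x <= 2.
Proof. intros Hr. assert (B := cs_bound x). nra. Qed.

Lemma avg_cont r phi x : 0 <= r < 1 -> contpos phi -> continuous (fun y => phi (1 - r * cs y)) x.
Proof.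
  intros Hr Hp. apply (continuous_comp (fun y => 1 - r * cs y) phi).
  - apply (continuous_minus (fun _ => 1) (fun y => r * cs y)); [apply continuous_const|].
    apply (continuous_mult (fun _ => r) cs); [apply continuous_const|apply cs_cont].
  - apply Hp. generalize (avg_arg_bound r x Hr); lra.
Qed.

Lemma avg_ex r phi a b : 0 <= r < 1 -> contpos phi -> ex_RInt (fun y => phi (1 - r * cs y)) a b.
Proof. intros Hr Hp. apply ex_RInt_cont. intros; now apply avg_cont. Qed.

Lemma contpos_const c : contpos (fun _ => c).
Proof. intros j _. apply continuous_const. Qed.

Lemma contpos_id : contpos (fun j => j).
Proof. intros j _. apply continuous_id. Qed.

Lemma contpos_plus f h : contpos f -> contpos h -> contpos (fun j => f j + h j).
Proof. intros Hf Hh j Hj. apply (continuous_plus f h); auto. Qed.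

Lemma contpos_minus f h : contpos f -> contpos h -> contpos (fun j => f j - h j).
Proof. intros Hf Hh j Hj. apply (continuous_minus f h); auto. Qed.

Lemma contpos_mult f h : contpos f -> contpos h -> contpos (fun j => f j * h j).
Proof. intros Hf Hh j Hj. apply (continuous_mult f h); auto. Qed.

Lemma contpos_Rpower a : contpos (fun j => Rpower j a).
Proof. intros j Hj. now apply continuous_Rpower. Qed.

Lemma contpos_inv : contpos (fun j => / j).
Proof. intros j Hj. apply continuous_Rinv. lra. Qed.

Lemma contpos_comp f h : (forall x, continuous f x) -> contpos h -> contpos (fun j => f (h j)).
Proof. intros Hf Hh j Hj. apply (continuous_comp h f); [now apply Hh|apply Hf]. Qed.

Lemma contpos_pow f n : contpos f -> contpos (fun j => f j ^ n).
Proof. apply (contpos_comp (fun y => y ^ n)). intros; apply continuous_pow_id. Qed.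

Lemma contpos_abs f : contpos f -> contpos (fun j => Rabs (f j)).
Proof. apply (contpos_comp Rabs). intros; apply continuous_Rabs. Qed.

Section Average.
Variable r : R.
Hypothesis Hr : 0 <= r < 1.

Lemma avg_le f h : contpos f -> contpos h -> (forall j, 1 - r <= j <= 2 -> f j <= h j) -> avg r f <= avg r h.
Proof.
  intros Hf Hh H. apply RInt_le; [lra|now apply avg_ex|now apply avg_ex|].
  intros x _. apply H. now apply avg_arg_bound.
Qed.

Lemma avg_ext f h : (forall j, 1 - r <= j <= 2 -> f j = h j) -> avg r f = avg r h.
Proof. intros H. apply RInt_extR. intros x. apply H. now apply avg_arg_bound. Qed.

Lemma avg_plus f h : contpos f -> contpos h -> avg r (fun j => f j + h j) = avg r f + avg r h.
Proof.
  intros Hf Hh. apply (RInt_plus (V := R_CompleteNormedModule) (fun y => f (1 - r * cs y)) (fun y => h (1 - r * cs y)));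
  now apply avg_ex.
Qed.

Lemma avg_minus f h : contpos f -> contpos h -> avg r (fun j => f j - h j) = avg r f - avg r h.
Proof.
  intros Hf Hh. apply (RInt_minus (V := R_CompleteNormedModule) (fun y => f (1 - r * cs y)) (fun y => h (1 - r * cs y)));
  now apply avg_ex.
Qed.

Lemma avg_scal c f : contpos f -> avg r (fun j => c * f j) = c * avg r f.
Proof.
  intros Hf. apply (RInt_scal (V := R_CompleteNormedModule) (fun y => f (1 - r * cs y))).
  now apply avg_ex.
Qed.

Lemma avg_const c : avg r (fun _ => c) = c.
Proof.
  unfold avg. rewrite (RInt_const (V := R_CompleteNormedModule)).
  unfold scal; simpl; unfold mult; simpl. ring.
Qed.

Lemma avg_half f : contpos f -> avg r f = 2 * RInt (fun x => f (1 - r * cs x)) 0 (1 / 2).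
Proof.
  intros Hf. apply (RInt_half (fun z => f (1 - r * z))). intros x. now apply avg_cont.
Qed.

Lemma avg_pos f : contpos f -> (forall j, 1 - r <= j <= 2 -> 0 < f j) -> 0 < avg r f.
Proof.
  intros Hf H. apply RInt_gt_0; [lra| |].
  - intros x _. apply H. now apply avg_arg_bound.
  - intros x _. now apply avg_cont.
Qed.

(* On [1/4, 1/2] the cosine is nonpositive. *)
Lemma avg_ge_far c f : contpos f -> (forall j, 1 - r <= j <= 2 -> 0 <= f j) ->
  (forall j, 1 <= j <= 2 -> c <= f j) -> c / 2 <= avg r f.
Proof.
  intros Hf H0 H. rewrite avg_half by exact Hf.
  assert (E : RInt (fun x => f (1 - r * cs x)) 0 (1 / 4) + RInt (fun x => f (1 - r * cs x)) (1 / 4) (1 / 2)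
    = RInt (fun x => f (1 - r * cs x)) 0 (1 / 2)).
  { apply (RInt_Chasles (V := R_CompleteNormedModule)); now apply avg_ex. }
  assert (H1 : 0 <= RInt (fun x => f (1 - r * cs x)) 0 (1 / 4)).
  { apply RInt_ge_0; [lra|now apply avg_ex|]. intros x _. apply H0. now apply avg_arg_bound. }
  assert (H2 : (1 / 2 - 1 / 4) * c <= RInt (fun x => f (1 - r * cs x)) (1 / 4) (1 / 2)).
  { assert (Ec : RInt (fun _ => c) (1 / 4) (1 / 2) = (1 / 2 - 1 / 4) * c).
    { rewrite (RInt_const (V := R_CompleteNormedModule)). reflexivity. }
    rewrite <- Ec. apply RInt_le; [lra|apply ex_RInt_const|now apply avg_ex|].
    intros x Hx. apply H. assert (B := avg_arg_bound r x Hr). split; [|lra].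
    assert (cs x <= 0); [|nra]. unfold cs. assert (P := PI_RGT_0). apply cos_le_0; nra. }
  lra.
Qed.

End Average.

(** * The Legendre-type integrals and their growth as [r] tends to 1 *)

(** By Laplace's integral this is [(1 - r^2)^(-s/2) P_(s-1)(1 / sqrt (1 - r^2))] with [P] the
    Legendre function, and [F_recurrence] is Bonnet's recurrence for it. *)
Definition F (s r : R) : R := avg r (fun j => Rpower j (- s)).

Lemma F_pos s r : 0 <= r < 1 -> 0 < F s r.
Proof. intros Hr. apply avg_pos; [exact Hr|apply contpos_Rpower|]. intros; apply Rpower_pos. Qed.

Lemma F_lower_const s : exists c, 0 < c /\ forall r, 0 <= r < 1 -> c <= F s r.
Proof.
  exists (Rmin 1 (Rpower 2 (- s)) / 2). split.
  - apply Rdiv_lt_0_compat; [apply Rmin_pos; [lra|apply Rpower_pos]|lra].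
  - intros r Hr. apply avg_ge_far; [exact Hr|apply contpos_Rpower| |].
    + intros; left; apply Rpower_pos.
    + intros j Hj. destruct (Rle_lt_dec 0 s) as [h|h].
      * eapply Rle_trans; [apply Rmin_r|]. apply Rpower_anti; lra.
      * eapply Rle_trans; [apply Rmin_l|]. apply Rpower_ge_1; lra.
Qed.

Lemma F_upper_nonpos s r : s <= 0 -> 0 <= r < 1 -> F s r <= Rpower 2 (- s).
Proof.
  intros Hs Hr. rewrite <- (avg_const r (Rpower 2 (- s))). apply avg_le; trivial.
  - apply contpos_Rpower.
  - apply contpos_const.
  - intros j Hj. apply Rle_Rpower_l; lra.
Qed.

(** [1 - r cos] is of the size of [(1 - r) + x^2], hence of [(sqrt (1 - r) + x)^2], a form whose
    powers have elementary antiderivatives. For [r >= 1/2] the quadratic lower bound on [1 - cos]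
    suffices; for [r < 1/2] nothing degenerates and the constant 8 pays for it. *)
Lemma jac_sqrt_lower r x : 0 <= r < 1 -> 0 <= x <= 1 / 2 ->
  (sqrt (1 - r) + x) * (sqrt (1 - r) + x) / 8 <= 1 - r * cs x.
Proof.
  intros Hr Hx. set (d := sqrt (1 - r)).
  assert (D0 : 0 < d) by (apply sqrt_lt_R0; lra).
  assert (D2 : d * d = 1 - r) by (apply sqrt_sqrt; lra).
  assert (D1 : d <= 1) by nra.
  assert (C := cs_lower x Hx). assert (B := cs_bound x).
  destruct (Rle_lt_dec (1 / 2) r) as [h|h].
  - assert (0 <= (d - x) * (d - x)) by apply (Rle_0_sqr (d - x)).
    assert (r * (2 * x ^ 2) <= r * (1 - cs x)) by (apply Rmult_le_compat_l; lra).
    assert (0 <= x ^ 2) by apply pow2_ge_0.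
    assert (1 / 2 * x ^ 2 <= r * x ^ 2) by (apply Rmult_le_compat_r; lra). nra.
  - assert ((d + x) * (d + x) <= (3 / 2) * (3 / 2)) by (apply Rmult_le_compat; lra).
    assert (0 <= r * (1 - cs x)) by (apply Rmult_le_pos; lra). lra.
Qed.

Lemma jac_sqrt_upper r x : 0 <= r < 1 -> 0 <= x ->
  1 - r * cs x <= 1 - r + 32 * x ^ 2.
Proof.
  intros Hr Hx. assert (C := cs_upper x). assert (B := cs_bound x).
  assert (r * (1 - cs x) <= 1 * (1 - cs x)) by (apply Rmult_le_compat_r; lra). lra.
Qed.

Lemma ex_RInt_shift_power d a h h' : 0 < d -> 0 <= h <= h' -> ex_RInt (fun x => Rpower (d + x) a) h h'.
Proof.
  intros Hd Hh. apply (ex_RInt_continuous (V := R_CompleteNormedModule)).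
  intros x. rewrite Rmin_left, Rmax_right by lra. intros Hx.
  apply (continuous_comp (fun x => d + x) (fun y => Rpower y a)).
  - apply (continuous_plus (fun _ => d) (fun x => x)); [apply continuous_const|apply continuous_id].
  - apply continuous_Rpower. lra.
Qed.

Lemma RInt_shift_power d k h : 0 < d -> 0 <= h -> k <> 0 ->
  RInt (fun x => Rpower (d + x) (k - 1)) 0 h = (Rpower (d + h) k - Rpower d k) / k.
Proof.
  intros Hd Hh Hk.
  apply is_RInt_unique.
  replace ((Rpower (d + h) k - Rpower d k) / k) with
    (minus (/ k * Rpower (d + h) k) (/ k * Rpower (d + 0) k))
    by (rewrite Rplus_0_r; unfold minus, plus, opp; simpl; field; exact Hk).
  apply (is_RInt_derive (fun x => / k * Rpower (d + x) k) (fun x => Rpower (d + x) (k - 1))).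
  - intros x. rewrite Rmin_left, Rmax_right by lra. intros Hx.
    eapply is_derive_val.
    + apply (is_derive_scal (fun x => Rpower (d + x) k)).
      apply (is_derive_Rpower_comp (fun x => d + x) x 1); [lra|]. auto_derive; auto.
    + unfold Rminus. rewrite Rpower_plus, Rpower_Ropp, Rpower_1 by lra. field. split; [lra|exact Hk].
  - intros x. rewrite Rmin_left, Rmax_right by lra. intros Hx.
    apply (continuous_comp (fun x => d + x) (fun y => Rpower y (k - 1))).
    + apply (continuous_plus (fun _ => d) (fun x => x)); [apply continuous_const|apply continuous_id].
    + apply continuous_Rpower. lra.
Qed.

Lemma jac_pow_upper s r x : 0 <= s -> 0 <= r < 1 -> 0 <= x <= 1 / 2 ->
  Rpower (1 - r * cs x) (- s) <= Rpower 8 s * Rpower (sqrt (1 - r) + x) (- (2 * s)).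
Proof.
  intros Hs Hr Hx. assert (H := jac_sqrt_lower r x Hr Hx).
  assert (D0 : 0 < sqrt (1 - r)) by (apply sqrt_lt_R0; lra).
  set (y := sqrt (1 - r) + x) in *. assert (Y : 0 < y) by (unfold y; lra).
  eapply Rle_trans; [apply (Rpower_anti s (y * y / 8)); [exact Hs|]; split; [nra|exact H]|].
  unfold Rdiv. rewrite <- Rpower_mult_distr by nra. rewrite Rpower_sqr_half by exact Y.
  replace (2 * - s) with (- (2 * s)) by ring.
  rewrite (Rmult_comm (Rpower 8 s)). apply Rmult_le_compat_l; [left; apply Rpower_pos|].
  right. unfold Rpower. f_equal. rewrite ln_Rinv by lra. ring.
Qed.

Lemma RInt_jac_pow_upper s r h : 0 <= s -> 0 <= r < 1 -> 0 <= h <= 1 / 2 -> s <> 1 / 2 ->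
  RInt (fun x => Rpower (1 - r * cs x) (- s)) 0 h <=
  Rpower 8 s * ((Rpower (sqrt (1 - r) + h) (1 - 2 * s) - Rpower (sqrt (1 - r)) (1 - 2 * s)) / (1 - 2 * s)).
Proof.
  intros Hs Hr Hh Hk.
  assert (D0 : 0 < sqrt (1 - r)) by (apply sqrt_lt_R0; lra).
  rewrite <- RInt_shift_power by lra.
  assert (E : RInt (fun x => Rpower 8 s * Rpower (sqrt (1 - r) + x) (1 - 2 * s - 1)) 0 h =
     Rpower 8 s * RInt (fun x => Rpower (sqrt (1 - r) + x) (1 - 2 * s - 1)) 0 h).
  { apply (RInt_scal (V := R_CompleteNormedModule) (fun x => Rpower (sqrt (1 - r) + x) (1 - 2 * s - 1))).
    apply ex_RInt_shift_power; lra. }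
  rewrite <- E. apply RInt_le; [lra| | |].
  - apply (avg_ex r (fun j => Rpower j (- s))); [exact Hr|apply contpos_Rpower].
  - apply (ex_RInt_scal (V := R_CompleteNormedModule) (fun x => Rpower (sqrt (1 - r) + x) (1 - 2 * s - 1))).
    apply ex_RInt_shift_power; lra.
  - intros x Hx. replace (1 - 2 * s - 1) with (- (2 * s)) by ring. apply jac_pow_upper; lra.
Qed.

(** Since the base is at most 2, raising the exponent from [s] to [s1] loses at most the factor
    [2^(s1 - s)]. *)
Lemma F_mono_exponent s s1 r : s <= s1 -> 0 <= r < 1 -> F s r <= Rpower 2 (s1 - s) * F s1 r.
Proof.
  intros Hs Hr. unfold F. rewrite <- avg_scal by (trivial; apply contpos_Rpower).
  apply avg_le; trivial.
  - apply contpos_Rpower.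
  - apply contpos_mult; [apply contpos_const|apply contpos_Rpower].
  - intros j Hj. replace (- s) with ((s1 - s) + - s1) by ring. rewrite Rpower_plus.
    apply Rmult_le_compat_r; [left; apply Rpower_pos|]. apply Rle_Rpower_l; lra.
Qed.

Lemma sqrt_Rpower x a : 0 < x -> Rpower (sqrt x) a = Rpower x (a / 2).
Proof.
  intros H. rewrite <- (sqrt_sqrt x) at 2 by lra. rewrite Rpower_sqr_half by now apply sqrt_lt_R0.
  f_equal. field.
Qed.

(** The exponent is first raised to [1/2 + b], where the comparison integral is an explicit power.
    This also covers the logarithmic case [s = 1/2], at the price of an arbitrarily small [b]. *)
Lemma F_upper_power s b : 0 < b -> s <= 1 / 2 + b ->
  exists C, 0 < C /\ forall r, 0 <= r < 1 -> F s r <= C * Rpower (1 - r) (- b).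
Proof.
  intros Hb Hs. set (s1 := 1 / 2 + b).
  exists (Rpower 2 (s1 - s) * (2 * (Rpower 8 s1 / (2 * b)))). split.
  { repeat apply Rmult_lt_0_compat; try apply Rpower_pos; try lra. apply Rinv_0_lt_compat; lra. }
  intros r Hr. eapply Rle_trans; [now apply (F_mono_exponent s s1)|].
  rewrite Rmult_assoc. apply Rmult_le_compat_l; [left; apply Rpower_pos|].
  unfold F. rewrite avg_half by (trivial; apply contpos_Rpower).
  rewrite Rmult_assoc. apply Rmult_le_compat_l; [lra|].
  eapply Rle_trans; [apply RInt_jac_pow_upper; unfold s1; lra|].
  unfold Rdiv at 3. rewrite Rmult_assoc. apply Rmult_le_compat_l; [left; apply Rpower_pos|].
  replace (1 - 2 * s1) with (- (2 * b)) by (unfold s1; field).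
  rewrite (sqrt_Rpower (1 - r)) by lra.
  replace (- (2 * b) / 2) with (- b) by field.
  assert (P := Rpower_pos (sqrt (1 - r) + 1 / 2) (- (2 * b))).
  assert (Q : 0 < / (2 * b)) by (apply Rinv_0_lt_compat; lra).
  replace ((Rpower (sqrt (1 - r) + 1 / 2) (- (2 * b)) - Rpower (1 - r) (- b)) / - (2 * b)) with
    (/ (2 * b) * Rpower (1 - r) (- b) - / (2 * b) * Rpower (sqrt (1 - r) + 1 / 2) (- (2 * b))) by (field; lra).
  assert (0 < / (2 * b) * Rpower (sqrt (1 - r) + 1 / 2) (- (2 * b))) by now apply Rmult_lt_0_compat. lra.
Qed.

Lemma RInt_jac_pow_tail s r h : 0 <= s < 1 / 2 -> 0 <= r < 1 -> 0 <= h <= 1 / 2 ->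
  RInt (fun x => Rpower (1 - r * cs x) (- s)) 0 h <=
  Rpower 8 s / (1 - 2 * s) * Rpower (sqrt (1 - r) + h) (1 - 2 * s).
Proof.
  intros Hs Hr Hh. eapply Rle_trans; [apply RInt_jac_pow_upper; lra|].
  assert (P := Rpower_pos (sqrt (1 - r)) (1 - 2 * s)).
  assert (Q : 0 < / (1 - 2 * s)) by (apply Rinv_0_lt_compat; lra).
  unfold Rdiv. rewrite Rmult_assoc. apply Rmult_le_compat_l; [left; apply Rpower_pos|]. nra.
Qed.

Lemma F_upper_bounded s : s < 1 / 2 -> exists C, 0 < C /\ forall r, 0 <= r < 1 -> F s r <= C.
Proof.
  intros Hs. set (s1 := (Rmax s 0 + 1 / 2) / 2).
  assert (M1 := Rmax_l s 0). assert (M2 := Rmax_r s 0).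
  assert (M3 : Rmax s 0 < 1 / 2) by (apply Rmax_lub_lt; lra).
  assert (S1 : 0 <= s1 < 1 / 2) by (unfold s1; lra). assert (S2 : s <= s1) by (unfold s1; lra).
  exists (Rpower 2 (s1 - s) * (2 * (Rpower 8 s1 / (1 - 2 * s1) * Rpower 2 (1 - 2 * s1)))). split.
  { repeat apply Rmult_lt_0_compat; try apply Rpower_pos; try lra. apply Rinv_0_lt_compat; lra. }
  intros r Hr. eapply Rle_trans; [now apply (F_mono_exponent s s1)|].
  apply Rmult_le_compat_l; [left; apply Rpower_pos|].
  unfold F. rewrite avg_half by (trivial; apply contpos_Rpower).
  apply Rmult_le_compat_l; [lra|].
  eapply Rle_trans; [apply RInt_jac_pow_tail; lra|].
  apply Rmult_le_compat_l.
  { apply Rlt_le, Rdiv_lt_0_compat; [apply Rpower_pos|lra]. }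
  assert (D0 : 0 < sqrt (1 - r)) by (apply sqrt_lt_R0; lra).
  assert (D1 : sqrt (1 - r) <= sqrt 1) by (apply sqrt_le_1_alt; lra).
  rewrite sqrt_1 in D1.
  apply Rle_Rpower_l; lra.
Qed.

(** The interval of length [sqrt (1 - r) / 2] next to the degenerate point is enough: there the base
    is at most [1 - r + 32 (1 - r)/4 = 9 (1 - r)]. *)
Lemma F_lower_power s : 1 / 2 < s ->
  exists c, 0 < c /\ forall r, 0 <= r < 1 -> c * Rpower (1 - r) (1 / 2 - s) <= F s r.
Proof.
  intros Hs. exists (Rpower 9 (- s)). split; [apply Rpower_pos|].
  intros r Hr. unfold F. rewrite avg_half by (trivial; apply contpos_Rpower).
  set (d := sqrt (1 - r)).
  assert (D0 : 0 < d) by (apply sqrt_lt_R0; lra).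
  assert (D2 : d * d = 1 - r) by (apply sqrt_sqrt; lra).
  assert (D1 : d <= 1) by nra.
  set (h := fun x => Rpower (1 - r * cs x) (- s)).
  assert (Ex : forall a b, ex_RInt h a b).
  { intros a b. apply (avg_ex r (fun j => Rpower j (- s))); [exact Hr|apply contpos_Rpower]. }
  assert (E : RInt h 0 (d / 2) + RInt h (d / 2) (1 / 2) = RInt h 0 (1 / 2)).
  { apply (RInt_Chasles (V := R_CompleteNormedModule)); apply Ex. }
  assert (H1 : 0 <= RInt h (d / 2) (1 / 2)).
  { apply RInt_ge_0; [lra|apply Ex|]. intros x _. left; apply Rpower_pos. }
  assert (H2 : d / 2 * Rpower (9 * (1 - r)) (- s) <= RInt h 0 (d / 2)).
  { assert (Ec : RInt (fun _ => Rpower (9 * (1 - r)) (- s)) 0 (d / 2) = (d / 2 - 0) * Rpower (9 * (1 - r)) (- s)).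
    { rewrite (RInt_const (V := R_CompleteNormedModule)). reflexivity. }
    rewrite Rminus_0_r in Ec. rewrite <- Ec. apply RInt_le; [lra|apply ex_RInt_const|apply Ex|].
    intros x Hx. apply Rpower_anti; [lra|]. split.
    - generalize (avg_arg_bound r x Hr); lra.
    - eapply Rle_trans; [apply jac_sqrt_upper; lra|]. nra. }
  assert (H3 : d * Rpower (9 * (1 - r)) (- s) = Rpower 9 (- s) * Rpower (1 - r) (1 / 2 - s)).
  { rewrite <- Rpower_mult_distr by lra. unfold Rminus at 3. rewrite Rpower_plus.
    replace (1 / 2) with (/ 2) by field. rewrite Rpower_sqrt by lra. fold d. ring. }
  lra.
Qed.

Definition tends_inf (f : R -> R) : Prop := forall M, at_left 1 (fun r => M < f r).

Lemma at_left_1_intro (P : R -> Prop) r0 : r0 < 1 -> (forall r, r0 < r < 1 -> P r) -> at_left 1 P.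
Proof.
  intros H HP. assert (Q : 0 < 1 - r0) by lra. exists (mkposreal _ Q). intros y Hy Hy1.
  change (Rabs (y - 1) < 1 - r0) in Hy. apply Rabs_def2 in Hy. apply HP. lra.
Qed.

Lemma at_left_1_elim (P : R -> Prop) : at_left 1 P -> exists r0, 0 <= r0 < 1 /\ forall r, r0 < r < 1 -> P r.
Proof.
  intros [d Hd]. exists (Rmax 0 (1 - d)). assert (Q := cond_pos d).
  split; [split; [apply Rmax_l|apply Rmax_lub_lt; lra]|].
  intros r Hr. apply Hd; [|lra]. change (Rabs (r - 1) < d). rewrite Rabs_left by lra.
  assert (R1 := Rmax_r 0 (1 - d)). lra.
Qed.

Lemma at_left_1_range (P : R -> Prop) : (forall r, 0 < r < 1 -> P r) -> at_left 1 P.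
Proof. intros H. apply (at_left_1_intro P 0); [lra|exact H]. Qed.

Lemma tends_inf_le f h : tends_inf f -> at_left 1 (fun r => f r <= h r) -> tends_inf h.
Proof.
  intros Hf H M. generalize (filter_and _ _ (Hf M) H). apply filter_imp. intros; lra.
Qed.

(** The critical exponent [1/2] diverges only logarithmically and all larger ones reduce to it. With
    [d = sqrt (1 - r)] the base is at most [32 (d + x)^2], and the integral of [1/(d + x)] is
    [ln ((d + 1/2)/d)]. *)
Lemma F_tends_inf s : 1 / 2 <= s -> tends_inf (F s).
Proof.
  intros Hs M. set (K := Rpower 2 (1 / 2 - s) * (2 * Rpower 32 (- (1 / 2)))).
  assert (KP : 0 < K) by (unfold K; repeat apply Rmult_lt_0_compat; try apply Rpower_pos; lra).
  set (M' := Rmax 1 (M / K)).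
  (* Chosen so that [d < e] forces [ln ((d + 1/2)/d) > M'], while [K * M' >= M]. *)
  set (e := exp (- M') / 2).
  assert (He : 0 < e) by (unfold e; generalize (exp_pos (- M')); lra).
  assert (He1 : e < 1 / 2).
  { unfold e. assert (exp (- M') < 1); [|lra]. rewrite <- exp_0. apply exp_increasing.
    unfold M'. generalize (Rmax_l 1 (M / K)); lra. }
  apply (at_left_1_intro _ (1 - e * e)); [nra|]. intros r Hr.
  assert (Hr0 : 0 <= r < 1) by nra.
  set (d := sqrt (1 - r)).
  assert (D0 : 0 < d) by (apply sqrt_lt_R0; lra).
  assert (D2 : d * d = 1 - r) by (apply sqrt_sqrt; lra).
  assert (D1 : d < e) by nra.
  assert (F1 : Rpower 2 (1 / 2 - s) * F (1 / 2) r <= F s r).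
  { assert (H := F_mono_exponent (1 / 2) s r Hs Hr0).
    replace (F s r) with (Rpower 2 (1 / 2 - s) * (Rpower 2 (s - 1 / 2) * F s r)).
    - apply Rmult_le_compat_l; [left; apply Rpower_pos|exact H].
    - rewrite <- Rmult_assoc, <- Rpower_plus. replace (1 / 2 - s + (s - 1 / 2)) with 0 by ring.
      rewrite Rpower_O by lra. ring. }
  assert (F2 : 2 * Rpower 32 (- (1 / 2)) * ln ((d + 1 / 2) / d) <= F (1 / 2) r).
  { unfold F. rewrite avg_half by (trivial; apply contpos_Rpower). rewrite Rmult_assoc.
    apply Rmult_le_compat_l; [lra|].
    assert (I : is_RInt (fun x => Rpower 32 (- (1 / 2)) * / (d + x)) 0 (1 / 2)
       (Rpower 32 (- (1 / 2)) * ln ((d + 1 / 2) / d))).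
    { replace (Rpower 32 (- (1 / 2)) * ln ((d + 1 / 2) / d)) with
       (minus (Rpower 32 (- (1 / 2)) * ln (d + 1 / 2)) (Rpower 32 (- (1 / 2)) * ln (d + 0))).
      - apply (is_RInt_derive (fun x => Rpower 32 (- (1 / 2)) * ln (d + x)) (fun x => Rpower 32 (- (1 / 2)) * / (d + x))).
        + intros x. rewrite Rmin_left, Rmax_right by lra. intros Hx. auto_derive; [lra|]. field. lra.
        + intros x. rewrite Rmin_left, Rmax_right by lra. intros Hx.
          apply (ex_derive_continuous (fun x => Rpower 32 (- (1 / 2)) * / (d + x))). auto_derive. lra.
      - rewrite Rplus_0_r, ln_div by lra. unfold minus, plus, opp; simpl. ring. }
    rewrite <- (is_RInt_unique _ _ _ _ I).
    apply RInt_le; [lra|eexists; exact I| |].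
    - apply (avg_ex r (fun j => Rpower j (- (1 / 2)))); [exact Hr0|apply contpos_Rpower].
    - intros x Hx. replace (/ (d + x)) with (Rpower ((d + x) * (d + x)) (- (1 / 2))).
      + rewrite Rpower_mult_distr by nra. apply Rpower_anti; [lra|]. split.
        * generalize (avg_arg_bound r x Hr0); lra.
        * eapply Rle_trans; [apply jac_sqrt_upper; lra|]. nra.
      + rewrite Rpower_sqr_half by lra. replace (2 * - (1 / 2)) with (- (1)) by field.
        rewrite Rpower_Ropp, Rpower_1 by lra. reflexivity. }
  assert (F3 : M' < ln ((d + 1 / 2) / d)).
  { rewrite <- (ln_exp M'). apply ln_increasing; [apply exp_pos|].
    apply (Rmult_lt_reg_r d); [exact D0|]. unfold Rdiv. rewrite Rmult_assoc, Rinv_l, Rmult_1_r by lra.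
    assert (exp M' * d < exp M' * e) by (apply Rmult_lt_compat_l; [apply exp_pos|exact D1]).
    assert (exp M' * e = 1 / 2).
    { unfold e. rewrite exp_Ropp. field. generalize (exp_pos M'); lra. }
    lra. }
  assert (F4 : K * M' < F s r).
  { eapply Rlt_le_trans; [|exact F1]. unfold K. rewrite Rmult_assoc. apply Rmult_lt_compat_l; [apply Rpower_pos|].
    eapply Rlt_le_trans; [|exact F2]. apply Rmult_lt_compat_l; [|exact F3].
    generalize (Rpower_pos 32 (- (1 / 2))); lra. }
  assert (M <= K * M').
  { assert (M / K <= M') by apply Rmax_r. replace M with (K * (M / K)) by (field; lra).
    apply Rmult_le_compat_l; lra. }
  lra.
Qed.

(* Integrate the derivative of [sin * jac^(-s)] over a period. *)
Lemma F_recurrence s r : 0 <= r < 1 ->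
  s * (1 - r ^ 2) * F (s + 1) r = (2 * s - 1) * F s r - (s - 1) * F (s - 1) r.
Proof.
  intros Hr.
  set (h := fun x => r * sin (2 * PI * x) * Rpower (1 - r * cs x) (- s)).
  set (dh := fun x => 2 * PI * (s * (1 - r ^ 2) * Rpower (1 - r * cs x) (- (s + 1)) -
     ((2 * s - 1) * Rpower (1 - r * cs x) (- s) - (s - 1) * Rpower (1 - r * cs x) (- (s - 1))))).
  set (phi := fun j => s * (1 - r ^ 2) * Rpower j (- (s + 1)) -
     ((2 * s - 1) * Rpower j (- s) - (s - 1) * Rpower j (- (s - 1)))).
  assert (Cphi : contpos phi).
  { apply contpos_minus; [|apply contpos_minus]; (apply contpos_mult; [apply contpos_const|apply contpos_Rpower]). }
  assert (E : RInt dh 0 1 = 0).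
  { apply is_RInt_unique.
    replace 0 with (minus (h 1) (h 0)) at 2.
    - apply (is_RInt_derive h dh).
      + intros x _. assert (J : 0 < 1 - r * cs x) by (generalize (avg_arg_bound r x Hr); lra).
        eapply is_derive_val.
        * apply (is_derive_mult (fun x => r * sin (2 * PI * x)) (fun x => Rpower (1 - r * cs x) (- s)) x (r * (2 * PI * cs x))).
          -- unfold cs. auto_derive; auto. ring.
          -- apply (is_derive_Rpower_comp (fun x => 1 - r * cs x) x (r * (2 * PI) * sin (2 * PI * x))); [exact J|].
             unfold cs. auto_derive; auto. ring.
          -- intros; apply Rmult_comm.
        * unfold dh, plus, mult; simpl.
          replace (- (s + 1)) with (- s + - (1)) by ring. replace (- (s - 1)) with (- s + 1) by ring.
          rewrite !Rpower_plus, (Rpower_Ropp _ 1), Rpower_1 by exact J.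
          assert (SC : sin (2 * PI * x) * sin (2 * PI * x) = 1 - cs x * cs x).
          { assert (Q := sin2_cos2 (2 * PI * x)). unfold Rsqr in Q. unfold cs. lra. }
          set (w := Rpower (1 - r * cs x) (- s)). set (j := 1 - r * cs x) in *.
          transitivity (2 * PI * (r * cs x) * w - s * w * (2 * PI) * r ^ 2 * (sin (2 * PI * x) * sin (2 * PI * x)) / j);
            [field; lra|].
          rewrite SC.
          transitivity (2 * PI * (r * cs x) * w - s * w * (2 * PI) * (r ^ 2 - (r * cs x) * (r * cs x)) / j);
            [field; lra|].
          replace (r * cs x) with (1 - j) by (unfold j; ring). field. lra.
      + intros x _. apply (continuous_mult (fun _ => 2 * PI) (fun x => phi (1 - r * cs x))).
        * apply continuous_const.
        * now apply avg_cont.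
    - unfold h. rewrite !Rmult_1_r, sin_2PI, (Rmult_0_r (2 * PI)), sin_0. unfold minus, plus, opp; simpl. ring. }
  assert (E2 : RInt dh 0 1 = 2 * PI * avg r phi).
  { apply (RInt_scal (V := R_CompleteNormedModule) (fun x => phi (1 - r * cs x))). now apply avg_ex. }
  assert (E3 : avg r phi = 0).
  { rewrite E2 in E. assert (P := PI_RGT_0). apply Rmult_integral in E. destruct E; lra. }
  unfold phi in E3. rewrite avg_minus in E3; trivial.
  2: { apply contpos_mult; [apply contpos_const|apply contpos_Rpower]. }
  2: { apply contpos_minus; (apply contpos_mult; [apply contpos_const|apply contpos_Rpower]). }
  rewrite avg_minus in E3; trivial; try (apply contpos_mult; [apply contpos_const|apply contpos_Rpower]).
  rewrite !avg_scal in E3; trivial; try apply contpos_Rpower.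
  unfold F. lra.
Qed.

(** * Real powers with [0^p = 0], and functions tending to infinity *)

Lemma rpow_pos_eq x p : 0 < x -> rpow x p = Rpower x p.
Proof. intros H. unfold rpow. destruct (Rle_dec x 0); [lra|reflexivity]. Qed.

Lemma rpow_nonneg x p : 0 <= rpow x p.
Proof. unfold rpow. destruct (Rle_dec x 0); [lra|left; apply Rpower_pos]. Qed.

Lemma rpow_le x y p : 0 <= p -> x <= y -> rpow x p <= rpow y p.
Proof.
  intros Hp H. unfold rpow. destruct (Rle_dec x 0), (Rle_dec y 0); try lra.
  - left; apply Rpower_pos.
  - apply Rle_Rpower_l; lra.
Qed.

Lemma rpow_mult x y p : 0 <= x -> 0 <= y -> rpow (x * y) p = rpow x p * rpow y p.
Proof.
  intros [Hx|<-] [Hy|<-]; unfold rpow at 1.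
  - rewrite !rpow_pos_eq by assumption. destruct (Rle_dec (x * y) 0); [nra|].
    symmetry; now apply Rpower_mult_distr.
  - destruct (Rle_dec (x * 0) 0); [|lra]. unfold rpow at 2. destruct (Rle_dec 0 0); lra.
  - destruct (Rle_dec (0 * y) 0); [|lra]. unfold rpow at 1. destruct (Rle_dec 0 0); lra.
  - destruct (Rle_dec (0 * 0) 0); [|lra]. unfold rpow at 1. destruct (Rle_dec 0 0); lra.
Qed.

Lemma rpow_rpow_inv x p : 0 < x -> 0 < p -> rpow (rpow x p) (/ p) = x.
Proof.
  intros Hx Hp. rewrite (rpow_pos_eq x) by exact Hx. rewrite rpow_pos_eq by apply Rpower_pos.
  rewrite Rpower_mult, Rinv_r, Rpower_1; lra.
Qed.

Lemma rpow_2 x : rpow (Rabs x) 2 = x ^ 2.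
Proof.
  destruct (Req_dec x 0) as [->|N].
  - rewrite Rabs_R0. unfold rpow. destruct (Rle_dec 0 0); [simpl; ring|lra].
  - rewrite rpow_pos_eq by now apply Rabs_pos_lt. replace 2 with (1 + 1) by ring.
    rewrite Rpower_plus, Rpower_1 by now apply Rabs_pos_lt.
    rewrite <- Rabs_mult, Rabs_pos_eq; nra.
Qed.

Lemma continuous_rpow p x : 0 < p -> continuous (fun y => rpow y p) x.
Proof.
  intros Hp. destruct (Rtotal_order x 0) as [H|[->|H]].
  - apply (continuous_ext_loc _ (fun _ => 0)); [|apply continuous_const].
    assert (P : 0 < - x) by lra. exists (mkposreal _ P). intros y Hy.
    change (Rabs (y - x) < - x) in Hy. apply Rabs_def2 in Hy.
    unfold rpow. destruct (Rle_dec y 0); [reflexivity|lra].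
  - apply filterlim_locally. intros eps.
    exists (mkposreal _ (Rpower_pos eps (/ p))). intros y Hy.
    change (Rabs (y - 0) < Rpower eps (/ p)) in Hy.
    change (Rabs (rpow y p - rpow 0 p) < eps).
    unfold rpow at 2. destruct (Rle_dec 0 0); [|lra].
    rewrite Rminus_0_r in *. rewrite Rabs_pos_eq by apply rpow_nonneg.
    unfold rpow. destruct (Rle_dec y 0); [apply cond_pos|].
    apply Rlt_le_trans with (Rpower (Rpower eps (/ p)) p).
    + apply Rlt_Rpower_l; [exact Hp|]. apply Rabs_def2 in Hy. lra.
    + rewrite Rpower_mult, Rinv_l, Rpower_1; [lra|apply cond_pos|lra].
  - apply (continuous_ext_loc _ (fun y => Rpower y p)); [|now apply continuous_Rpower].
    exists (mkposreal _ H). intros y Hy. change (Rabs (y - x) < x) in Hy. apply Rabs_def2 in Hy.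
    symmetry. apply rpow_pos_eq. lra.
Qed.

Lemma continuous_rpow_abs p x : 0 < p -> continuous (fun y => rpow (Rabs y) p) x.
Proof.
  intros Hp. apply (continuous_comp Rabs (fun y => rpow y p)); [apply continuous_Rabs|now apply continuous_rpow].
Qed.

Lemma contpos_rpow f p : 0 < p -> contpos f -> contpos (fun j => rpow (Rabs (f j)) p).
Proof. intros Hp. apply (contpos_comp (fun y => rpow (Rabs y) p)). intros; now apply continuous_rpow_abs. Qed.

Lemma rpow_triangle p x y : 0 <= p ->
  rpow (Rabs (x + y)) p <= Rpower 2 p * (rpow (Rabs x) p + rpow (Rabs y) p).
Proof.
  intros Hp.
  assert (H : forall a b, 0 <= a -> 0 <= b -> a <= b -> rpow (a + b) p <= Rpower 2 p * (rpow a p + rpow b p)).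
  { intros a b Ha Hb Hab. apply Rle_trans with (rpow (2 * b) p); [apply rpow_le; lra|].
    rewrite rpow_mult by lra. rewrite (rpow_pos_eq 2) by lra.
    apply Rmult_le_compat_l; [left; apply Rpower_pos|]. generalize (rpow_nonneg a p); lra. }
  apply Rle_trans with (rpow (Rabs x + Rabs y) p); [apply rpow_le; [exact Hp|apply Rabs_triang]|].
  destruct (Rle_lt_dec (Rabs x) (Rabs y)).
  - apply H; try apply Rabs_pos; lra.
  - rewrite Rplus_comm, (Rplus_comm (rpow (Rabs x) p)). apply H; try apply Rabs_pos; lra.
Qed.

Lemma tends_inf_ge_mult f h c : 0 < c -> tends_inf f -> at_left 1 (fun r => c * f r <= h r) -> tends_inf h.
Proof.
  intros Hc Hf H M. generalize (filter_and _ _ (Hf (M / c)) H). apply filter_imp. intros r [H1 H2].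
  assert (c * (M / c) < c * f r) by (apply Rmult_lt_compat_l; lra).
  replace (c * (M / c)) with M in H0 by (field; lra). lra.
Qed.

Lemma tends_inf_rpow f p : 0 < p -> tends_inf f -> tends_inf (fun r => rpow (f r) p).
Proof.
  intros Hp Hf M. generalize (Hf (rpow (Rabs M + 1) (/ p))). apply filter_imp. intros r H.
  assert (A := Rabs_pos M). assert (B := Rle_abs M).
  assert (Q : 0 < rpow (Rabs M + 1) (/ p)) by (rewrite rpow_pos_eq by lra; apply Rpower_pos).
  apply Rlt_le_trans with (rpow (rpow (Rabs M + 1) (/ p)) p); [|apply rpow_le; lra].
  replace p with (/ / p) at 2 by (field; lra). rewrite rpow_rpow_inv; [lra|lra|now apply Rinv_0_lt_compat].
Qed.

Lemma tends_inf_power a : 0 < a -> tends_inf (fun r => Rpower (1 - r) (- a)).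
Proof.
  intros Ha M. set (K := Rabs M + 1). assert (KP : 0 < K) by (unfold K; generalize (Rabs_pos M); lra).
  apply (at_left_1_intro _ (1 - Rpower K (- / a))).
  { generalize (Rpower_pos K (- / a)); lra. }
  intros r Hr. apply Rlt_trans with K; [unfold K; generalize (Rle_abs M); lra|].
  rewrite Rpower_Ropp. rewrite <- (Rinv_inv K). apply Rinv_lt_contravar.
  - apply Rmult_lt_0_compat; [apply Rpower_pos|now apply Rinv_0_lt_compat].
  - apply Rlt_le_trans with (Rpower (Rpower K (- / a)) a).
    + apply Rlt_Rpower_l; lra.
    + rewrite Rpower_mult. replace (- / a * a) with (- (1)) by (field; lra).
      rewrite Rpower_Ropp, Rpower_1; lra.
Qed.

(** * Expectations of [X = 1/J] under the Jacobian density [J^(-b)] *)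

Definition expect (b r : R) (phi : R -> R) : R :=
  avg r (fun j => phi (/ j) * Rpower j (- b)) / F b r.

Definition mean (b r : R) : R := F (b + 1) r / F b r.

Section Expect.
Variables b r : R.
Hypothesis Hr : 0 <= r < 1.

Let wc phi : contpos phi -> contpos (fun j => phi (/ j) * Rpower j (- b)).
Proof.
  intros H. apply contpos_mult; [|apply contpos_Rpower].
  intros j Hj. apply (continuous_comp Rinv phi); [now apply contpos_inv|].
  apply H. now apply Rinv_0_lt_compat.
Qed.

Lemma expect_le f h : contpos f -> contpos h ->
  (forall x, / 2 <= x <= / (1 - r) -> f x <= h x) -> expect b r f <= expect b r h.
Proof.
  intros Hf Hh H. apply Rmult_le_compat_r; [left; apply Rinv_0_lt_compat; now apply F_pos|].
  apply avg_le; [exact Hr|now apply wc|now apply wc|].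
  intros j Hj. apply Rmult_le_compat_r; [left; apply Rpower_pos|]. apply H.
  split; apply Rinv_le_contravar; lra.
Qed.

Lemma expect_ext f h : (forall x, / 2 <= x <= / (1 - r) -> f x = h x) -> expect b r f = expect b r h.
Proof.
  intros H. unfold expect. f_equal. apply avg_ext; [exact Hr|]. intros j Hj. f_equal. apply H.
  split; apply Rinv_le_contravar; lra.
Qed.

Lemma expect_plus f h : contpos f -> contpos h -> expect b r (fun x => f x + h x) = expect b r f + expect b r h.
Proof.
  intros Hf Hh. unfold expect. rewrite <- Rdiv_plus_distr. f_equal.
  rewrite <- avg_plus; [|exact Hr|now apply wc|now apply wc].
  apply avg_ext; [exact Hr|]. intros; ring.
Qed.

Lemma expect_scal c f : contpos f -> expect b r (fun x => c * f x) = c * expect b r f.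
Proof.
  intros Hf. unfold expect. unfold Rdiv. rewrite <- Rmult_assoc. f_equal.
  rewrite <- avg_scal; [|exact Hr|now apply wc].
  apply avg_ext; [exact Hr|]. intros; ring.
Qed.

Lemma expect_const c : expect b r (fun _ => c) = c.
Proof.
  unfold expect. rewrite avg_scal; [|exact Hr|apply contpos_Rpower].
  fold (F b r). field. generalize (F_pos b r Hr); lra.
Qed.

Lemma expect_Rpower p : expect b r (fun x => Rpower x p) = F (b + p) r / F b r.
Proof.
  unfold expect. f_equal. apply avg_ext; [exact Hr|]. intros j Hj.
  replace (Rpower (/ j) p) with (Rpower j (- p)).
  - rewrite <- Rpower_plus. f_equal. ring.
  - unfold Rpower. rewrite ln_Rinv by lra. f_equal. ring.
Qed.

Lemma expect_pow n : expect b r (fun x => x ^ n) = F (b + INR n) r / F b r.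
Proof.
  rewrite <- expect_Rpower. apply expect_ext. intros x Hx. symmetry. apply Rpower_pow. lra.
Qed.

Lemma expect_id : expect b r (fun x => x) = mean b r.
Proof.
  rewrite (expect_ext _ (fun x => x ^ 1)) by (intros; ring). now rewrite expect_pow.
Qed.

Lemma mean_bounds : / 2 <= mean b r <= / (1 - r).
Proof.
  rewrite <- expect_id. split.
  - rewrite <- (expect_const (/ 2)). apply expect_le; [apply contpos_const|apply contpos_id|]. intros; lra.
  - rewrite <- (expect_const (/ (1 - r))). apply expect_le; [apply contpos_id|apply contpos_const|]. intros; lra.
Qed.

Lemma contpos_central : contpos (fun x => x - mean b r).
Proof. apply contpos_minus; [apply contpos_id|apply contpos_const]. Qed.

Lemma contpos_monomial c n : contpos (fun x => c * x ^ n).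
Proof. apply contpos_mult; [apply contpos_const|]. apply contpos_pow, contpos_id. Qed.

Lemma expect_variance : expect b r (fun x => (x - mean b r) ^ 2) = F (b + 2) r / F b r - mean b r ^ 2.
Proof.
  set (m := mean b r).
  rewrite (expect_ext _ (fun x => 1 * x ^ 2 + (- (2 * m) * x ^ 1 + m ^ 2 * x ^ 0))) by (intros; ring).
  rewrite expect_plus; [|apply contpos_monomial|apply contpos_plus; apply contpos_monomial].
  rewrite expect_plus; [|apply contpos_monomial|apply contpos_monomial].
  rewrite !expect_scal by apply contpos_pow, contpos_id.
  rewrite !expect_pow. replace (INR 2) with 2 by (simpl; ring). simpl INR. rewrite Rplus_0_r.
  fold (mean b r). fold m. field. generalize (F_pos b r Hr); lra.
Qed.

Lemma expect_third : expect b r (fun x => (x - mean b r) ^ 3) =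
  F (b + 3) r / F b r - 3 * mean b r * (F (b + 2) r / F b r) + 2 * mean b r ^ 3.
Proof.
  set (m := mean b r).
  rewrite (expect_ext _ (fun x => 1 * x ^ 3 + (- (3 * m) * x ^ 2 + (3 * m ^ 2 * x ^ 1 + - m ^ 3 * x ^ 0)))) by (intros; ring).
  rewrite expect_plus; [|apply contpos_monomial|apply contpos_plus; [apply contpos_monomial|apply contpos_plus; apply contpos_monomial]].
  rewrite expect_plus; [|apply contpos_monomial|apply contpos_plus; apply contpos_monomial].
  rewrite expect_plus; [|apply contpos_monomial|apply contpos_monomial].
  rewrite !expect_scal by apply contpos_pow, contpos_id.
  rewrite !expect_pow. replace (INR 2) with 2 by (simpl; ring). replace (INR 3) with 3 by (simpl; ring). simpl INR. rewrite Rplus_0_r.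
  fold (mean b r). fold m. field. generalize (F_pos b r Hr); lra.
Qed.

(* Jensen's inequality up to the factor 2, from [y <= a + a^(1-p) y^p]. *)
Lemma expect_jensen f p : contpos f -> 1 <= p ->
  rpow (expect b r (fun x => Rabs (f x)) / 2) p <= expect b r (fun x => rpow (Rabs (f x)) p).
Proof.
  intros Hf Hp. set (y := expect b r (fun x => Rabs (f x))).
  assert (Cr : contpos (fun x => rpow (Rabs (f x)) p)) by (apply contpos_rpow; [lra|exact Hf]).
  assert (H0 : 0 <= expect b r (fun x => rpow (Rabs (f x)) p)).
  { rewrite <- (expect_const 0). apply expect_le; [apply contpos_const|exact Cr|]. intros; apply rpow_nonneg. }
  destruct (Rle_lt_dec y 0) as [N|P].
  { unfold rpow at 1. destruct (Rle_dec (y / 2) 0); lra. }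
  set (a := y / 2). assert (A : 0 < a) by (unfold a; lra).
  assert (H : y <= a + Rpower a (1 - p) * expect b r (fun x => rpow (Rabs (f x)) p)).
  { rewrite <- expect_scal by exact Cr. rewrite <- (expect_const a) at 1.
    rewrite <- expect_plus; [|apply contpos_const|apply contpos_mult; [apply contpos_const|exact Cr]].
    apply expect_le; [now apply contpos_abs|apply contpos_plus; [apply contpos_const|apply contpos_mult; [apply contpos_const|exact Cr]]|].
    intros x _. set (z := Rabs (f x)). assert (Z : 0 <= z) by apply Rabs_pos.
    assert (Q := Rpower_pos a (1 - p)). assert (Q1 := rpow_nonneg z p).
    destruct (Rle_lt_dec z a) as [h|h].
    - assert (0 <= Rpower a (1 - p) * rpow z p) by (apply Rmult_le_pos; lra). lra.
    - rewrite rpow_pos_eq by lra. replace p with (1 + (p - 1)) at 2 by ring. rewrite Rpower_plus, Rpower_1 by lra.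
      replace (1 - p) with (- (p - 1)) by ring.
      assert (Rpower a (p - 1) <= Rpower z (p - 1)) by (apply Rle_Rpower_l; lra).
      rewrite Rpower_Ropp. assert (Q2 := Rpower_pos a (p - 1)).
      assert (1 <= / Rpower a (p - 1) * Rpower z (p - 1)).
      { apply (Rmult_le_reg_l (Rpower a (p - 1))); [exact Q2|]. rewrite <- Rmult_assoc, Rinv_r, Rmult_1_l, Rmult_1_r by lra. exact H. }
      nra. }
  assert (Ey : y = 2 * a) by (unfold a; field).
  rewrite rpow_pos_eq by exact A.
  replace (Rpower a p) with (Rpower a (p - 1) * a).
  2: { rewrite <- (Rpower_1 a) at 2 by exact A. rewrite <- Rpower_plus. f_equal. ring. }
  assert (Q := Rpower_pos a (p - 1)).
  replace (expect b r (fun x => rpow (Rabs (f x)) p)) with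
    (Rpower a (p - 1) * (Rpower a (1 - p) * expect b r (fun x => rpow (Rabs (f x)) p))).
  - apply Rmult_le_compat_l; lra.
  - rewrite <- Rmult_assoc, <- Rpower_plus. replace (p - 1 + (1 - p)) with 0 by ring. rewrite Rpower_O by exact A. ring.
Qed.

(** [X] and its mean both lie between 0 and [1/(1 - r)], so the variance is at most [1/(1 - r)]
    times the mean absolute deviation. The variance is the quantity that the recurrence of [F]
    evaluates. *)
Lemma expect_abs_ge_variance :
  (1 - r) * (F (b + 2) r / F b r - mean b r ^ 2) <= expect b r (fun x => Rabs (x - mean b r)).
Proof.
  rewrite <- expect_variance. rewrite <- expect_scal by apply contpos_pow, contpos_central.
  apply expect_le.
  - apply contpos_mult; [apply contpos_const|]. apply contpos_pow, contpos_central.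
  - apply contpos_abs, contpos_central.
  - intros x Hx. assert (M := mean_bounds).
    assert (H : Rabs (x - mean b r) <= / (1 - r)) by (apply Rabs_le; lra).
    rewrite <- pow2_abs. assert (Z := Rabs_pos (x - mean b r)).
    assert ((1 - r) * Rabs (x - mean b r) <= (1 - r) * / (1 - r)) by (apply Rmult_le_compat_l; lra).
    rewrite Rinv_r in H0 by lra. nra.
Qed.

End Expect.

(* Dominated convergence by hand: the integral over [0,h] is small uniformly in [r], and
   [phi] is uniformly continuous on the values taken over [h,1/2]. *)
Lemma avg_converges (phi : R -> R -> R) (m : R -> R) (m1 s C : R) :
  0 <= s < 1 / 2 -> 0 < C ->
  (forall j z, 0 < j -> continuity_2d_pt phi j z) ->
  filterlim m (at_left 1) (locally m1) ->
  at_left 1 (fun r => forall j, 0 < j <= 2 -> Rabs (phi j (m r)) <= C * Rpower j (- s)) ->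
  exists l : R, filterlim (fun r => avg r (fun j => phi j (m r))) (at_left 1) (locally l).
Proof.
  intros Hs HC Hphi Hm Hb.
  apply (filterlim_locally_cauchy (U := R_CompleteSpace) (F := at_left 1)). intros eps.
  set (k := 1 - 2 * s). assert (K : 0 < k) by (unfold k; lra).
  set (A := C * (Rpower 8 s / k)).
  assert (HA : 0 < A).
  { unfold A. apply Rmult_lt_0_compat; [exact HC|]. apply Rdiv_lt_0_compat; [apply Rpower_pos|exact K]. }
  (* Error budget: each of the two tails gets [eps/8] and the middle part stays below [eps/8]; after
     the factor 2 of [avg_half] the total is below [3/4 eps]. *)
  set (tg := eps / (8 * A)).
  assert (Htg : 0 < tg) by (unfold tg; apply Rdiv_lt_0_compat; [apply cond_pos|lra]).
  set (h := Rmin (1 / 2) (Rpower tg (/ k) / 2)).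
  assert (Hh : 0 < h) by (unfold h; apply Rmin_pos; [lra|generalize (Rpower_pos tg (/ k)); lra]).
  assert (Hh1 : h <= 1 / 2) by apply Rmin_l.
  assert (Hh2 : Rpower (2 * h) k <= tg).
  { replace tg with (Rpower (Rpower tg (/ k)) k) by (rewrite Rpower_mult, Rinv_l, Rpower_1; lra).
    apply Rle_Rpower_l; [lra|]. split; [lra|]. generalize (Rmin_r (1 / 2) (Rpower tg (/ k) / 2)). fold h. lra. }
  assert (He : 0 < eps / 4) by (generalize (cond_pos eps); lra).
  (* For [x >= h], [jac_sqrt_lower] keeps [1 - r cos] in the compact interval from [h^2/8] to 2,
     whatever [r] is; near the limit [m r] is within 1 of [m1]. *)
  destruct (uniform_continuity_2d phi (h * h / 8) 2 (m1 - 1) (m1 + 1)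
     (fun x y Hx _ => Hphi x y ltac:(nra)) (mkposreal _ He)) as [d Hd]. simpl in Hd.
  assert (Hd2 : 0 < Rmin 1 (d / 2)) by (apply Rmin_pos; [lra|generalize (cond_pos d); lra]).
  assert (Hmr := proj1 (filterlim_locally _ _) Hm (mkposreal _ Hd2)).
  assert (Hnear : at_left 1 (fun r => 0 < r < 1 /\ 1 - r < d /\ 1 - r <= h * h)).
  { assert (D0 := cond_pos d).
    apply (at_left_1_intro _ (Rmax 0 (Rmax (1 - d) (1 - h * h)))).
    - apply Rmax_lub_lt; [lra|]. apply Rmax_lub_lt; nra.
    - intros r Hr. assert (R1 := Rmax_l 0 (Rmax (1 - d) (1 - h * h))).
      assert (R2 := Rmax_r 0 (Rmax (1 - d) (1 - h * h))).
      assert (R3 := Rmax_l (1 - d) (1 - h * h)). assert (R4 := Rmax_r (1 - d) (1 - h * h)). lra. }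
  exists (fun r => (Rabs (m r - m1) < Rmin 1 (d / 2) /\ (0 < r < 1 /\ 1 - r < d /\ 1 - r <= h * h)) /\
    (forall j, 0 < j <= 2 -> Rabs (phi j (m r)) <= C * Rpower j (- s))).
  split; [apply filter_and; [apply filter_and; [exact Hmr|exact Hnear]|exact Hb]|].
  assert (Cp : forall r, contpos (fun j => phi j (m r))).
  { intros r j Hj. apply (cont2d_fst phi). now apply Hphi. }
  assert (Tail : forall r, 0 < r < 1 -> 1 - r <= h * h ->
     (forall j, 0 < j <= 2 -> Rabs (phi j (m r)) <= C * Rpower j (- s)) ->
     Rabs (RInt (fun x => phi (1 - r * cs x) (m r)) 0 h) <= eps / 8).
  { intros r Hr Hrh Hbr. assert (Hr0 : 0 <= r < 1) by lra.
    assert (X1 := avg_ex r _ 0 h Hr0 (Cp r)). assert (X2 := avg_ex r _ 0 h Hr0 (contpos_abs _ (Cp r))).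
    assert (X3 := avg_ex r (fun j => C * Rpower j (- s)) 0 h Hr0 (contpos_mult _ _ (contpos_const C) (contpos_Rpower (- s)))).
    eapply Rle_trans; [apply abs_RInt_le; [lra|exact X1]|].
    eapply Rle_trans.
    { apply (RInt_le _ (fun x => C * Rpower (1 - r * cs x) (- s))); [lra|exact X2|exact X3|].
      intros x _. apply Hbr. generalize (avg_arg_bound r x Hr0); lra. }
    assert (E : RInt (fun x => C * Rpower (1 - r * cs x) (- s)) 0 h = C * RInt (fun x => Rpower (1 - r * cs x) (- s)) 0 h).
    { apply (RInt_scal (V := R_CompleteNormedModule) (fun x => Rpower (1 - r * cs x) (- s))).
      apply (avg_ex r (fun j => Rpower j (- s))); [exact Hr0|apply contpos_Rpower]. }
    rewrite E.
    assert (T := RInt_jac_pow_tail s r h Hs Hr0 ltac:(lra)). fold k in T.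
    assert (D0 : 0 < sqrt (1 - r)) by (apply sqrt_lt_R0; lra).
    assert (D1 : sqrt (1 - r) <= h).
    { rewrite <- (sqrt_square h) by lra. apply sqrt_le_1_alt. exact Hrh. }
    assert (T2 : Rpower (sqrt (1 - r) + h) k <= tg).
    { eapply Rle_trans; [|exact Hh2]. apply Rle_Rpower_l; lra. }
    apply Rle_trans with (C * (Rpower 8 s / k * tg)).
    - apply Rmult_le_compat_l; [lra|]. eapply Rle_trans; [exact T|]. apply Rmult_le_compat_l; [|exact T2].
      left. apply Rdiv_lt_0_compat; [apply Rpower_pos|exact K].
    - rewrite <- Rmult_assoc. fold A. unfold tg. right. field. lra. }
  intros r r' [[Hm1 (Hr & Hrd & Hrh)] Hbr] [[Hm2 (Hr' & Hrd' & Hrh')] Hbr'].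
  change (Rabs (avg r' (fun j => phi j (m r')) - avg r (fun j => phi j (m r))) < eps).
  assert (Hr0 : 0 <= r < 1) by lra. assert (Hr0' : 0 <= r' < 1) by lra.
  rewrite !avg_half by auto.
  assert (Ch : forall r, 0 <= r < 1 -> RInt (fun x => phi (1 - r * cs x) (m r)) 0 (1 / 2) =
     RInt (fun x => phi (1 - r * cs x) (m r)) 0 h + RInt (fun x => phi (1 - r * cs x) (m r)) h (1 / 2)).
  { intros z Hz. symmetry. apply (RInt_Chasles (V := R_CompleteNormedModule) (fun x => phi (1 - z * cs x) (m z)));
    apply (avg_ex z (fun j => phi j (m z))); auto. }
  rewrite (Ch r Hr0), (Ch r' Hr0').
  assert (T1 := Tail r Hr Hrh Hbr). assert (T2 := Tail r' Hr' Hrh' Hbr').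
  assert (Y1 := avg_ex r _ h (1 / 2) Hr0 (Cp r)). assert (Y2 := avg_ex r' _ h (1 / 2) Hr0' (Cp r')).
  cbv beta in Y1, Y2.
  assert (Mid : Rabs (RInt (fun x => phi (1 - r' * cs x) (m r')) h (1 / 2) - RInt (fun x => phi (1 - r * cs x) (m r)) h (1 / 2)) <= (1 / 2 - h) * (eps / 4)).
  { assert (E : RInt (fun x => phi (1 - r' * cs x) (m r')) h (1 / 2) - RInt (fun x => phi (1 - r * cs x) (m r)) h (1 / 2) =
      RInt (fun x => phi (1 - r' * cs x) (m r') - phi (1 - r * cs x) (m r)) h (1 / 2)).
    { symmetry. exact (RInt_minus (V := R_CompleteNormedModule) _ _ _ _ Y2 Y1). }
    rewrite E. apply abs_RInt_le_const; [lra| |].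
    - exact (ex_RInt_minus (V := R_CompleteNormedModule) _ _ _ _ Y2 Y1).
    - intros x Hx. left.
      assert (R1 := Rmin_l 1 (d / 2)). assert (R2 := Rmin_r 1 (d / 2)).
      apply Rabs_def2 in Hm1. apply Rabs_def2 in Hm2.
      assert (JL : forall z, 0 < z < 1 -> 1 - z <= h * h -> h * h / 8 <= 1 - z * cs x <= 2).
      { intros z Hz _. split.
        - eapply Rle_trans; [|apply (jac_sqrt_lower z x); lra]. assert (0 < sqrt (1 - z)) by (apply sqrt_lt_R0; lra). nra.
        - apply (avg_arg_bound z x ltac:(lra)). }
      apply Hd; try (apply JL; assumption); try lra.
      + replace (1 - r' * cs x - (1 - r * cs x)) with ((r - r') * cs x) by ring.
        rewrite Rabs_mult. assert (Rabs (cs x) <= 1) by (apply Rabs_le; apply cs_bound).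
        assert (Rabs (r - r') < d) by (apply Rabs_def1; lra).
        assert (P1 := Rabs_pos (r - r')). nra.
      + apply Rabs_def1; lra. }
  apply Rabs_le_between in T1. apply Rabs_le_between in T2. apply Rabs_le_between in Mid.
  assert ((1 / 2 - h) * (eps / 4) < eps / 8) by (generalize (cond_pos eps); nra).
  apply Rabs_def1; lra.
Qed.

Lemma filterlim_Rmult (f h : R -> R) (a b : R) :
  filterlim f (at_left 1) (locally a) -> filterlim h (at_left 1) (locally b) ->
  filterlim (fun x => f x * h x) (at_left 1) (locally (a * b)).
Proof.
  intros Hf Hh. apply (filterlim_comp_2 (G := locally a) (H := locally b) f h Rmult); trivial.
  apply (filterlim_mult (K := R_AbsRing)).
Qed.

Lemma filterlim_continuous (f h : R -> R) (a : R) :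
  filterlim f (at_left 1) (locally a) -> continuous h a ->
  filterlim (fun x => h (f x)) (at_left 1) (locally (h a)).
Proof. intros Hf Hh. now apply (filterlim_comp _ _ _ f h (at_left 1) (locally a)). Qed.

Lemma F_converges s : s < 1 / 2 -> exists l, filterlim (F s) (at_left 1) (locally l).
Proof.
  intros Hs. set (s1 := Rmax s 0).
  assert (S1 : 0 <= s1 < 1 / 2) by (split; [apply Rmax_r|apply Rmax_lub_lt; lra]).
  assert (S2 : s <= s1) by apply Rmax_l.
  apply (avg_converges (fun j _ => Rpower j (- s)) (fun _ => 0) 0 s1 (Rpower 2 (s1 - s))).
  - exact S1.
  - apply Rpower_pos.
  - intros j z Hj. apply (cont2d_of_fst (fun j => Rpower j (- s))). now apply continuous_Rpower.
  - apply filterlim_const.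
  - apply at_left_1_range. intros r _ j Hj. rewrite Rabs_pos_eq by (left; apply Rpower_pos).
    replace (- s) with ((s1 - s) + - s1) by ring. rewrite Rpower_plus.
    apply Rmult_le_compat_r; [left; apply Rpower_pos|]. apply Rle_Rpower_l; lra.
Qed.

(** * The norms of [u_x] as functions of the radius *)

(** With [r = |lam| e], these are [spd], the [p]-th power of the norm of [u_x] in [L^p], and the
    integral of [u_x^3] up to the sign of [lam]. The quotient by [r] comes from
    [cos / J = (X - 1) / (lam e)]. *)
Definition speed (lam r : R) : R := Rpower (F (/ lam) r) (- (2 * lam)).
Definition moment (lam p r : R) : R :=
  rpow (speed lam r / r) p * expect (/ lam) r (fun x => rpow (Rabs (x - mean (/ lam) r)) p).
Definition third (lam r : R) : R := (speed lam r / r) ^ 3 * expect (/ lam) r (fun x => (x - mean (/ lam) r) ^ 3).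

Lemma speed_pos lam r : 0 < speed lam r.
Proof. apply Rpower_pos. Qed.

Lemma speed_le_div lam r : 0 < r < 1 -> speed lam r <= speed lam r / r.
Proof.
  intros Hr. rewrite <- (Rmult_1_r (speed lam r)) at 1. apply Rmult_le_compat_l; [left; apply speed_pos|].
  rewrite <- Rinv_1 at 1. apply Rinv_le_contravar; lra.
Qed.

Lemma moment_nonneg_expect b r p : 0 <= r < 1 -> 0 < p ->
  0 <= expect b r (fun x => rpow (Rabs (x - mean b r)) p).
Proof.
  intros Hr Hp. rewrite <- (expect_const b r Hr 0). apply expect_le; [exact Hr|apply contpos_const| |].
  - apply contpos_rpow; [exact Hp|apply contpos_central].
  - intros; apply rpow_nonneg.
Qed.

(** * Negative [lam] *)

(** For [b < 0] the weight [J^(-b)] is a positive power of a bounded base, so the normalisation, and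
    with it the speed, stays between positive constants. For negative [lam] only the expectations
    decide. *)
Lemma F_bounds_neg b : b < 0 -> exists c C, 0 < c /\ 0 < C /\ forall r, 0 <= r < 1 -> c <= F b r <= C.
Proof.
  intros Hb. destruct (F_lower_const b) as (c & Hc & H). exists c, (Rpower 2 (- b)).
  split; [exact Hc|]. split; [apply Rpower_pos|]. intros r Hr. split; [now apply H|]. apply F_upper_nonpos; lra.
Qed.

Lemma speed_bounds_neg lam : lam < 0 ->
  exists c C, 0 < c /\ 0 < C /\ forall r, 0 <= r < 1 -> c <= speed lam r <= C.
Proof.
  intros Hl. assert (Hb : / lam < 0) by now apply Rinv_lt_0_compat.
  destruct (F_bounds_neg _ Hb) as (c & C & Hc & HC & H).
  exists (Rpower c (- (2 * lam))), (Rpower C (- (2 * lam))).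
  split; [apply Rpower_pos|]. split; [apply Rpower_pos|].
  intros r Hr. destruct (H r Hr). split; apply Rle_Rpower_l; lra.
Qed.

Lemma mean_bounded_neg b : b < - (1 / 2) -> exists M, 0 < M /\ forall r, 0 <= r < 1 -> mean b r <= M.
Proof.
  intros Hb. destruct (F_lower_const b) as (c & Hc & H).
  destruct (F_upper_bounded (b + 1)) as (C & HC & H'); [lra|].
  exists (C / c). split; [now apply Rdiv_lt_0_compat|]. intros r Hr. unfold mean.
  apply Rmult_le_compat; [left; now apply F_pos|left; apply Rinv_0_lt_compat; now apply F_pos|now apply H'|].
  apply Rinv_le_contravar; [exact Hc|now apply H].
Qed.

Lemma ratio_tends_inf_neg b s : b < 0 -> 1 / 2 <= s -> tends_inf (fun r => F s r / F b r).
Proof.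
  intros Hb Hs. destruct (F_bounds_neg b Hb) as (c & C & Hc & HC & H).
  apply (tends_inf_ge_mult (F s) _ (/ C)); [now apply Rinv_0_lt_compat|now apply F_tends_inf|].
  apply at_left_1_range. intros r Hr. rewrite Rmult_comm. apply Rmult_le_compat_l; [left; apply F_pos; lra|].
  apply Rinv_le_contravar; [apply F_pos; lra|apply H; lra].
Qed.

Lemma moment_tends_inf_of_expect lam p : lam < 0 -> 0 < p ->
  tends_inf (fun r => expect (/ lam) r (fun x => rpow (Rabs (x - mean (/ lam) r)) p)) ->
  tends_inf (moment lam p).
Proof.
  intros Hl Hp H. destruct (speed_bounds_neg lam Hl) as (c & C & Hc & HC & Hs).
  apply (tends_inf_ge_mult _ _ (rpow c p)) with (2 := H); [rewrite rpow_pos_eq by exact Hc; apply Rpower_pos|].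
  apply at_left_1_range. intros r Hr. apply Rmult_le_compat_r; [apply moment_nonneg_expect; lra|].
  apply rpow_le; [lra|]. apply Rle_trans with (speed lam r); [apply Hs; lra|now apply speed_le_div].
Qed.

Lemma moment_diverges_neg lam p : 1 <= p -> lam <= - 2 / (2 * p - 1) -> tends_inf (moment lam p).
Proof.
  intros Hp Hl.
  assert (Hl0 : lam < 0).
  { assert (0 < 2 / (2 * p - 1)) by (apply Rdiv_lt_0_compat; lra).
    replace (- 2 / (2 * p - 1)) with (- (2 / (2 * p - 1))) in Hl by (field; lra). lra. }
  assert (Hb : / lam < 0) by now apply Rinv_lt_0_compat.
  (* The hypothesis in the form [b + p >= 1/2], under which [F (b + p)] diverges. *)
  assert (Hpb : - (p - 1 / 2) <= / lam).
  { replace (- (p - 1 / 2)) with (/ (- 2 / (2 * p - 1))) by (field; lra).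
    apply Rmult_le_reg_r with (- lam); [lra|].
    replace (/ lam * - lam) with (-1) by (field; lra).
    replace (/ (-2 / (2 * p - 1)) * - lam) with ((p - 1 / 2) * lam) by (field; lra).
    assert ((p - 1 / 2) * lam <= (p - 1 / 2) * (- 2 / (2 * p - 1))) by (apply Rmult_le_compat_l; lra).
    replace ((p - 1 / 2) * (- 2 / (2 * p - 1))) with (-1) in H by (field; lra). exact H. }
  set (b := / lam) in *.
  apply moment_tends_inf_of_expect; [exact Hl0|lra|]. fold b.
  assert (Cc : forall r, contpos (fun x => rpow (Rabs (x - mean b r)) p)).
  { intros r. apply contpos_rpow; [lra|apply contpos_central]. }
  destruct (Rle_lt_dec (- (1 / 2)) b) as [h|h].
  - (* The mean blows up, and [X <= 1] on half of the period. *)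
    destruct (F_bounds_neg b Hb) as (c & C & Hc & HC & HF).
    assert (Hm : tends_inf (fun r => mean b r - 1)).
    { intros M. generalize (ratio_tends_inf_neg b (b + 1) Hb ltac:(lra) (M + 1)).
      apply filter_imp. intros r. unfold mean. lra. }
    apply (tends_inf_ge_mult (fun r => rpow (mean b r - 1) p) _ (/ 2 * / C)).
    + apply Rmult_lt_0_compat; apply Rinv_0_lt_compat; lra.
    + now apply (tends_inf_rpow (fun r => mean b r - 1)); [lra|].
    + generalize (filter_and _ _ (Hm 0) (at_left_1_range (fun r => 0 < r < 1) (fun r H => H))).
      apply filter_imp. intros r [H1 H2].
      assert (Hr : 0 <= r < 1) by lra.
      unfold expect.
      assert (P := rpow_nonneg (mean b r - 1) p).
      apply Rle_trans with ((rpow (mean b r - 1) p / 2) * / F b r).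
      * replace (/ 2 * / C * rpow (mean b r - 1) p) with (rpow (mean b r - 1) p / 2 * / C) by (field; lra).
        apply Rmult_le_compat_l; [lra|]. apply Rinv_le_contravar; [now apply F_pos|now apply HF].
      * apply Rmult_le_compat_r; [left; apply Rinv_0_lt_compat; now apply F_pos|].
        apply avg_ge_far; [exact Hr| | |].
        -- apply contpos_mult; [|apply contpos_Rpower].
           intros j Hj. apply (continuous_comp Rinv (fun x => rpow (Rabs (x - mean b r)) p)); [now apply contpos_inv|].
           apply Cc. now apply Rinv_0_lt_compat.
        -- intros j _. apply Rmult_le_pos; [apply rpow_nonneg|left; apply Rpower_pos].
        -- intros j Hj. assert (1 <= Rpower j (- b)) by (apply Rpower_ge_1; lra).
           assert (/ j <= 1) by (rewrite <- Rinv_1; apply Rinv_le_contravar; lra).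
           assert (rpow (mean b r - 1) p <= rpow (Rabs (/ j - mean b r)) p).
           { apply rpow_le; [lra|]. rewrite Rabs_left1 by lra. lra. }
           rewrite <- (Rmult_1_r (rpow (mean b r - 1) p)). apply Rmult_le_compat; lra.
  (* Here the mean is bounded, so [E X^p <= 2^p (E |X - EX|^p + M^p)] passes the divergence of the
     raw moment on to the central one. *)
  - destruct (mean_bounded_neg b h) as (M & HM & Hmean).
    assert (Hbp : 1 / 2 <= b + p) by lra.
    intros N. generalize (filter_and _ _ (ratio_tends_inf_neg b (b + p) Hb Hbp (Rpower 2 p * (N + rpow M p)))
       (at_left_1_range (fun r => 0 < r < 1) (fun r H => H))).
    apply filter_imp. intros r [H1 H2]. assert (Hr : 0 <= r < 1) by lra.
    rewrite <- expect_Rpower in H1 by exact Hr.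
    assert (H3 : expect b r (fun x => Rpower x p) <=
       Rpower 2 p * (expect b r (fun x => rpow (Rabs (x - mean b r)) p) + rpow M p)).
    { rewrite <- (expect_const b r Hr (rpow M p)) at 1.
      rewrite <- expect_plus; [|exact Hr|apply Cc|apply contpos_const].
      rewrite <- expect_scal; [|exact Hr|apply contpos_plus; [apply Cc|apply contpos_const]].
      apply expect_le; [exact Hr|apply contpos_Rpower|apply contpos_mult; [apply contpos_const|apply contpos_plus; [apply Cc|apply contpos_const]]|].
      intros x Hx.
      assert (T := rpow_triangle p (x - mean b r) (mean b r) ltac:(lra)).
      replace (x - mean b r + mean b r) with x in T by ring.
      rewrite (Rabs_pos_eq x) in T by lra. rewrite rpow_pos_eq in T by lra.
      eapply Rle_trans; [exact T|]. apply Rmult_le_compat_l; [left; apply Rpower_pos|].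
      apply Rplus_le_compat_l. apply rpow_le; [lra|]. assert (B := mean_bounds b r Hr).
      rewrite Rabs_pos_eq by lra. now apply Hmean. }
    assert (P := Rpower_pos 2 p).
    assert (Rpower 2 p * (N + rpow M p) < Rpower 2 p * (expect b r (fun x => rpow (Rabs (x - mean b r)) p) + rpow M p)) by lra.
    apply Rmult_lt_reg_l in H; lra.
Qed.

Lemma moment_converges_neg lam p : 1 <= p -> - 2 / (2 * p - 1) < lam < 0 ->
  exists l, filterlim (moment lam p) (at_left 1) (locally l).
Proof.
  intros Hp [Hl Hl0].
  assert (Hb : / lam < 0) by now apply Rinv_lt_0_compat.
  assert (Hpb : / lam < - (p - 1 / 2)).
  { apply Rmult_lt_reg_r with (- lam); [lra|].
    replace (/ lam * - lam) with (-1) by (field; lra).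
    assert ((p - 1 / 2) * (- 2 / (2 * p - 1)) < (p - 1 / 2) * lam) by (apply Rmult_lt_compat_l; lra).
    replace ((p - 1 / 2) * (- 2 / (2 * p - 1))) with (-1) in H by (field; lra). lra. }
  set (b := / lam) in *.
  destruct (F_converges b ltac:(lra)) as [l0 H0]. destruct (F_converges (b + 1) ltac:(lra)) as [l1 H1].
  destruct (F_bounds_neg b Hb) as (c & C & Hc & HC & HF).
  assert (L0 : 0 < l0).
  { apply Rlt_le_trans with c; [exact Hc|].
    apply (filterlim_le (F := at_left 1) (fun _ => c) (F b) (Finite c) (Finite l0)).
    - apply at_left_1_range. intros r Hr. apply HF; lra.
    - apply filterlim_const.
    - exact H0. }
  assert (Hinv : filterlim (fun r => / F b r) (at_left 1) (locally (/ l0))).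
  { apply (filterlim_continuous (F b) Rinv); [exact H0|]. apply continuous_Rinv. lra. }
  assert (Hm : filterlim (mean b) (at_left 1) (locally (l1 * / l0))) by (now apply filterlim_Rmult).
  destruct (mean_bounded_neg b ltac:(lra)) as (M & HM & Hmean).
  (* [|X - EX|^p J^(-b)] is at most a sum of multiples of [J^(-(b+p))] and [J^(-b)]. As [J <= 2], a
     constant times [J^(-s)] dominates both, and [s < 1/2] makes this integrable uniformly in
     [r]. *)
  set (s := Rmax (b + p) 0).
  assert (S1 : 0 <= s < 1 / 2) by (split; [apply Rmax_r|apply Rmax_lub_lt; lra]).
  assert (S2 : b + p <= s) by apply Rmax_l.
  assert (HA : exists l : R, filterlim (fun r => avg r (fun j => rpow (Rabs (/ j - mean b r)) p * Rpower j (- b))) (at_left 1) (locally l)).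
  { apply (avg_converges (fun j m => rpow (Rabs (/ j - m)) p * Rpower j (- b)) (mean b) (l1 * / l0) s
      (Rpower 2 p * (Rpower 2 (s - (b + p)) + rpow M p * Rpower 2 (s - b)))).
    - exact S1.
    - apply Rmult_lt_0_compat; [apply Rpower_pos|].
      assert (0 <= rpow M p * Rpower 2 (s - b)) by (apply Rmult_le_pos; [apply rpow_nonneg|left; apply Rpower_pos]).
      generalize (Rpower_pos 2 (s - (b + p))); lra.
    - intros j z Hj. apply continuity_2d_pt_mult.
      + apply (continuity_1d_2d_pt_comp (fun y => rpow (Rabs y) p) (fun j m => / j - m)).
        * apply continuity_pt_filterlim. apply continuous_rpow_abs. lra.
        * apply continuity_2d_pt_minus; [|apply continuity_2d_pt_id2].
          apply continuity_2d_pt_inv; [apply continuity_2d_pt_id1|lra].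
      + apply (cont2d_of_fst (fun j => Rpower j (- b))). now apply continuous_Rpower.
    - exact Hm.
    - apply at_left_1_range. intros r Hr j Hj. assert (Hr0 : 0 <= r < 1) by lra.
      rewrite Rabs_pos_eq by (apply Rmult_le_pos; [apply rpow_nonneg|left; apply Rpower_pos]).
      assert (T := rpow_triangle p (/ j) (- mean b r) ltac:(lra)).
      assert (Q : 0 < / j) by (apply Rinv_0_lt_compat; lra).
      rewrite Rabs_Ropp in T. rewrite (Rabs_pos_eq (/ j)), (rpow_pos_eq (/ j)) in T by lra.
      assert (T1 : rpow (Rabs (mean b r)) p <= rpow M p).
      { apply rpow_le; [lra|]. assert (B := mean_bounds b r Hr0). rewrite Rabs_pos_eq by lra. now apply Hmean. }
      assert (W := Rpower_pos j (- b)).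
      apply Rle_trans with (Rpower 2 p * (Rpower (/ j) p + rpow M p) * Rpower j (- b)).
      { apply Rmult_le_compat_r; [lra|]. eapply Rle_trans; [exact T|].
        apply Rmult_le_compat_l; [left; apply Rpower_pos|]. lra. }
      rewrite !Rmult_assoc. apply Rmult_le_compat_l; [left; apply Rpower_pos|].
      replace ((Rpower (/ j) p + rpow M p) * Rpower j (- b)) with
        (Rpower (/ j) p * Rpower j (- b) + rpow M p * Rpower j (- b)) by ring.
      replace ((Rpower 2 (s - (b + p)) + rpow M p * Rpower 2 (s - b)) * Rpower j (- s)) with
        (Rpower 2 (s - (b + p)) * Rpower j (- s) + rpow M p * (Rpower 2 (s - b) * Rpower j (- s))) by ring.
      apply Rplus_le_compat.
      + replace (Rpower (/ j) p) with (Rpower j (- p)) by (unfold Rpower; rewrite ln_Rinv by lra; f_equal; ring).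
        rewrite <- Rpower_plus. replace (- p + - b) with ((s - (b + p)) + - s) by ring. rewrite Rpower_plus.
        apply Rmult_le_compat_r; [left; apply Rpower_pos|]. apply Rle_Rpower_l; lra.
      + apply Rmult_le_compat_l; [apply rpow_nonneg|].
        replace (- b) with ((s - b) + - s) by ring. rewrite Rpower_plus.
        apply Rmult_le_compat_r; [left; apply Rpower_pos|]. apply Rle_Rpower_l; lra. }
  destruct HA as [l HA].
  eexists. unfold moment, expect. fold b. apply filterlim_Rmult.
  - apply (filterlim_continuous (fun r => speed lam r / r) (fun y => rpow y p)).
    + apply filterlim_Rmult.
      * unfold speed. fold b. apply (filterlim_continuous (F b) (fun y => Rpower y (- (2 * lam)))); [exact H0|now apply continuous_Rpower].
      * apply (filterlim_continuous (fun r => r) Rinv 1).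
        -- intros P [d Hd]. exists d. intros y Hy _. now apply Hd.
        -- apply continuous_Rinv. lra.
    + apply continuous_rpow. lra.
  - apply filterlim_Rmult; [exact HA|exact Hinv].
Qed.

(* [X^2 <= d X^3 + d^(-2)] with [d = 1/(6m)]. *)
Lemma third_moment_lower b r : 0 <= r < 1 ->
  F (b + 3) r / F b r / 2 - 108 * mean b r ^ 3 <= expect b r (fun x => (x - mean b r) ^ 3).
Proof.
  intros Hr. rewrite expect_third by exact Hr.
  assert (B := mean_bounds b r Hr). set (m := mean b r) in *.
  assert (H : F (b + 2) r / F b r <= / (6 * m) * (F (b + 3) r / F b r) + 36 * m ^ 2).
  { replace 2 with (INR 2) at 1 by (simpl; ring). replace 3 with (INR 3) by (simpl; ring).
    rewrite <- !expect_pow by exact Hr. rewrite <- expect_scal by (trivial; apply contpos_pow, contpos_id).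
    rewrite <- (expect_const b r Hr (36 * m ^ 2)).
    rewrite <- expect_plus; [|exact Hr|apply contpos_monomial|apply contpos_const].
    apply expect_le; [exact Hr|apply contpos_pow, contpos_id|apply contpos_plus; [apply contpos_monomial|apply contpos_const]|].
    intros x Hx. destruct (Rle_lt_dec x (6 * m)) as [h|h].
    - assert (0 <= / (6 * m) * x ^ 3) by (apply Rmult_le_pos; [left; apply Rinv_0_lt_compat; lra|apply pow_le; lra]). nra.
    - assert (1 <= / (6 * m) * x).
      { apply (Rmult_le_reg_l (6 * m)); [lra|]. rewrite <- Rmult_assoc, Rinv_r by lra. lra. }
      assert (0 <= x ^ 2) by apply pow2_ge_0. replace (/ (6 * m) * x ^ 3) with (/ (6 * m) * x * x ^ 2) by ring. nra. }
  set (a := F (b + 3) r / F b r) in *. set (v := F (b + 2) r / F b r) in *.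
  assert (3 * m * v <= 3 * m * (/ (6 * m) * a + 36 * m ^ 2)) by (apply Rmult_le_compat_l; lra).
  replace (3 * m * (/ (6 * m) * a + 36 * m ^ 2)) with (a / 2 + 108 * m ^ 3) in H0 by (field; lra).
  assert (0 <= m ^ 3) by (apply pow_le; lra). lra.
Qed.

(** For [b >= -1/2] the mean may diverge too, and rates decide: [E X^3] is at least of order
    [(1 - r)^(-(b + 5/2))], the cube of the mean at most of order [(1 - r)^(-3/2)], and the gap
    [b + 1] is positive. For [b < -1/2] the mean is bounded and the divergence of [E X^3], from
    [b + 3 >= 1/2], is enough. *)
Lemma third_diverges_neg lam : lam <= - 2 / 5 -> tends_inf (third lam).
Proof.
  intros Hl. assert (Hl0 : lam < 0) by lra.
  assert (Hb : / lam < 0) by now apply Rinv_lt_0_compat.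
  assert (Hpb : - (5 / 2) <= / lam).
  { apply Rmult_le_reg_r with (- lam); [lra|]. replace (/ lam * - lam) with (-1) by (field; lra). lra. }
  set (b := / lam) in *.
  assert (H : tends_inf (fun r => expect b r (fun x => (x - mean b r) ^ 3))).
  { destruct (Rle_lt_dec (- (1 / 2)) b) as [h|h].
    - destruct (F_lower_power (b + 3)) as (c & Hc & HF3); [lra|].
      destruct (F_upper_power (b + 1) (1 / 2)) as (C1 & HC1 & HF1); [lra|lra|].
      destruct (F_bounds_neg b Hb) as (c0 & C0 & Hc0 & HC0 & HF0).
      set (K := 108 * (C1 / c0) ^ 3). set (k := c / C0 / 2).
      assert (Kp : 0 < K) by (unfold K; apply Rmult_lt_0_compat; [lra|apply pow_lt; now apply Rdiv_lt_0_compat]).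
      assert (kp : 0 < k) by (unfold k; repeat apply Rdiv_lt_0_compat; lra).
      set (a := b + 1). assert (Ha : 0 < a) by (unfold a; lra).
      intros M. generalize (filter_and _ _ (tends_inf_power a Ha ((K + Rabs M) / k + 1))
        (at_left_1_range (fun r => 0 < r < 1) (fun r H => H))).
      apply filter_imp. intros r [H1 Hr']. assert (Hr : 0 <= r < 1) by lra.
      eapply Rlt_le_trans; [|now apply third_moment_lower].
      set (y := Rpower (1 - r) (- (3 / 2))).
      assert (Y : 1 <= y).
      { unfold y. rewrite <- (Rpower_base_1 (- (3 / 2))) at 1. apply Rpower_anti; lra. }
      assert (E1 : 2 * k * (y * Rpower (1 - r) (- a)) <= F (b + 3) r / F b r).
      { replace (y * Rpower (1 - r) (- a)) with (Rpower (1 - r) (1 / 2 - (b + 3))).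
        2: { unfold y. rewrite <- Rpower_plus. f_equal. unfold a. field. }
        replace (2 * k * Rpower (1 - r) (1 / 2 - (b + 3))) with (c * Rpower (1 - r) (1 / 2 - (b + 3)) * / C0) by (unfold k; field; lra).
        apply Rmult_le_compat.
        - apply Rmult_le_pos; [lra|left; apply Rpower_pos].
        - left; now apply Rinv_0_lt_compat.
        - now apply HF3.
        - apply Rinv_le_contravar; [now apply F_pos|now apply HF0]. }
      assert (E2 : 108 * mean b r ^ 3 <= K * y).
      { assert (mean b r <= C1 / c0 * Rpower (1 - r) (- (1 / 2))).
        { unfold mean. replace (C1 / c0 * Rpower (1 - r) (- (1 / 2))) with (C1 * Rpower (1 - r) (- (1 / 2)) * / c0) by (field; lra).
          apply Rmult_le_compat; [left; now apply F_pos|left; apply Rinv_0_lt_compat; now apply F_pos|now apply HF1|].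
          apply Rinv_le_contravar; [exact Hc0|now apply HF0]. }
        assert (B := mean_bounds b r Hr).
        assert (mean b r ^ 3 <= (C1 / c0 * Rpower (1 - r) (- (1 / 2))) ^ 3) by (apply pow_incr; lra).
        rewrite Rpow_mult_distr in H0.
        replace (Rpower (1 - r) (- (1 / 2)) ^ 3) with y in H0.
        - unfold K. lra.
        - unfold y. rewrite <- Rpower_pow by apply Rpower_pos. rewrite Rpower_mult. f_equal. simpl. field. }
      assert (E3 : k * ((K + Rabs M) / k + 1) < k * Rpower (1 - r) (- a)) by (apply Rmult_lt_compat_l; lra).
      replace (k * ((K + Rabs M) / k + 1)) with (K + Rabs M + k) in E3 by (field; lra).
      assert (Q := Rabs_pos M). assert (Q1 := Rle_abs M).
      set (w := Rpower (1 - r) (- a)) in *.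
      assert (y * (K + Rabs M) <= y * (k * w)) by (apply Rmult_le_compat_l; lra).
      assert (Rabs M <= y * Rabs M) by nra.
      assert (y * (K + Rabs M + k) <= y * (k * w)) by (apply Rmult_le_compat_l; lra). nra.
    - destruct (mean_bounded_neg b h) as (M0 & HM & Hmean).
      assert (Hb3 : 1 / 2 <= b + 3) by lra.
      intros M. generalize (filter_and _ _ (ratio_tends_inf_neg b (b + 3) Hb Hb3 (2 * (M + 108 * M0 ^ 3)))
        (at_left_1_range (fun r => 0 < r < 1) (fun r H => H))).
      apply filter_imp. intros r [H1 Hr']. assert (Hr : 0 <= r < 1) by lra.
      eapply Rlt_le_trans; [|now apply third_moment_lower].
      assert (B := mean_bounds b r Hr).
      assert (mean b r ^ 3 <= M0 ^ 3) by (apply pow_incr; split; [lra|now apply Hmean]). lra. }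
  destruct (speed_bounds_neg lam Hl0) as (c & C & Hc & HC & Hs).
  apply (tends_inf_ge_mult _ _ (c ^ 3)) with (2 := H); [now apply pow_lt|].
  generalize (filter_and _ _ (H 0) (at_left_1_range (fun r => 0 < r < 1) (fun r H => H))).
  apply filter_imp. intros r [H1 Hr]. unfold third. fold b. apply Rmult_le_compat_r; [lra|].
  apply pow_incr. split; [lra|]. apply Rle_trans with (speed lam r); [apply Hs; lra|now apply speed_le_div].
Qed.

(** * The range [lam > 1] *)

Section Large.
Variable lam : R.
Hypothesis Hlam : 1 < lam.
Let b := / lam.

Let Hb : 0 < b < 1.
Proof.
  split; [apply Rinv_0_lt_compat; lra|]. rewrite <- Rinv_1. apply Rinv_lt_contravar; lra.
Qed.

(** By [F_recurrence], [(1 - r^2)^2 Var X] is [rho (c2 - rho)] and [(1 - r^2)^3 E (X - EX)^3] is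
    [rho] times [g3 rho], up to errors of order [1 - r^2]. Both central moments are thus governed by
    the scaled mean. *)
Let rho (r : R) : R := (1 - r ^ 2) * mean b r.
Let c2 : R := (2 * b + 1) / (b + 1).
Let g3 (x : R) : R := (2 * b + 3) * c2 / (b + 2) - 3 * x * c2 + 2 * x ^ 2.

(** One bound for the three behaviours of [F b]: bounded for [b < 1/2], logarithmic at [b = 1/2], of
    order [(1 - r)^(1/2 - b)] beyond. *)
Lemma F_upper_any_power beta : Rmax (b - 1 / 2) 0 < beta ->
  exists C, 0 < C /\ forall r, 0 <= r < 1 -> F b r <= C * Rpower (1 - r) (- beta).
Proof.
  intros H. assert (A1 := Rmax_l (b - 1 / 2) 0). assert (A2 := Rmax_r (b - 1 / 2) 0).
  apply F_upper_power; lra.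
Qed.

(* [Z] controls every quantity of the regime [lam > 1]. *)
Let Z (r : R) : R := speed lam r * mean b r.

Lemma Z_tends_inf : tends_inf Z.
Proof.
  (* [Z] is [F (b + 1) * F b ^ (-(2 lam + 1))], and [t] is the break-even exponent of [F b]:
     [(2 lam + 1) t = b + 1/2]. That the true exponent [b - 1/2] lies below [t] amounts to
     [b < 1]. *)
  set (t := (b + 1 / 2) * b / (2 + b)).
  assert (Ht : Rmax (b - 1 / 2) 0 < t).
  { apply Rmax_lub_lt; unfold t; apply (Rmult_lt_reg_r (2 + b)); try lra;
    unfold Rdiv; rewrite Rmult_assoc, Rinv_l by lra; nra. }
  set (beta := (Rmax (b - 1 / 2) 0 + t) / 2).
  destruct (F_upper_any_power beta) as (C & HC & HF); [unfold beta; lra|].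
  destruct (F_lower_power (b + 1)) as (c & Hc & HF1); [lra|].
  set (a := b + 1 / 2 - (2 * lam + 1) * beta).
  assert (Ha : 0 < a).
  { assert ((2 * lam + 1) * beta < (2 * lam + 1) * t) by (apply Rmult_lt_compat_l; unfold beta; lra).
    assert ((2 * lam + 1) * t = b + 1 / 2).
    { unfold t. unfold b. field. split; lra. }
    unfold a. lra. }
  apply (tends_inf_ge_mult _ _ (c * Rpower C (- (2 * lam + 1))) ) with (2 := tends_inf_power a Ha).
  { apply Rmult_lt_0_compat; [exact Hc|apply Rpower_pos]. }
  apply at_left_1_range. intros r Hr'. assert (Hr : 0 <= r < 1) by lra.
  assert (FP := F_pos b r Hr).
  assert (EZ : Z r = F (b + 1) r * Rpower (F b r) (- (2 * lam + 1))).
  { unfold Z, speed, mean. fold b. replace (- (2 * lam + 1)) with (- (2 * lam) + - (1)) by ring.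
    rewrite Rpower_plus, (Rpower_Ropp _ 1), Rpower_1 by exact FP. unfold Rdiv. ring. }
  rewrite EZ.
  apply Rle_trans with (c * Rpower (1 - r) (1 / 2 - (b + 1)) * Rpower (C * Rpower (1 - r) (- beta)) (- (2 * lam + 1))).
  - rewrite <- Rpower_mult_distr, Rpower_mult by (lra || apply Rpower_pos).
    replace (- a) with ((1 / 2 - (b + 1)) + - beta * - (2 * lam + 1)) by (unfold a; field).
    rewrite Rpower_plus. right. ring.
  - apply Rmult_le_compat.
    + apply Rmult_le_pos; [lra|left; apply Rpower_pos].
    + left; apply Rpower_pos.
    + now apply HF1.
    + apply Rpower_anti; [lra|]. split; [exact FP|now apply HF].
Qed.

Lemma mean_tends_inf_large : tends_inf (mean b).
Proof.
  set (beta := (Rmax (b - 1 / 2) 0 + b) / 2).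
  assert (HR : Rmax (b - 1 / 2) 0 < b) by (apply Rmax_lub_lt; lra).
  destruct (F_upper_any_power beta) as (C & HC & HF); [unfold beta; lra|].
  destruct (F_lower_power (b + 1)) as (c & Hc & HF1); [lra|].
  assert (Ha : 0 < b + 1 / 2 - beta) by (unfold beta; lra).
  apply (tends_inf_ge_mult _ _ (c / C)) with (2 := tends_inf_power _ Ha); [now apply Rdiv_lt_0_compat|].
  apply at_left_1_range. intros r Hr'. assert (Hr : 0 <= r < 1) by lra.
  assert (FP := F_pos b r Hr). assert (Q := Rpower_pos (1 - r) beta).
  replace (- (b + 1 / 2 - beta)) with ((1 / 2 - (b + 1)) + beta) by field. rewrite Rpower_plus.
  replace (c / C * (Rpower (1 - r) (1 / 2 - (b + 1)) * Rpower (1 - r) beta)) with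
    (c * Rpower (1 - r) (1 / 2 - (b + 1)) * / (C * Rpower (1 - r) (- beta))).
  2: { rewrite (Rpower_Ropp (1 - r) beta). field. lra. }
  apply Rmult_le_compat.
  - apply Rmult_le_pos; [lra|left; apply Rpower_pos].
  - left. apply Rinv_0_lt_compat. apply Rmult_lt_0_compat; [exact HC|apply Rpower_pos].
  - now apply HF1.
  - apply Rinv_le_contravar; [exact FP|now apply HF].
Qed.

Let rho0 : R := Rmax 0 (2 - / b).

(** For [b >= 1/2] the recurrence gives [rho = 2 - 1/b + (1 - b)/b * F (b - 1) / F b], whose last
    numerator is bounded while the denominator diverges. For [b < 1/2] the mean is at most of order
    [(1 - r)^(-(b + 1/2))], so [rho] tends to 0. *)
Lemma rho_upper delta : 0 < delta -> at_left 1 (fun r => rho r <= rho0 + delta).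
Proof.
  intros Hd. destruct (Rle_lt_dec (1 / 2) b) as [h|h].
  - assert (A1 : 2 - / b <= rho0) by apply Rmax_r.
    set (K := (1 - b) / b * Rpower 2 (- (b - 1)) / delta).
    generalize (filter_and _ _ (F_tends_inf b h K) (at_left_1_range (fun r => 0 < r < 1) (fun r H => H))).
    apply filter_imp. intros r [H Hr']. assert (Hr : 0 <= r < 1) by lra.
    assert (FP := F_pos b r Hr).
    assert (U := F_upper_nonpos (b - 1) r ltac:(lra) Hr).
    assert (R := F_recurrence b r Hr).
    assert (E : rho r = 2 - / b + (1 - b) / b * (F (b - 1) r / F b r)).
    { unfold rho, mean. apply (Rmult_eq_reg_l (b * F b r)); [|nra].
      replace (b * F b r * ((1 - r ^ 2) * (F (b + 1) r / F b r))) with (b * (1 - r ^ 2) * F (b + 1) r) by (field; lra).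
      rewrite R. field. lra. }
    rewrite E. assert (Q : 0 <= (1 - b) / b) by (apply Rmult_le_pos; [lra|left; apply Rinv_0_lt_compat; lra]).
    assert ((1 - b) / b * (F (b - 1) r / F b r) <= delta); [|lra].
    apply Rle_trans with ((1 - b) / b * (Rpower 2 (- (b - 1)) / F b r)).
    + apply Rmult_le_compat_l; [exact Q|]. apply Rmult_le_compat_r; [left; now apply Rinv_0_lt_compat|exact U].
    + apply (Rmult_le_reg_r (F b r)); [exact FP|].
      replace ((1 - b) / b * (Rpower 2 (- (b - 1)) / F b r) * F b r) with (delta * K) by (unfold K; field; lra).
      apply Rmult_le_compat_l; lra.
  - assert (A1 : 0 <= rho0) by apply Rmax_l.
    destruct (F_upper_power (b + 1) (b + 1 / 2)) as (C & HC & HF); [lra|lra|].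
    destruct (F_lower_const b) as (c & Hc & HF0).
    assert (Ha : 0 < 1 / 2 - b) by lra.
    generalize (filter_and _ _ (tends_inf_power _ Ha (2 * C / c / delta)) (at_left_1_range (fun r => 0 < r < 1) (fun r H => H))).
    apply filter_imp. intros r [H Hr']. assert (Hr : 0 <= r < 1) by lra.
    assert (M : mean b r <= C * Rpower (1 - r) (- (b + 1 / 2)) * / c).
    { apply Rmult_le_compat; [left; now apply F_pos|left; apply Rinv_0_lt_compat; now apply F_pos|now apply HF|].
      apply Rinv_le_contravar; [exact Hc|now apply HF0]. }
    assert (D : 0 < 1 - r ^ 2 <= 2 * (1 - r)) by nra.
    assert (Mp : 0 < mean b r) by (generalize (mean_bounds b r Hr); lra).
    assert (rho r <= 2 * (1 - r) * (C * Rpower (1 - r) (- (b + 1 / 2)) * / c)) by (apply Rmult_le_compat; lra).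
    replace (- (b + 1 / 2)) with ((1 / 2 - b) + - (1)) in H0 by field.
    rewrite Rpower_plus, (Rpower_Ropp _ 1), Rpower_1 in H0 by lra.
    replace (2 * (1 - r) * (C * (Rpower (1 - r) (1 / 2 - b) * / (1 - r)) * / c)) with
      (2 * C / c * Rpower (1 - r) (1 / 2 - b)) in H0 by (field; lra).
    rewrite Rpower_Ropp in H. assert (Q := Rpower_pos (1 - r) (1 / 2 - b)). set (w := Rpower (1 - r) (1 / 2 - b)) in *.
    assert (delta * w * (2 * C / c / delta) < delta * w * / w) by (apply Rmult_lt_compat_l; nra).
    replace (delta * w * (2 * C / c / delta)) with (2 * C / c * w) in H1 by (field; lra).
    replace (delta * w * / w) with delta in H1 by (field; lra). lra.
Qed.

(* For [b > 1/2], [rho0] is the mean and [rho0 * g3 rho0] the third central moment of the limit law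
   2 Beta(b - 1/2, 1/2) of [(1 - r^2) X], which is skewed to the right because [b < 1]. *)
Lemma coefficients_positive : exists kappa, 0 < kappa /\
  at_left 1 (fun r => kappa <= c2 - rho r /\ kappa <= g3 (rho r)).
Proof.
  assert (C2 : 0 < c2) by (unfold c2; apply Rdiv_lt_0_compat; lra).
  assert (A : 0 <= rho0 /\ 4 * rho0 < 3 * c2 /\ 0 < g3 rho0).
  { unfold rho0. destruct (Rle_lt_dec b (1 / 2)) as [h|h].
    - assert (/ (1 / 2) <= / b) by (apply Rinv_le_contravar; lra).
      replace (/ (1 / 2)) with 2 in H by field. rewrite Rmax_left by lra.
      split; [lra|]. split; [lra|]. unfold g3.
      assert (0 < (2 * b + 3) * c2 / (b + 2)) by (apply Rdiv_lt_0_compat; [apply Rmult_lt_0_compat; lra|lra]). lra.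
    - assert (/ b < / (1 / 2)) by (apply Rinv_lt_contravar; lra).
      replace (/ (1 / 2)) with 2 in H by field. rewrite Rmax_right by lra.
      split; [lra|]. split.
      + apply (Rmult_lt_reg_r (b * (b + 1))); [nra|].
        replace (4 * (2 - / b) * (b * (b + 1))) with (4 * (2 * b - 1) * (b + 1)) by (field; lra).
        replace (3 * c2 * (b * (b + 1))) with (3 * (2 * b + 1) * b) by (unfold c2; field; lra). nra.
      + replace (g3 (2 - / b)) with (4 * (1 - b) / (b * b * (b + 1) * (b + 2))) by (unfold g3, c2; field; lra).
        apply Rdiv_lt_0_compat; [lra|]. repeat apply Rmult_lt_0_compat; lra. }
  destruct A as (A1 & A2 & A3).
  (* [g3] is a parabola with its minimum at [3 c2 / 4]. The first bound keeps [rho0 + d] on the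
     decreasing branch, so an upper bound on [rho] is a lower bound on [g3 (rho r)]; the second
     makes the loss from [rho0] to [rho0 + d] at most half of [g3 rho0]. *)
  set (d := Rmin ((3 * c2 - 4 * rho0) / 4) (g3 rho0 / (6 * c2))).
  assert (Hd : 0 < d) by (unfold d; apply Rmin_pos; apply Rdiv_lt_0_compat; lra).
  assert (Hd1 : 4 * (rho0 + d) <= 3 * c2) by (unfold d; generalize (Rmin_l ((3 * c2 - 4 * rho0) / 4) (g3 rho0 / (6 * c2))); lra).
  assert (Hd2 : 3 * c2 * d <= g3 rho0 / 2).
  { apply Rle_trans with (3 * c2 * (g3 rho0 / (6 * c2))).
    - apply Rmult_le_compat_l; [lra|apply Rmin_r].
    - right. field. lra. }
  exists (Rmin (c2 / 4) (g3 rho0 / 2)). split; [apply Rmin_pos; lra|].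
  generalize (filter_and _ _ (rho_upper d Hd) (at_left_1_range (fun r => 0 < r < 1) (fun r H => H))).
  apply filter_imp. intros r [H Hr]. split.
  - eapply Rle_trans; [apply Rmin_l|]. lra.
  - eapply Rle_trans; [apply Rmin_r|].
    assert (E1 : g3 (rho0 + d) = g3 rho0 - 3 * c2 * d + 4 * rho0 * d + 2 * d ^ 2) by (unfold g3; ring).
    assert (E2 : g3 (rho r) - g3 (rho0 + d) = (rho0 + d - rho r) * (3 * c2 - 2 * (rho r + (rho0 + d)))) by (unfold g3; ring).
    assert (0 <= (rho0 + d - rho r) * (3 * c2 - 2 * (rho r + (rho0 + d)))) by (apply Rmult_le_pos; lra).
    assert (0 <= rho0 * d) by (apply Rmult_le_pos; lra). assert (0 <= d ^ 2) by apply pow2_ge_0. lra.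
Qed.

(** The recurrence at [b + 1] and at [b + 2] expresses the scaled moments exactly through [rho] and
    [D = 1 - r^2]. The terms carrying [D] are negligible against [rho = D * EX] because the mean
    diverges. *)
Lemma central_moments_lower : exists kappa, 0 < kappa /\ at_left 1 (fun r => 0 < r < 1 /\ rho r <= 2 /\
  kappa * rho r <= (1 - r ^ 2) ^ 2 * (F (b + 2) r / F b r - mean b r ^ 2) /\
  kappa * rho r <= (1 - r ^ 2) ^ 3 * expect b r (fun x => (x - mean b r) ^ 3)).
Proof.
  destruct coefficients_positive as (k & Hk & Hev).
  exists (k / 2). split; [lra|].
  (* A mean above [20/k] gives [20 D <= k rho], whereas the negative error terms are at most [4 D]:
     they cost less than half of [k rho]. *)
  generalize (filter_and _ _ Hev (filter_and _ _ (mean_tends_inf_large (20 / k))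
    (at_left_1_range (fun r => 0 < r < 1) (fun r H => H)))).
  apply filter_imp. intros r [[H1 H2] [H3 Hr']]. assert (Hr : 0 <= r < 1) by lra.
  rewrite expect_third by exact Hr.
  assert (FP := F_pos b r Hr).
  assert (R1 := F_recurrence (b + 1) r Hr). replace (b + 1 + 1) with (b + 2) in R1 by ring. replace (b + 1 - 1) with b in R1 by ring.
  assert (R2 := F_recurrence (b + 2) r Hr). replace (b + 2 + 1) with (b + 3) in R2 by ring. replace (b + 2 - 1) with (b + 1) in R2 by ring.
  set (D := 1 - r ^ 2) in *. assert (DP : 0 < D) by (unfold D; nra).
  assert (Hrho : rho r = D * mean b r) by reflexivity. set (p := rho r) in *.
  assert (MP : 0 < mean b r) by (generalize (mean_bounds b r Hr); lra).
  assert (Hp0 : 0 < p) by (rewrite Hrho; now apply Rmult_lt_0_compat).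
  assert (C2 : c2 <= 2).
  { unfold c2. apply (Rmult_le_reg_r (b + 1)); [lra|]. unfold Rdiv. rewrite Rmult_assoc, Rinv_l by lra. lra. }
  assert (Hp2 : p <= 2) by lra.
  assert (HD : 20 * D <= k * p).
  { assert (k * (20 / k) <= k * mean b r) by (apply Rmult_le_compat_l; lra).
    replace (k * (20 / k)) with 20 in H by (field; lra). rewrite Hrho. nra. }
  assert (E2 : D ^ 2 * (F (b + 2) r / F b r) = c2 * p - b / (b + 1) * D).
  { apply (Rmult_eq_reg_l ((b + 1) * F b r)); [|nra].
    replace ((b + 1) * F b r * (D ^ 2 * (F (b + 2) r / F b r))) with (D * ((b + 1) * D * F (b + 2) r)) by (field; lra).
    rewrite R1, Hrho. unfold c2, mean. field. lra. }
  assert (E3 : D ^ 3 * (F (b + 3) r / F b r) = (2 * b + 3) / (b + 2) * (D ^ 2 * (F (b + 2) r / F b r)) - (b + 1) / (b + 2) * (D * p)).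
  { apply (Rmult_eq_reg_l ((b + 2) * F b r)); [|nra].
    replace ((b + 2) * F b r * (D ^ 3 * (F (b + 3) r / F b r))) with (D ^ 2 * ((b + 2) * D * F (b + 3) r)) by (field; lra).
    rewrite R2, Hrho. unfold mean. field. lra. }
  assert (B1 : 0 < b / (b + 1) < 1).
  { split; [apply Rdiv_lt_0_compat; lra|]. apply (Rmult_lt_reg_r (b + 1)); [lra|]. unfold Rdiv. rewrite Rmult_assoc, Rinv_l by lra. lra. }
  assert (B2 : 0 < (2 * b + 3) / (b + 2) < 2).
  { split; [apply Rdiv_lt_0_compat; lra|]. apply (Rmult_lt_reg_r (b + 2)); [lra|]. unfold Rdiv. rewrite Rmult_assoc, Rinv_l by lra. lra. }
  assert (B3 : 0 < (b + 1) / (b + 2) < 1).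
  { split; [apply Rdiv_lt_0_compat; lra|]. apply (Rmult_lt_reg_r (b + 2)); [lra|]. unfold Rdiv. rewrite Rmult_assoc, Rinv_l by lra. lra. }
  split; [exact Hr'|]. split; [exact Hp2|]. split.
  - rewrite Rmult_minus_distr_l, E2. replace (D ^ 2 * mean b r ^ 2) with (p ^ 2) by (rewrite Hrho; ring).
    assert (k * p <= (c2 - p) * p) by (apply Rmult_le_compat_r; lra).
    assert (b / (b + 1) * D <= 1 * D) by (apply Rmult_le_compat_r; lra). lra.
  - replace (D ^ 3 * (F (b + 3) r / F b r - 3 * mean b r * (F (b + 2) r / F b r) + 2 * mean b r ^ 3)) with
      (D ^ 3 * (F (b + 3) r / F b r) - 3 * (D * mean b r) * (D ^ 2 * (F (b + 2) r / F b r)) + 2 * (D * mean b r) ^ 3) by ring.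
    rewrite <- Hrho, E3, E2.
    assert (k * p <= g3 p * p) by (apply Rmult_le_compat_r; lra).
    replace ((2 * b + 3) / (b + 2) * (c2 * p - b / (b + 1) * D) - (b + 1) / (b + 2) * (D * p) - 3 * p * (c2 * p - b / (b + 1) * D) + 2 * p ^ 3) with
     (g3 p * p - D * ((2 * b + 3) / (b + 2) * (b / (b + 1)) + (b + 1) / (b + 2) * p) + 3 * p * (b / (b + 1)) * D) by (unfold g3; field; lra).
    assert ((2 * b + 3) / (b + 2) * (b / (b + 1)) <= 2 * 1) by (apply Rmult_le_compat; lra).
    assert ((b + 1) / (b + 2) * p <= 1 * 2) by (apply Rmult_le_compat; lra).
    assert (D * ((2 * b + 3) / (b + 2) * (b / (b + 1)) + (b + 1) / (b + 2) * p) <= D * 4) by (apply Rmult_le_compat_l; lra).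
    assert (0 <= 3 * p * (b / (b + 1)) * D) by (apply Rmult_le_pos; [apply Rmult_le_pos|]; lra). lra.
Qed.

(** The variance is at least [k EX / (1 - r^2)], so [expect_abs_ge_variance] gives a mean absolute
    deviation of at least [(k/2) EX]. Jensen's inequality then bounds the moment below by the [p]-th
    power of [(k/4) Z]. *)
Lemma moment_diverges_large p : 1 <= p -> tends_inf (moment lam p).
Proof.
  intros Hp. destruct central_moments_lower as (k & Hk & Hev).
  apply (tends_inf_le (fun r => rpow (k / 4 * Z r) p)).
  { apply (tends_inf_rpow (fun r => k / 4 * Z r)); [lra|].
    apply (tends_inf_ge_mult Z _ (k / 4)); [lra|apply Z_tends_inf|]. apply at_left_1_range. intros; lra. }
  revert Hev. apply filter_imp. intros r (Hr' & H2 & H3 & _). assert (Hr : 0 <= r < 1) by lra.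
  unfold moment. fold b.
  assert (SP := speed_pos lam r).
  assert (SL := speed_le_div lam r Hr').
  assert (J := expect_jensen b r Hr (fun x => x - mean b r) p (contpos_central b r) Hp).
  set (y := expect b r (fun x => Rabs (x - mean b r))) in *.
  assert (V := expect_abs_ge_variance b r Hr). fold y in V.
  set (v := F (b + 2) r / F b r - mean b r ^ 2) in *.
  assert (MP : 0 < mean b r) by (generalize (mean_bounds b r Hr); lra).
  assert (Hy : k / 2 * mean b r <= y).
  { eapply Rle_trans; [|exact V]. unfold rho in H3.
    assert (DP : 0 < 1 - r ^ 2 <= 2 * (1 - r)) by nra. set (D := 1 - r ^ 2) in *.
    assert (k * mean b r <= D * v).
    { apply (Rmult_le_reg_l D); [lra|]. replace (D * (D * v)) with (D ^ 2 * v) by ring. lra. }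
    assert (0 <= v) by (apply (Rmult_le_reg_l D); [lra|]; rewrite Rmult_0_r; assert (0 <= k * mean b r) by (apply Rmult_le_pos; lra); lra).
    assert (D * v <= 2 * (1 - r) * v) by (apply Rmult_le_compat_r; lra). lra. }
  apply Rle_trans with (rpow (speed lam r / r) p * rpow (y / 2) p).
  - rewrite <- rpow_mult; [|lra|].
    + apply rpow_le; [lra|]. unfold Z.
      assert (k / 4 * mean b r <= y / 2) by lra.
      replace (k / 4 * (speed lam r * mean b r)) with (speed lam r * (k / 4 * mean b r)) by ring.
      apply Rmult_le_compat; try lra. apply Rmult_le_pos; lra.
    + assert (0 <= k / 2 * mean b r) by (apply Rmult_le_pos; lra). lra.
  - apply Rmult_le_compat_l; [apply rpow_nonneg|exact J].
Qed.

(** The third central moment is at least [k EX / (1 - r^2)^2], and [rho <= 2] means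
    [1/(1 - r^2) >= EX / 2]; hence it is at least [(k/4) (EX)^3]. Multiplied by the cube of the
    speed this is [(k/4) Z^3], which exceeds [(k/4) Z] once [Z >= 1]. *)
Lemma third_diverges_large : tends_inf (third lam).
Proof.
  destruct central_moments_lower as (k & Hk & Hev).
  assert (H : tends_inf (fun r => k / 4 * Z r)).
  { apply (tends_inf_ge_mult Z _ (k / 4)); [lra|apply Z_tends_inf|]. apply at_left_1_range. intros; lra. }
  apply (tends_inf_le (fun r => k / 4 * Z r)); [exact H|].
  generalize (filter_and _ _ (Z_tends_inf 1) Hev). apply filter_imp. intros r (HZ & Hr' & H2 & _ & H3). assert (Hr : 0 <= r < 1) by lra.
  unfold third. fold b. set (t := expect b r (fun x => (x - mean b r) ^ 3)) in *.
  assert (SP := speed_pos lam r). assert (SL := speed_le_div lam r Hr').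
  assert (MP : 0 < mean b r) by (generalize (mean_bounds b r Hr); lra).
  unfold rho in *. set (D := 1 - r ^ 2) in *. assert (DP : 0 < D) by (unfold D; nra).
  assert (k * mean b r <= D ^ 2 * t).
  { apply (Rmult_le_reg_l D); [lra|]. replace (D * (D ^ 2 * t)) with (D ^ 3 * t) by ring. lra. }
  assert (D2 : 0 < D ^ 2) by (apply pow_lt; lra).
  assert (T0 : 0 < t).
  { apply (Rmult_lt_reg_l (D ^ 2)); [exact D2|]. rewrite Rmult_0_r. assert (0 < k * mean b r) by now apply Rmult_lt_0_compat. lra. }
  assert (DM : (D * mean b r) ^ 2 <= 4) by (assert (0 < D * mean b r) by (now apply Rmult_lt_0_compat); nra).
  assert (HT : k / 4 * mean b r ^ 3 <= t).
  { apply (Rmult_le_reg_l (D ^ 2)); [exact D2|].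
    replace (D ^ 2 * (k / 4 * mean b r ^ 3)) with ((D * mean b r) ^ 2 * (k / 4 * mean b r)) by ring.
    assert ((D * mean b r) ^ 2 * (k / 4 * mean b r) <= 4 * (k / 4 * mean b r)) by (apply Rmult_le_compat_r; [apply Rmult_le_pos; lra|exact DM]). lra. }
  apply Rle_trans with (speed lam r ^ 3 * t).
  - apply Rle_trans with (k / 4 * Z r ^ 3).
    + apply Rmult_le_compat_l; [lra|]. assert (1 <= Z r ^ 2) by nra. replace (Z r ^ 3) with (Z r * Z r ^ 2) by ring. nra.
    + unfold Z. replace (k / 4 * (speed lam r * mean b r) ^ 3) with (speed lam r ^ 3 * (k / 4 * mean b r ^ 3)) by ring.
      apply Rmult_le_compat_l; [|exact HT]. apply pow_le; lra.
  - apply Rmult_le_compat_r; [lra|]. apply pow_incr. lra.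
Qed.

End Large.

(** * Kernel averages as expectations *)

Lemma dom_radius lam e : 0 <= e -> dom lam e -> 0 <= Rabs lam * e < 1.
Proof.
  intros He [H1 H2]. split; [apply Rmult_le_pos; [apply Rabs_pos|exact He]|].
  unfold Rabs. destruct (Rcase_abs lam); lra.
Qed.

Lemma dom_of_radius lam e : 0 <= e -> Rabs lam * e < 1 -> dom lam e.
Proof.
  intros He H. assert (P : 0 <= Rabs lam * e) by (apply Rmult_le_pos; [apply Rabs_pos|exact He]).
  unfold dom. unfold Rabs in *. destruct (Rcase_abs lam); lra.
Qed.

(** For [lam < 0] the half-period shift replaces [lam e] by [|lam| e]. *)
Lemma kernel_avg lam e psi : 0 <= e -> dom lam e -> contpos psi ->
  RInt (fun x => psi (jac lam x e)) 0 1 = avg (Rabs lam * e) psi.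
Proof.
  intros He Hd Hpsi. assert (Hr := dom_radius lam e He Hd).
  unfold jac. destruct (Rle_lt_dec 0 lam) as [h|h].
  - rewrite Rabs_pos_eq by exact h. reflexivity.
  - unfold avg. rewrite <- (RInt_cs_opp (fun z => psi (1 - Rabs lam * e * z))).
    + rewrite Rabs_left by exact h. apply RInt_extR. intros x. f_equal. ring.
    + intros x. now apply avg_cont.
Qed.

Lemma kerg_cont lam e x : dom lam e -> continuous (fun x => kerg lam x e) x.
Proof.
  intros H. apply (continuous_mult (fun x => wgt lam x e) (fun _ => / mom lam 0 e)); [|apply continuous_const].
  apply (cont2d_fst (wgt lam)). now apply wgt_cont.
Qed.

Lemma kerV_cont lam e x : dom lam e -> continuous (fun x => kerV lam x e) x.
Proof.
  intros H. apply (continuous_mult (fun _ => spd lam e) (fun x => hq lam x e - kap lam e)); [apply continuous_const|].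
  apply (continuous_minus (fun x => hq lam x e) (fun _ => kap lam e)); [|apply continuous_const].
  apply (cont2d_fst (hq lam)). now apply hq_cont.
Qed.

Lemma kerVg_cont lam e phi x : dom lam e -> (forall y, continuous phi y) ->
  continuous (fun x => phi (kerV lam x e) * kerg lam x e) x.
Proof.
  intros H Hphi. apply (continuous_mult (fun x => phi (kerV lam x e)) (fun x => kerg lam x e)).
  - apply (continuous_comp (fun x => kerV lam x e) phi); [now apply kerV_cont|apply Hphi].
  - now apply kerg_cont.
Qed.

Lemma kerg_pos lam x e : dom lam e -> 0 < kerg lam x e.
Proof. intros H. apply Rdiv_lt_0_compat; [apply wgt_pos|now apply mom0_pos]. Qed.

(** [kerg] is a probability density on the period. *)
Lemma kernel_integral_bound lam e phi B : dom lam e -> (forall y, continuous phi y) ->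
  (forall x, Rabs (phi (kerV lam x e)) <= B) ->
  Rabs (RInt (fun x => phi (kerV lam x e) * kerg lam x e) 0 1) <= B.
Proof.
  intros H Hphi HB.
  assert (X : ex_RInt (fun x => phi (kerV lam x e) * kerg lam x e) 0 1).
  { apply ex_RInt_cont. intros; now apply kerVg_cont. }
  assert (Xg : ex_RInt (fun x => B * kerg lam x e) 0 1).
  { apply ex_RInt_cont. intros x. apply (continuous_mult (fun _ => B) (fun x => kerg lam x e)); [apply continuous_const|now apply kerg_cont]. }
  eapply Rle_trans; [apply abs_RInt_le; [lra|exact X]|].
  replace B with (RInt (fun x => B * kerg lam x e) 0 1).
  - apply RInt_le; [lra| |exact Xg|].
    + apply ex_RInt_cont. intros x. apply (continuous_comp (fun x => phi (kerV lam x e) * kerg lam x e) Rabs);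
      [now apply kerVg_cont|apply continuous_Rabs].
    + intros x _. assert (P := kerg_pos lam x e H). rewrite Rabs_mult, (Rabs_pos_eq (kerg lam x e)) by lra.
      apply Rmult_le_compat_r; [lra|apply HB].
  - rewrite (RInt_scal (V := R_CompleteNormedModule) (fun x => kerg lam x e)).
    + rewrite (kernel_mass lam e H). apply Rmult_1_r.
    + apply ex_RInt_cont. intros; now apply kerg_cont.
Qed.

Section Bridge.
Variables lam e : R.
Hypothesis Hlam : lam <> 0.
Hypothesis He : 0 <= e.
Hypothesis Hd : dom lam e.
Let r := Rabs lam * e.
Let Hr : 0 <= r < 1 := dom_radius lam e He Hd.

Lemma wgt_jac x : wgt lam x e = Rpower (jac lam x e) (- / lam).
Proof. unfold wgt. destruct (Req_EM_T lam 0); [contradiction|reflexivity]. Qed.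

Lemma mom0_F : mom lam 0 e = F (/ lam) r.
Proof.
  unfold mom, F, r. rewrite <- (kernel_avg lam e (fun j => Rpower j (- / lam)) He Hd (contpos_Rpower _)).
  apply RInt_extR. intros x. rewrite wgt_jac. simpl. ring.
Qed.

Lemma spd_speed : spd lam e = speed lam r.
Proof. unfold spd, speed. now rewrite mom0_F. Qed.

Lemma kernel_weighted psi : contpos psi ->
  RInt (fun x => psi (/ jac lam x e) * kerg lam x e) 0 1 = expect (/ lam) r psi.
Proof.
  intros Hpsi. unfold expect, r.
  rewrite <- (kernel_avg lam e (fun j => psi (/ j) * Rpower j (- / lam)) He Hd).
  - assert (FP := F_pos (/ lam) r Hr). fold r.
    rewrite (RInt_extR _ (fun x => / F (/ lam) r * (psi (/ jac lam x e) * Rpower (jac lam x e) (- / lam)))).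
    + rewrite (RInt_scal (V := R_CompleteNormedModule) (fun x => psi (/ jac lam x e) * Rpower (jac lam x e) (- / lam))).
      * apply Rmult_comm.
      * apply ex_RInt_cont. intros x. assert (J := jac_pos lam x e Hd).
        assert (CJ : continuous (fun x => jac lam x e) x) by (apply (cont2d_fst (jac lam)), jac_cont).
        apply (continuous_mult (fun x => psi (/ jac lam x e)) (fun x => Rpower (jac lam x e) (- / lam))).
        -- apply (continuous_comp (fun x => / jac lam x e) psi).
           ++ apply continuous_Rinv_comp; [exact CJ|lra].
           ++ apply Hpsi. now apply Rinv_0_lt_compat.
        -- apply (continuous_comp (fun x => jac lam x e) (fun y => Rpower y (- / lam))); [exact CJ|now apply continuous_Rpower].
    + intros x. unfold kerg. rewrite wgt_jac, mom0_F. field. lra.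
  - apply contpos_mult; [|apply contpos_Rpower].
    intros j Hj. apply (continuous_comp Rinv psi); [now apply contpos_inv|].
    apply Hpsi. now apply Rinv_0_lt_compat.
Qed.

Lemma kap_integral : kap lam e = RInt (fun x => hq lam x e * kerg lam x e) 0 1.
Proof.
  assert (P := mom0_pos lam e Hd).
  rewrite (RInt_extR _ (fun x => / mom lam 0 e * (wgt lam x e * hq lam x e ^ 1))).
  - rewrite (RInt_scal (V := R_CompleteNormedModule) (fun x => wgt lam x e * hq lam x e ^ 1)).
    + apply Rmult_comm.
    + apply ex_RInt_cont. intros; now apply mom_integrand_cx.
  - intros x. unfold kerg. field. lra.
Qed.

Lemma jac_inv_kerg_cont x : continuous (fun x => / jac lam x e * kerg lam x e) x.
Proof.
  apply (continuous_mult (fun x => / jac lam x e) (fun x => kerg lam x e)); [|now apply kerg_cont].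
  apply continuous_Rinv_comp; [apply (cont2d_fst (jac lam)), jac_cont|].
  generalize (jac_pos lam x e Hd); lra.
Qed.

(** Comes from [|cos / J| <= 1/J]. In contrast with the exact formula [kerV_mean], this bound and
    [kerV_abs_le] do not divide by [e] and remain valid at [e = 0]. *)
Lemma kap_abs_le_mean : Rabs (kap lam e) <= mean (/ lam) r.
Proof.
  rewrite kap_integral. rewrite <- (expect_id (/ lam) r Hr).
  rewrite <- (kernel_weighted (fun x => x) contpos_id).
  assert (C : forall x, continuous (fun x => hq lam x e * kerg lam x e) x).
  { intros x. apply (continuous_mult (fun x => hq lam x e) (fun x => kerg lam x e)); [|now apply kerg_cont].
    apply (cont2d_fst (hq lam)). now apply hq_cont. }
  eapply Rle_trans; [apply abs_RInt_le; [lra|now apply ex_RInt_cont]|].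
  apply RInt_le; [lra| |apply ex_RInt_cont; apply jac_inv_kerg_cont|].
  - apply ex_RInt_cont. intros x. apply (continuous_comp (fun x => hq lam x e * kerg lam x e) Rabs); [apply C|apply continuous_Rabs].
  - intros x _. assert (P := kerg_pos lam x e Hd). assert (J := jac_pos lam x e Hd).
    rewrite Rabs_mult, (Rabs_pos_eq (kerg lam x e)) by lra. apply Rmult_le_compat_r; [lra|].
    unfold hq. unfold Rdiv. rewrite Rabs_mult. assert (Q := Rinv_0_lt_compat _ J). rewrite (Rabs_pos_eq (/ jac lam x e)) by lra.
    assert (Rabs (cs x) <= 1) by (apply Rabs_le; apply cs_bound).
    rewrite <- (Rmult_1_l (/ jac lam x e)) at 2. apply Rmult_le_compat_r; lra.
Qed.

Lemma kerV_abs_le x : Rabs (kerV lam x e) <= speed lam r * (/ jac lam x e + mean (/ lam) r).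
Proof.
  unfold kerV. rewrite spd_speed. assert (SP := speed_pos lam r).
  rewrite Rabs_mult, (Rabs_pos_eq (speed lam r)) by lra. apply Rmult_le_compat_l; [lra|].
  eapply Rle_trans; [apply Rabs_triang|]. rewrite Rabs_Ropp. apply Rplus_le_compat; [|apply kap_abs_le_mean].
  assert (J := jac_pos lam x e Hd). assert (Q := Rinv_0_lt_compat _ J).
  unfold hq. unfold Rdiv. rewrite Rabs_mult, (Rabs_pos_eq (/ jac lam x e)) by lra.
  assert (Rabs (cs x) <= 1) by (apply Rabs_le; apply cs_bound).
  rewrite <- (Rmult_1_l (/ jac lam x e)) at 2. apply Rmult_le_compat_r; lra.
Qed.

Lemma jac_ge x : 1 - r <= jac lam x e.
Proof.
  unfold jac. assert (B := cs_bound x).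
  assert (Rabs (lam * e * cs x) <= r).
  { rewrite !Rabs_mult. unfold r. rewrite (Rabs_pos_eq e) by exact He.
    assert (Rabs (cs x) <= 1) by (apply Rabs_le; apply cs_bound).
    rewrite <- (Rmult_1_r (Rabs lam * e)) at 2. apply Rmult_le_compat_l; [apply Hr|exact H]. }
  assert (Q := Rle_abs (lam * e * cs x)). lra.
Qed.

Hypothesis He0 : 0 < e.

(** [cos / J = (1/J - 1) / (lam e)], and the constant cancels when the mean is subtracted. *)
Lemma kerV_mean x : kerV lam x e = speed lam r / (lam * e) * (/ jac lam x e - mean (/ lam) r).
Proof.
  assert (LE : lam * e <> 0) by (apply Rmult_integral_contrapositive; lra).
  assert (HJ : forall y, hq lam y e = / (lam * e) * (/ jac lam y e) - / (lam * e)).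
  { intros y. assert (J := jac_pos lam y e Hd). unfold hq.
    apply (Rmult_eq_reg_l (lam * e * jac lam y e)).
    - replace (lam * e * jac lam y e * (cs y / jac lam y e)) with (lam * e * cs y) by (field; lra).
      replace (lam * e * jac lam y e * (/ (lam * e) * / jac lam y e - / (lam * e))) with (1 - jac lam y e) by (field; lra).
      unfold jac. ring.
    - apply Rmult_integral_contrapositive; lra. }
  assert (K : kap lam e = / (lam * e) * mean (/ lam) r - / (lam * e)).
  { rewrite kap_integral.
    rewrite (RInt_extR _ (fun y => / (lam * e) * (/ jac lam y e * kerg lam y e) - / (lam * e) * kerg lam y e))
      by (intros; rewrite HJ; ring).
    assert (G : forall c (f : R -> R), (forall x, continuous f x) -> ex_RInt (fun x => c * f x) 0 1).
    { intros c f Hf. apply ex_RInt_cont. intros y. apply (continuous_mult (fun _ => c) f); [apply continuous_const|apply Hf]. }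
    rewrite (RInt_minus (V := R_CompleteNormedModule) (fun y => / (lam * e) * (/ jac lam y e * kerg lam y e)) (fun y => / (lam * e) * kerg lam y e)).
    2: { apply (G _ (fun y => / jac lam y e * kerg lam y e)). apply jac_inv_kerg_cont. }
    2: { apply G. intros; now apply kerg_cont. }
    rewrite (RInt_scal (V := R_CompleteNormedModule) (fun y => / jac lam y e * kerg lam y e)) by (apply ex_RInt_cont; apply jac_inv_kerg_cont).
    rewrite (RInt_scal (V := R_CompleteNormedModule) (fun y => kerg lam y e)) by (apply ex_RInt_cont; intros; now apply kerg_cont).
    rewrite (kernel_mass lam e Hd), (kernel_weighted (fun x => x) contpos_id), (expect_id (/ lam) r Hr).
    unfold minus, plus, opp, scal; simpl; unfold mult; simpl. to_R_eq. ring. }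
  unfold kerV. rewrite spd_speed, HJ, K. unfold Rdiv. ring.
Qed.

Lemma kernel_expect phi : (forall y, continuous phi y) ->
  RInt (fun x => phi (kerV lam x e) * kerg lam x e) 0 1 =
  expect (/ lam) r (fun x => phi (speed lam r / (lam * e) * (x - mean (/ lam) r))).
Proof.
  intros Hphi. rewrite <- kernel_weighted.
  - apply RInt_extR. intros x. now rewrite kerV_mean.
  - apply (contpos_comp phi); [exact Hphi|]. apply contpos_mult; [apply contpos_const|apply contpos_central].
Qed.

Lemma kernel_moment p : 0 < p ->
  RInt (fun x => rpow (Rabs (kerV lam x e)) p * kerg lam x e) 0 1 = moment lam p r.
Proof.
  intros Hp. rewrite (kernel_expect (fun y => rpow (Rabs y) p)) by (intros; now apply continuous_rpow_abs).
  assert (SP := speed_pos lam r).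
  assert (E : Rabs (speed lam r / (lam * e)) = speed lam r / r).
  { unfold Rdiv. rewrite Rabs_mult, Rabs_inv, Rabs_mult, (Rabs_pos_eq e), (Rabs_pos_eq (speed lam r)) by lra. reflexivity. }
  assert (RP : 0 < r) by (apply Rmult_lt_0_compat; [now apply Rabs_pos_lt|exact He0]).
  unfold moment. rewrite <- expect_scal.
  - apply expect_ext; [exact Hr|]. intros x _. rewrite Rabs_mult, E. apply rpow_mult; [|apply Rabs_pos].
    left. now apply Rdiv_lt_0_compat.
  - exact Hr.
  - apply contpos_rpow; [exact Hp|apply contpos_central].
Qed.

(** An odd moment keeps the sign of [lam]: the third central moment of [X] may be large and positive
    while the integral of [u_x^3] is large and negative. *)
Lemma kernel_third : RInt (fun x => kerV lam x e ^ 3 * kerg lam x e) 0 1 = lam / Rabs lam * third lam r.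
Proof.
  rewrite (kernel_expect (fun y => y ^ 3)) by (intros; apply continuous_pow_id).
  rewrite (expect_ext _ _ Hr _ (fun x => (speed lam r / (lam * e)) ^ 3 * (x - mean (/ lam) r) ^ 3)) by (intros; ring).
  rewrite expect_scal; [|exact Hr|apply contpos_pow, contpos_central].
  unfold third. rewrite <- Rmult_assoc. f_equal. unfold r.
  unfold Rabs. destruct (Rcase_abs lam); field; lra.
Qed.

End Bridge.

(** * The solutions in each range of [lam] *)

(** Its derivative attains the maximum 1 and the minimum -1, both quadratically, and a half-period
    shift exchanges them up to sign; one datum therefore serves both signs of [lam]. *)
Definition u_init (x : R) : R := sin (2 * PI * x) / (2 * PI).

Definition near_top (lam : R) (P : R -> Prop) : Prop :=
  exists e0, 0 <= e0 /\ dom lam e0 /\ forall e, e0 < e -> dom lam e -> P e.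

Definition kerN (lam p e : R) : R := RInt (fun x => rpow (Rabs (kerV lam x e)) p * kerg lam x e) 0 1.
Definition ker2 (lam e : R) : R := RInt (fun x => kerV lam x e ^ 2 * kerg lam x e) 0 1.
Definition ker3 (lam e : R) : R := RInt (fun x => kerV lam x e ^ 3 * kerg lam x e) 0 1.

Lemma near_top_of_at_left lam P : lam <> 0 -> at_left 1 P -> near_top lam (fun e => P (Rabs lam * e)).
Proof.
  intros Hl H. destruct (at_left_1_elim P H) as (r0 & Hr0 & HP).
  assert (L : 0 < Rabs lam) by now apply Rabs_pos_lt.
  assert (E0 : 0 <= r0 / Rabs lam) by (apply Rmult_le_pos; [lra|left; now apply Rinv_0_lt_compat]).
  exists (r0 / Rabs lam). split; [exact E0|]. split.
  - apply dom_of_radius; [exact E0|]. replace (Rabs lam * (r0 / Rabs lam)) with r0 by (field; lra). lra.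
  - intros e He De. apply HP. split.
    + apply (Rmult_lt_compat_l (Rabs lam)) in He; [|exact L].
      replace (Rabs lam * (r0 / Rabs lam)) with r0 in He by (field; lra). exact He.
    + apply dom_radius; [lra|exact De].
Qed.

Lemma near_top_imp lam (P Q : R -> Prop) :
  (forall e, 0 < e -> dom lam e -> P e -> Q e) -> near_top lam P -> near_top lam Q.
Proof.
  intros H (e0 & H0 & D0 & HP). exists e0. split; [exact H0|]. split; [exact D0|].
  intros e He De. apply H; [lra|exact De|]. now apply HP.
Qed.

(** The body of the theorem for one [lam], named so that the ranges of [lam] can be proved
    separately. *)
Definition profile (lam : R) (u0 : R -> R) : Prop :=
  exists (T : option R) (u ux uxx uxt : R -> R -> R),
    is_solution lam u0 T u ux uxx uxt /\
    (0 <= lam <= 1 -> T = None) /\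
    (~ (0 <= lam <= 1) -> exists s, T = Some s /\ 0 < s /\ Linf_blowup ux s) /\
    (forall p, 1 <= p -> 2 / (1 - 2 * p) < lam <= 1 ->
       lim_finite T (fun t => Lpnorm ux p t)) /\
    (forall p, 1 < p -> (lam <= -2 \/ 1 < lam) ->
       lim_pinf T (fun t => Lpnorm ux p t)) /\
    (forall p, 1 < p -> -2 < lam <= -2 / p ->
       lim_pinf T (fun t => Lpnorm ux p t)) /\
    ((lam <= -2/3 \/ 1 < lam) -> lim_pinf T (energy ux)) /\
    (-2/3 < lam <= 1 -> bounded_on T (energy ux)) /\
    (exists dE : R -> R,
       (forall t, 0 < t -> before T t -> derivable_pt_lim (energy ux) t (dE t)) /\
       ((lam < -1/2 \/ 1 < lam) -> lim_pinf T dE) /\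
       (lam = -1/2 -> forall t, 0 < t -> before T t -> dE t = 0) /\
       (-1/2 < lam <= -2/5 -> lim_minf T dE) /\
       (-2/5 < lam <= 1 ->
          exists M, forall t, 0 < t -> before T t -> Rabs (dE t) <= M)).

Lemma u_init_derive x : is_derive u_init x (cs x).
Proof.
  unfold u_init, cs. assert (P := PI_RGT_0). auto_derive; [auto|]. field. lra.
Qed.

Lemma near_end_imp T (P Q : R -> Prop) :
  (forall t, 0 < t -> before T t -> P t -> Q t) -> near_end T P -> near_end T Q.
Proof.
  intros H (t0 & H0 & B0 & HP). exists t0. split; [exact H0|]. split; [exact B0|].
  intros t Ht Bt. apply H; [lra|exact Bt|]. now apply HP.
Qed.

(** Everything Eulerian is discharged here: what remains are asymptotics of the kernel in [e].
    Divergence is required up to the threshold [-2/(2p - 1)], which yields the energy range at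
    [p = 2], the [L^p] ranges of the theorem, and the blow-up of [u_x] in the supremum norm. *)
Lemma profile_of_kernel lam :
  (0 <= lam <= 1 -> forall M, exists e, 0 <= e /\ dom lam e /\ M < clock lam e) ->
  (~ (0 <= lam <= 1) -> exists M, forall e, 0 <= e -> dom lam e -> clock lam e <= M) ->
  (forall p, 1 <= p -> 2 / (1 - 2 * p) < lam <= 1 ->
     exists l, forall eps, 0 < eps -> near_top lam (fun e => Rabs (kerN lam p e - l) < eps)) ->
  (forall p, 1 <= p -> (lam <= - 2 / (2 * p - 1) \/ 1 < lam) -> forall M, near_top lam (fun e => M < kerN lam p e)) ->
  (-2/3 < lam <= 1 -> exists M, forall e, 0 <= e -> dom lam e -> Rabs (ker2 lam e) <= M) ->
  ((lam < -1/2 \/ 1 < lam) -> forall M, near_top lam (fun e => M < (1 + 2 * lam) * ker3 lam e)) ->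
  (-1/2 < lam <= -2/5 -> forall M, near_top lam (fun e => (1 + 2 * lam) * ker3 lam e < M)) ->
  (-2/5 < lam <= 1 -> exists M, forall e, 0 <= e -> dom lam e -> Rabs ((1 + 2 * lam) * ker3 lam e) <= M) ->
  profile lam u_init.
Proof.
  intros Hinf Hfin Hlim Hdiv H2 H3p H3m H3b.
  destruct (clock_inverse_exists lam) as (T & D & eta & CI).
  set (V := fun x t => kerV lam x (eta t)). set (Vx := fun x t => kerVx lam x (eta t)).
  set (g := fun x t => kerg lam x (eta t)).
  assert (L : lagrangian lam D V Vx g) by exact (kernel_lagrangian lam T D eta CI).
  set (ux := euler_ux V g).
  assert (HD : forall t, 0 <= t -> before T t -> D t) by exact (ci_strip _ _ _ _ CI).
  assert (B0 : before T 0).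
  { destruct T as [s|] eqn:ET; simpl; [|exact I]. now apply (ci_T_pos _ _ _ _ CI). }
  assert (D0 : D 0) by (apply HD; [lra|exact B0]).
  assert (Hdom : forall t, 0 <= t -> before T t -> 0 <= eta t /\ dom lam (eta t)).
  { intros t H0 Ht. split; [now apply (ci_nonneg _ _ _ _ CI)|]. apply (ci_dom _ _ _ _ CI). now apply HD. }
  assert (NT : forall P, near_top lam P -> near_end T (fun t => P (eta t))).
  { intros P (e0 & H0 & De & HP). now apply (near_end_of_clock lam T D eta CI P e0). }
  assert (Lp : forall p, 0 < p -> forall t, 0 <= t -> before T t -> Lpnorm ux p t = rpow (kerN lam p (eta t)) (/ p)).
  { intros p Hp t H0 Ht. unfold Lpnorm. f_equal.
    apply (euler_ux_change_var lam D V Vx g L (fun y => rpow (Rabs y) p)); [now apply HD|].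
    intros; now apply continuous_rpow_abs. }
  assert (En : forall t, 0 <= t -> before T t -> energy ux t = ker2 lam (eta t)).
  { intros t H0 Ht. apply (energy_euler lam D V Vx g L). now apply HD. }
  assert (LpD : forall p, 1 <= p -> (lam <= - 2 / (2 * p - 1) \/ 1 < lam) -> lim_pinf T (fun t => Lpnorm ux p t)).
  { intros p Hp Hc M.
    assert (Q : 0 < Rabs M + 1) by (generalize (Rabs_pos M); lra).
    apply (near_end_imp T (fun t => rpow (Rabs M + 1) p < kerN lam p (eta t))).
    - intros t H0 Ht H. rewrite Lp; [|lra|lra|exact Ht].
      apply Rlt_le_trans with (Rabs M + 1); [generalize (Rle_abs M); lra|].
      rewrite <- (rpow_rpow_inv (Rabs M + 1) p) by lra. apply rpow_le; [|lra].
      left. apply Rinv_0_lt_compat. lra.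
    - apply (NT (fun e => rpow (Rabs M + 1) p < kerN lam p e)). now apply Hdiv. }
  (* Since [2p - 1 >= p], the range [lam <= -2/p] lies inside [lam <= -2/(2p - 1)]. *)
  assert (Conv : forall p, 1 < p -> lam <= - 2 / p -> lam <= - 2 / (2 * p - 1)).
  { intros p Hp Hl. eapply Rle_trans; [exact Hl|]. unfold Rdiv.
    assert (/ (2 * p - 1) <= / p) by (apply Rinv_le_contravar; lra). lra. }
  exists T, (euler_u V g), ux, (euler_uxx Vx g), (euler_uxt lam V Vx g).
  split.
  { apply (euler_is_solution lam D V Vx g L); trivial.
    - exact (ci_T_pos _ _ _ _ CI).
    - intros x. now apply (kernel_initial lam T D eta CI).
    - unfold u_init. rewrite Rmult_0_r, sin_0. field. generalize PI_RGT_0; lra.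
    - intros x. unfold V. destruct (kernel_initial lam T D eta CI x D0) as [_ ->]. apply u_init_derive. }
  split. { intros Hl. apply (ci_infinite _ _ _ _ CI). now apply Hinf. }
  split.
  { intros Hl. destruct (Hfin Hl) as [M HM]. destruct (ci_finite _ _ _ _ CI M HM) as [s Hs].
    exists s. split; [exact Hs|]. split; [now apply (ci_T_pos _ _ _ _ CI)|].
    (* Blow-up in the supremum norm follows from that of a single [p]-norm, since a bound on [|u_x|]
       bounds all averages against the density. For [lam < 0] the choice [p = 1 - 1/lam] gives
       [lam (2p - 1) = lam - 2 <= -2]. *)
    assert (HP : exists p, 1 <= p /\ (lam <= - 2 / (2 * p - 1) \/ 1 < lam)).
    { destruct (Rle_lt_dec lam 1) as [h|h]; [|exists 1; split; [lra|now right]].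
      assert (Hn : lam < 0) by (apply Rnot_le_lt; intros N; apply Hl; lra).
      exists (1 + / - lam). assert (Q : 0 < / - lam) by (apply Rinv_0_lt_compat; lra). split; [lra|]. left.
      apply (Rmult_le_reg_r (2 * (1 + / - lam) - 1)); [lra|].
      replace (- 2 / (2 * (1 + / - lam) - 1) * (2 * (1 + / - lam) - 1)) with (-2) by (field; split; lra).
      replace (lam * (2 * (1 + / - lam) - 1)) with (lam - 2) by (field; lra). lra. }
    destruct HP as (p & Hp & Hc).
    intros K t0 Ht0. set (K' := Rabs K + 1).
    assert (NE := NT _ (Hdiv p Hp Hc (rpow K' p))). cbv beta in NE.
    destruct NE as (t1 & T0 & T1 & HN). rewrite Hs in T1. simpl in T1.
    set (t := (Rmax t0 t1 + s) / 2).
    assert (Mx : Rmax t0 t1 < s) by (now apply Rmax_lub_lt).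
    assert (M1 := Rmax_l t0 t1). assert (M2 := Rmax_r t0 t1).
    assert (Ht : Rmax t0 t1 < t < s) by (unfold t; lra).
    assert (Bt : before T t) by (rewrite Hs; simpl; lra).
    exists t. split; [lra|]. split; [lra|]. split; [lra|].
    apply NNPP. intros N.
    assert (HB : forall x, Rabs (ux x t) <= K').
    { intros x. apply Rnot_lt_le. intros h. apply N. exists x.
      unfold K' in h. generalize (Rle_abs K); lra. }
    assert (Dt : D t) by (apply HD; [lra|exact Bt]).
    assert (HV : forall x, Rabs (kerV lam x (eta t)) <= K').
    { intros x. assert (H := HB (flow g x t)). unfold ux, euler_ux in H.
      rewrite (flow_inv_flow lam D V Vx g L) in H by exact Dt. exact H. }
    assert (B := kernel_integral_bound lam (eta t) (fun y => rpow (Rabs y) p) (rpow K' p)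
      (proj2 (Hdom t ltac:(lra) Bt)) (fun y => continuous_rpow_abs p y ltac:(lra))).
    assert (A := HN t ltac:(lra) Bt). unfold kerN in A.
    assert (B' : Rabs (RInt (fun x => rpow (Rabs (kerV lam x (eta t))) p * kerg lam x (eta t)) 0 1) <= rpow K' p).
    { apply B. intros x. rewrite Rabs_pos_eq by apply rpow_nonneg. apply rpow_le; [lra|apply HV]. }
    assert (C := Rle_abs (RInt (fun x => rpow (Rabs (kerV lam x (eta t))) p * kerg lam x (eta t)) 0 1)). lra. }
  split.
  { intros p Hp Hl. destruct (Hlim p Hp Hl) as [l Hl'].
    exists (rpow l (/ p)). intros eps Heps.
    assert (Ip : 0 < / p) by (apply Rinv_0_lt_compat; lra).
    destruct (proj1 (filterlim_locally _ _) (continuous_rpow (/ p) l Ip) (mkposreal _ Heps)) as [d Hd].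
    apply (near_end_imp T (fun t => Rabs (kerN lam p (eta t) - l) < d)).
    - intros t H0 Ht H. rewrite Lp; [|lra|lra|exact Ht]. now apply Hd.
    - apply (NT (fun e => Rabs (kerN lam p e - l) < d)). apply Hl'. apply cond_pos. }
  split.
  { intros p Hp [Hl|Hl]; apply LpD; try lra. left. apply Conv; [exact Hp|]. eapply Rle_trans; [exact Hl|].
    unfold Rdiv. assert (/ p < / 1) by (apply Rinv_lt_contravar; lra). rewrite Rinv_1 in H. lra. }
  split.
  { intros p Hp Hl. apply LpD; [lra|]. left. apply Conv; lra. }
  split.
  { intros Hl M. apply (near_end_imp T (fun t => M < kerN lam 2 (eta t))).
    - intros t H0 Ht H. rewrite En; [|lra|exact Ht]. unfold ker2, kerN in *.
      rewrite (RInt_extR _ (fun x => rpow (Rabs (kerV lam x (eta t))) 2 * kerg lam x (eta t))); [exact H|].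
      intros x. now rewrite rpow_2.
    - apply (NT (fun e => M < kerN lam 2 e)). apply Hdiv; [lra|].
      destruct Hl as [Hl|Hl]; [left|now right]. replace (2 * 2 - 1) with 3 by ring. exact Hl. }
  split.
  { intros Hl. destruct (H2 Hl) as [M HM]. exists M. intros t H0 Ht. rewrite En by trivial.
    destruct (Hdom t H0 Ht). now apply HM. }
  exists (fun t => (1 + 2 * lam) * ker3 lam (eta t)).
  split.
  { intros t H0 Ht. apply is_derive_Reals. apply (energy_euler_derive lam D V Vx g L).
    apply HD; [lra|exact Ht]. }
  split. { intros Hl M. now apply (NT (fun e => M < (1 + 2 * lam) * ker3 lam e)), H3p. }
  split. { intros -> t _ _. replace (1 + 2 * (-1 / 2)) with 0 by field. ring. }
  split. { intros Hl M. now apply (NT (fun e => (1 + 2 * lam) * ker3 lam e < M)), H3m. }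
  intros Hl. destruct (H3b Hl) as [M HM]. exists M. intros t H0 Ht.
  destruct (Hdom t ltac:(lra) Ht). now apply HM.
Qed.

Lemma moment_near_top lam p (P : R -> Prop) : lam <> 0 -> 0 < p ->
  at_left 1 (fun r => P (moment lam p r)) -> near_top lam (fun e => P (kerN lam p e)).
Proof.
  intros Hl Hp H. apply (near_top_imp lam (fun e => P (moment lam p (Rabs lam * e)))).
  - intros e He De HP. unfold kerN. rewrite (kernel_moment lam e Hl ltac:(lra) De He p Hp). exact HP.
  - now apply (near_top_of_at_left lam (fun r => P (moment lam p r))).
Qed.

Lemma third_near_top lam (P : R -> Prop) : lam <> 0 ->
  at_left 1 (fun r => P (lam / Rabs lam * third lam r)) -> near_top lam (fun e => P (ker3 lam e)).
Proof.
  intros Hl H. apply (near_top_imp lam (fun e => P (lam / Rabs lam * third lam (Rabs lam * e)))).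
  - intros e He De HP. unfold ker3. rewrite (kernel_third lam e Hl ltac:(lra) De He). exact HP.
  - now apply (near_top_of_at_left lam (fun r => P (lam / Rabs lam * third lam r))).
Qed.

(** * Lifespan: bounds on the clock *)

Lemma derive_sign_le (f df : R -> R) a b : a <= b ->
  (forall s, a <= s <= b -> is_derive f s (df s) /\ 0 <= df s) -> f a <= f b.
Proof.
  intros Hab H.
  destruct (MVT_gen f a b df) as [c [Hc E]].
  - intros x. rewrite Rmin_left, Rmax_right by exact Hab. intros Hx. apply H. lra.
  - intros x. rewrite Rmin_left, Rmax_right by exact Hab. intros Hx. apply continuity_pt_filterlim.
    apply (ex_derive_continuous f). eexists. now apply H.
  - rewrite Rmin_left, Rmax_right in Hc by exact Hab.
    assert (0 <= df c * (b - a)) by (apply Rmult_le_pos; [now apply H|lra]). lra.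
Qed.

Lemma dom_below lam e s : dom lam e -> 0 <= s <= e -> dom lam s.
Proof.
  intros H Hs. apply (dom_between lam 0 e); [apply dom_0|exact H|]. rewrite Rmin_left, Rmax_right; lra.
Qed.

Lemma clock_le lam e (h dh : R -> R) : 0 <= e -> dom lam e ->
  (forall s, 0 <= s <= e -> is_derive h s (dh s) /\ Rpower (mom lam 0 s) (2 * lam) <= dh s) ->
  clock lam e <= h e - h 0.
Proof.
  intros He De H.
  assert (A := derive_sign_le (fun s => h s - clock lam s) (fun s => dh s - Rpower (mom lam 0 s) (2 * lam)) 0 e He).
  cbv beta in A. rewrite clock_0 in A.
  assert (h 0 - 0 <= h e - clock lam e); [|lra]. apply A. intros s Hs. destruct (H s Hs) as [H1 H2].
  split; [|lra]. apply (is_derive_minus h (clock lam)); [exact H1|]. apply clock_derive. now apply (dom_below lam e).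
Qed.

Lemma clock_ge lam e (h dh : R -> R) : 0 <= e -> dom lam e ->
  (forall s, 0 <= s <= e -> is_derive h s (dh s) /\ dh s <= Rpower (mom lam 0 s) (2 * lam)) ->
  h e - h 0 <= clock lam e.
Proof.
  intros He De H.
  assert (A := derive_sign_le (fun s => clock lam s - h s) (fun s => Rpower (mom lam 0 s) (2 * lam) - dh s) 0 e He).
  cbv beta in A. rewrite clock_0 in A.
  assert (0 - h 0 <= clock lam e - h e); [|lra]. apply A. intros s Hs. destruct (H s Hs) as [H1 H2].
  split; [|lra]. apply (is_derive_minus (clock lam) h); [|exact H1]. apply clock_derive. now apply (dom_below lam e).
Qed.

(** The range of [e] is bounded by [1/|lam|], and [S_0] is bounded below, so its negative power
    [S_0^(2 lam)] is bounded. *)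
Lemma clock_bounded_neg lam : lam < 0 -> exists M, forall e, 0 <= e -> dom lam e -> clock lam e <= M.
Proof.
  intros Hl. assert (Hb : / lam < 0) by now apply Rinv_lt_0_compat.
  destruct (F_lower_const (/ lam)) as (c & Hc & HF).
  set (K := Rpower c (2 * lam)). assert (KP : 0 < K) by apply Rpower_pos.
  exists (K * / - lam). intros e He De.
  assert (H := clock_le lam e (fun s => K * s) (fun _ => K) He De).
  assert (A : clock lam e <= K * e - K * 0).
  { apply H. intros s Hs. split; [auto_derive; auto; ring|].
    assert (Ds := dom_below lam e s De Hs).
    rewrite (mom0_F lam s) by (lra || exact Ds). unfold K. replace (2 * lam) with (- (- (2 * lam))) by ring.
    apply Rpower_anti; [lra|]. split; [exact Hc|]. apply HF. apply dom_radius; [lra|exact Ds]. }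
  destruct (dom_radius lam e He De) as [_ R1]. rewrite Rabs_left in R1 by exact Hl.
  assert (e <= / - lam).
  { apply (Rmult_le_reg_l (- lam)); [lra|]. rewrite Rinv_r by lra. lra. }
  assert (K * e <= K * / - lam) by (apply Rmult_le_compat_l; lra). lra.
Qed.

(** The integrand is at most of order [(1 - r)^(-2 lam beta)], integrable when [beta < b/2]. An
    exponent between [max (b - 1/2) 0] and [b/2] exists because [b < 1], that is [lam > 1]. *)
Lemma clock_bounded_large lam : 1 < lam -> exists M, forall e, 0 <= e -> dom lam e -> clock lam e <= M.
Proof.
  intros Hl. set (b := / lam).
  assert (Hb : 0 < b < 1).
  { split; [apply Rinv_0_lt_compat; lra|]. unfold b. rewrite <- Rinv_1. apply Rinv_lt_contravar; lra. }
  assert (HR : Rmax (b - 1 / 2) 0 < b / 2) by (apply Rmax_lub_lt; lra).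
  assert (R0 := Rmax_r (b - 1 / 2) 0).
  set (beta := (Rmax (b - 1 / 2) 0 + b / 2) / 2).
  destruct (F_upper_any_power lam beta) as (C & HC & HF); [fold b; unfold beta; lra|].
  set (a := 2 * lam * beta).
  assert (Ha : a < 1).
  { assert (2 * lam * beta < 2 * lam * (b / 2)) by (apply Rmult_lt_compat_l; unfold beta; lra).
    replace (2 * lam * (b / 2)) with 1 in H by (unfold b; field; lra). exact H. }
  set (K := Rpower C (2 * lam)). assert (KP : 0 < K) by apply Rpower_pos.
  exists (K / (lam * (1 - a))). intros e He De.
  assert (A := clock_le lam e (fun s => - (K / (lam * (1 - a))) * Rpower (1 - lam * s) (1 - a))
     (fun s => K * Rpower (1 - lam * s) (- a)) He De). cbv beta in A.
  assert (Q : 0 < K / (lam * (1 - a))) by (apply Rdiv_lt_0_compat; [exact KP|apply Rmult_lt_0_compat; lra]).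
  replace (1 - lam * 0) with 1 in A by ring. rewrite Rpower_base_1 in A.
  assert (P := Rpower_pos (1 - lam * e) (1 - a)).
  assert (clock lam e <= - (K / (lam * (1 - a))) * Rpower (1 - lam * e) (1 - a) - - (K / (lam * (1 - a))) * 1).
  { apply A. intros s Hs. assert (Ds := dom_below lam e s De Hs).
    assert (Hr := dom_radius lam s (proj1 Hs) Ds). assert (Er : Rabs lam * s = lam * s) by (rewrite Rabs_pos_eq; lra).
    split.
    - eapply is_derive_val.
      + apply (is_derive_scal (fun s => Rpower (1 - lam * s) (1 - a))).
        apply (is_derive_Rpower_comp (fun s => 1 - lam * s) s (- lam)); [lra|]. auto_derive; auto. ring.
      + cbv beta. replace (- a) with ((1 - a) + - (1)) by ring. rewrite (Rpower_plus (1 - a) (- (1))), (Rpower_Ropp _ 1), Rpower_1 by lra.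
        field. repeat split; lra.
    - rewrite (mom0_F lam s) by (lra || exact Ds). rewrite Er in *.
      apply Rle_trans with (Rpower (C * Rpower (1 - lam * s) (- beta)) (2 * lam)).
      + apply Rle_Rpower_l; [lra|]. split; [now apply F_pos|now apply HF].
      + rewrite <- Rpower_mult_distr by (exact HC || apply Rpower_pos). rewrite Rpower_mult.
        fold K. right. f_equal. f_equal. unfold a. ring. }
  assert (0 < K / (lam * (1 - a)) * Rpower (1 - lam * e) (1 - a)) by now apply Rmult_lt_0_compat. lra.
Qed.

(** * The range [0 < lam < 1] *)

(** The speed is at most of order [(1 - r)^(2 - lam)], while [1/J] and its mean are at most
    [1/(1 - r)]. The product tends to 0 for [lam < 1], so [u_x] decays uniformly. *)
Lemma kerV_uniform_small lam : 0 < lam < 1 -> exists C, 0 < C /\ forall e x, 0 <= e -> dom lam e ->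
  Rabs (kerV lam x e) <= C * Rpower (1 - Rabs lam * e) (1 - lam).
Proof.
  intros Hl. assert (Hb : 1 < / lam) by (rewrite <- Rinv_1; apply Rinv_lt_contravar; lra).
  destruct (F_lower_power (/ lam)) as (c & Hc & HF); [lra|].
  exists (2 * Rpower c (- (2 * lam))). split; [generalize (Rpower_pos c (- (2 * lam))); lra|].
  intros e x He De. assert (Hr := dom_radius lam e He De). set (r := Rabs lam * e) in *.
  eapply Rle_trans; [apply (kerV_abs_le lam e ltac:(lra) He De)|]. fold r.
  assert (S : speed lam r <= Rpower c (- (2 * lam)) * Rpower (1 - r) (2 - lam)).
  { unfold speed. replace (2 - lam) with ((1 / 2 - / lam) * - (2 * lam)) by (field; lra).
    rewrite <- Rpower_mult, Rpower_mult_distr by (lra || apply Rpower_pos).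
    apply Rpower_anti; [lra|]. split; [|now apply HF]. apply Rmult_lt_0_compat; [lra|apply Rpower_pos]. }
  assert (J : / jac lam x e <= / (1 - r)) by (apply Rinv_le_contravar; [lra|now apply jac_ge]).
  assert (M := mean_bounds (/ lam) r Hr).
  assert (JP := Rinv_0_lt_compat _ (jac_pos lam x e De)).
  apply Rle_trans with (Rpower c (- (2 * lam)) * Rpower (1 - r) (2 - lam) * (2 * / (1 - r))).
  - apply Rmult_le_compat; [left; apply speed_pos|lra|exact S|lra].
  - replace (1 - lam) with ((2 - lam) + - (1)) by ring. rewrite Rpower_plus, (Rpower_Ropp _ 1), Rpower_1 by lra. right. ring.
Qed.

Lemma kerN_abs_le lam e p B : 0 < p -> dom lam e -> (forall x, Rabs (kerV lam x e) <= B) ->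
  Rabs (kerN lam p e) <= rpow B p.
Proof.
  intros Hp De HB. apply (kernel_integral_bound lam e (fun y => rpow (Rabs y) p)); [exact De| |].
  - intros; now apply continuous_rpow_abs.
  - intros x. rewrite Rabs_pos_eq by apply rpow_nonneg. apply rpow_le; [lra|apply HB].
Qed.

Lemma kernel_pow_bound lam e n B : dom lam e -> (forall x, Rabs (kerV lam x e) <= B) ->
  Rabs (RInt (fun x => kerV lam x e ^ n * kerg lam x e) 0 1) <= B ^ n.
Proof.
  intros De HB. apply (kernel_integral_bound lam e (fun y => y ^ n)); [exact De| |].
  - intros; apply continuous_pow_id.
  - intros x. rewrite <- RPow_abs. apply pow_incr. split; [apply Rabs_pos|apply HB].
Qed.

Lemma kernel_bounded lam C : (forall e x, 0 <= e -> dom lam e -> Rabs (kerV lam x e) <= C) ->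
  (exists M, forall e, 0 <= e -> dom lam e -> Rabs (ker2 lam e) <= M) /\
  (exists M, forall e, 0 <= e -> dom lam e -> Rabs ((1 + 2 * lam) * ker3 lam e) <= M).
Proof.
  intros H. split.
  - exists (C ^ 2). intros e He De. apply kernel_pow_bound; auto.
  - exists (Rabs (1 + 2 * lam) * C ^ 3). intros e He De. rewrite Rabs_mult.
    apply Rmult_le_compat_l; [apply Rabs_pos|]. apply kernel_pow_bound; auto.
Qed.

Lemma range_contradiction p lam : 1 <= p -> 0 <= lam <= 1 -> ~ (lam <= - 2 / (2 * p - 1) \/ 1 < lam).
Proof.
  intros Hp Hl [H|H]; [|lra].
  assert (0 < 2 / (2 * p - 1)) by (apply Rdiv_lt_0_compat; lra).
  replace (- 2 / (2 * p - 1)) with (- (2 / (2 * p - 1))) in H by (field; lra). lra.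
Qed.

Lemma profile_between lam : 0 < lam < 1 -> profile lam u_init.
Proof.
  intros Hl. destruct (kerV_uniform_small lam Hl) as (C & HC & HV).
  assert (Bd := kernel_bounded lam C). destruct Bd as [B2 B3].
  { intros e x He De. eapply Rle_trans; [now apply HV|]. rewrite <- (Rmult_1_r C) at 2.
    apply Rmult_le_compat_l; [lra|]. assert (Hr := dom_radius lam e He De).
    apply Rle_trans with (Rpower 1 (1 - lam)); [apply Rle_Rpower_l; lra|rewrite Rpower_base_1; lra]. }
  apply profile_of_kernel; try (intros; lra).
  - intros _ M. assert (Hb : 1 < / lam) by (rewrite <- Rinv_1; apply Rinv_lt_contravar; lra).
    destruct (F_lower_power (/ lam)) as (c & Hc & HF); [lra|].
    set (K := Rpower c (2 * lam)). assert (KP : 0 < K) by apply Rpower_pos.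
    (* As [2 - lam > 1], the clock rate is at least [K / (1 - lam e)], and the clock at least
       [-(K/lam) ln (1 - lam e)]. With [1 - lam e = z] this bound equals [|M| + K/lam]. *)
    set (z := exp (- (Rabs M * lam / K + 1))).
    assert (Z : 0 < z < 1).
    { split; [apply exp_pos|]. rewrite <- exp_0. apply exp_increasing.
      assert (0 <= Rabs M * lam / K) by (apply Rmult_le_pos; [apply Rmult_le_pos; [apply Rabs_pos|lra]|left; now apply Rinv_0_lt_compat]). lra. }
    set (e := (1 - z) / lam).
    assert (He : 0 <= e) by (unfold e; left; apply Rdiv_lt_0_compat; lra).
    assert (Ee : lam * e = 1 - z) by (unfold e; field; lra).
    assert (De : dom lam e) by (unfold dom; lra).
    exists e. split; [exact He|]. split; [exact De|].
    assert (A := clock_ge lam e (fun s => - (K / lam) * ln (1 - lam * s)) (fun s => K * / (1 - lam * s)) He De). cbv beta in A.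
    rewrite Rmult_0_r, Rminus_0_r, ln_1, Rmult_0_r, Rminus_0_r, Ee in A.
    replace (1 - (1 - z)) with z in A by ring. unfold z in A. rewrite ln_exp in A.
    replace (- (K / lam) * - (Rabs M * lam / K + 1)) with (Rabs M + K / lam) in A by (field; lra).
    assert (Rabs M + K / lam <= clock lam e).
    { apply A. intros s Hs. assert (Ds := dom_below lam e s De Hs).
      assert (Hr := dom_radius lam s (proj1 Hs) Ds). assert (Er : Rabs lam * s = lam * s) by (rewrite Rabs_pos_eq; lra).
      split.
      - auto_derive; [lra|]. field. lra.
      - rewrite (mom0_F lam s) by (lra || exact Ds). rewrite Er in *.
        apply Rle_trans with (Rpower (c * Rpower (1 - lam * s) (1 / 2 - / lam)) (2 * lam)).
        + rewrite <- Rpower_mult_distr by (exact Hc || apply Rpower_pos). rewrite Rpower_mult. fold K.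
          apply Rmult_le_compat_l; [lra|].
          replace ((1 / 2 - / lam) * (2 * lam)) with (- (2 - lam)) by (field; lra).
          rewrite <- (Rpower_1 (1 - lam * s)) at 1 by lra. rewrite <- Rpower_Ropp.
          replace (- (2 - lam)) with (- (1) + - (1 - lam)) by ring. rewrite Rpower_plus.
          rewrite <- (Rmult_1_r (Rpower (1 - lam * s) (- (1)))) at 1. apply Rmult_le_compat_l; [left; apply Rpower_pos|].
          apply Rle_trans with (Rpower 1 (- (1 - lam))); [rewrite Rpower_base_1; lra|]. apply Rpower_anti; lra.
        + apply Rle_Rpower_l; [lra|]. split; [|now apply HF]. apply Rmult_lt_0_compat; [exact Hc|apply Rpower_pos]. }
    assert (0 < K / lam) by (apply Rdiv_lt_0_compat; lra). generalize (Rle_abs M); lra.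
  - intros p Hp _. exists 0. intros eps Heps.
    set (d := Rpower eps (/ p) / C).
    assert (Hd : 0 < d) by (apply Rdiv_lt_0_compat; [apply Rpower_pos|exact HC]).
    assert (H : at_left 1 (fun r => 0 < r < 1 /\ C * Rpower (1 - r) (1 - lam) < Rpower eps (/ p))).
    { apply (at_left_1_intro _ (1 - Rmin 1 (Rpower d (/ (1 - lam))))).
      - assert (0 < Rmin 1 (Rpower d (/ (1 - lam)))) by (apply Rmin_pos; [lra|apply Rpower_pos]). lra.
      - intros r Hr. assert (R1 := Rmin_l 1 (Rpower d (/ (1 - lam)))). assert (R2 := Rmin_r 1 (Rpower d (/ (1 - lam)))).
        split; [lra|]. replace (Rpower eps (/ p)) with (C * d) by (unfold d; field; lra).
        apply Rmult_lt_compat_l; [exact HC|].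
        replace d with (Rpower (Rpower d (/ (1 - lam))) (1 - lam)) by (rewrite Rpower_mult, Rinv_l, Rpower_1; lra).
        apply Rlt_Rpower_l; lra. }
    apply (near_top_imp lam (fun e => 0 < Rabs lam * e < 1 /\ C * Rpower (1 - Rabs lam * e) (1 - lam) < Rpower eps (/ p))).
    2: { apply (near_top_of_at_left lam (fun r => 0 < r < 1 /\ C * Rpower (1 - r) (1 - lam) < Rpower eps (/ p))); [lra|exact H]. }
    intros e He De [_ H1]. rewrite Rminus_0_r.
    eapply Rle_lt_trans; [apply (kerN_abs_le lam e p (C * Rpower (1 - Rabs lam * e) (1 - lam))); [lra|exact De|]|].
    + intros x. apply HV; [lra|exact De].
    + assert (P : 0 < C * Rpower (1 - Rabs lam * e) (1 - lam)) by (apply Rmult_lt_0_compat; [exact HC|apply Rpower_pos]).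
      rewrite rpow_pos_eq by exact P.
      replace eps with (Rpower (Rpower eps (/ p)) p) by (rewrite Rpower_mult, Rinv_l, Rpower_1; lra).
      apply Rlt_Rpower_l; lra.
  - intros p Hp Hc. exfalso. revert Hc. apply range_contradiction; lra.
  - intros _. exact B2.
  - intros _. exact B3.
Qed.

(** * Assembling the ranges [lam < 0] and [lam > 1] *)

(** Boundedness is claimed on the whole existence interval, [e = 0] included, so it rests on
    [kerV_abs_le] and not on the exact moments. The condition [b + n < 1/2] bounds [E X^n], and with
    [n >= 1] also the mean. *)
Lemma kernel_pow_bounded_neg lam n : lam < 0 -> / lam + INR n < 1 / 2 -> (1 <= n)%nat ->
  exists M, forall e, 0 <= e -> dom lam e ->
    Rabs (RInt (fun x => kerV lam x e ^ n * kerg lam x e) 0 1) <= M.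
Proof.
  intros Hl Hn Hn1. set (b := / lam) in *.
  assert (Hb : b < 0) by now apply Rinv_lt_0_compat.
  assert (N1 : 1 <= INR n) by (change 1 with (INR 1); now apply le_INR).
  destruct (speed_bounds_neg lam Hl) as (c1 & C1 & _ & HC1 & HS).
  destruct (mean_bounded_neg b) as (M & HM & Hm); [lra|].
  destruct (F_bounds_neg b Hb) as (c & C & Hc & HC & HF).
  destruct (F_upper_bounded (b + INR n)) as (C2 & HC2 & HFn); [lra|].
  exists ((C1 * 2) ^ n * (C2 / c + M ^ n)). intros e He De.
  assert (Hr := dom_radius lam e He De). set (r := Rabs lam * e) in *.
  assert (HV : forall x, Rabs (kerV lam x e ^ n) <= (C1 * 2) ^ n * ((/ jac lam x e) ^ n + M ^ n)).
  { intros x. rewrite <- RPow_abs.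
    assert (A := kerV_abs_le lam e ltac:(lra) He De x). fold r b in A.
    assert (JP := Rinv_0_lt_compat _ (jac_pos lam x e De)).
    assert (A2 : Rabs (kerV lam x e) <= C1 * (/ jac lam x e + M)).
    { eapply Rle_trans; [exact A|]. assert (B := mean_bounds b r Hr). assert (SP := speed_pos lam r).
      apply Rmult_le_compat; [lra|lra|now apply HS|]. assert (B2 := Hm r Hr). lra. }
    eapply Rle_trans; [apply pow_incr; split; [apply Rabs_pos|exact A2]|].
    rewrite !Rpow_mult_distr. rewrite Rmult_assoc. apply Rmult_le_compat_l; [apply pow_le; lra|].
    assert (P1 : 0 <= (/ jac lam x e) ^ n) by (apply pow_le; lra). assert (P2 : 0 <= M ^ n) by (apply pow_le; lra).
    assert (P3 : 0 <= 2 ^ n) by (apply pow_le; lra).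
    destruct (Rle_lt_dec (/ jac lam x e) M) as [h|h].
    - apply Rle_trans with ((2 * M) ^ n); [apply pow_incr; lra|]. rewrite Rpow_mult_distr.
      apply Rmult_le_compat_l; lra.
    - apply Rle_trans with ((2 * / jac lam x e) ^ n); [apply pow_incr; lra|]. rewrite Rpow_mult_distr.
      apply Rmult_le_compat_l; lra. }
  assert (Cp : contpos (fun x => (C1 * 2) ^ n * (x ^ n + M ^ n))).
  { apply contpos_mult; [apply contpos_const|]. apply contpos_plus; [apply contpos_pow, contpos_id|apply contpos_const]. }
  assert (X : ex_RInt (fun x => kerV lam x e ^ n * kerg lam x e) 0 1).
  { apply ex_RInt_cont. intros x. apply (kerVg_cont lam e (fun y => y ^ n)); [exact De|]. intros; apply continuous_pow_id. }
  eapply Rle_trans; [apply abs_RInt_le; [lra|exact X]|].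
  apply Rle_trans with (expect b r (fun x => (C1 * 2) ^ n * (x ^ n + M ^ n))).
  - unfold r, b. rewrite <- (kernel_weighted lam e ltac:(lra) He De) by exact Cp.
    apply RInt_le; [lra| | |].
    + apply ex_RInt_cont. intros x. apply (continuous_comp (fun x => kerV lam x e ^ n * kerg lam x e) Rabs); [|apply continuous_Rabs].
      apply (kerVg_cont lam e (fun y => y ^ n)); [exact De|]. intros; apply continuous_pow_id.
    + apply ex_RInt_cont. intros x.
      apply (continuous_mult (fun x => (C1 * 2) ^ n * ((/ jac lam x e) ^ n + M ^ n)) (fun x => kerg lam x e)); [|now apply kerg_cont].
      assert (J := jac_pos lam x e De).
      apply (continuous_comp (fun x => / jac lam x e) (fun y => (C1 * 2) ^ n * (y ^ n + M ^ n))).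
      * apply continuous_Rinv_comp; [apply (cont2d_fst (jac lam)), jac_cont|lra].
      * apply Cp. now apply Rinv_0_lt_compat.
    + intros x _. assert (P := kerg_pos lam x e De). rewrite Rabs_mult, (Rabs_pos_eq (kerg lam x e)) by lra.
      apply Rmult_le_compat_r; [lra|apply HV].
  - rewrite expect_scal; [|exact Hr|apply contpos_plus; [apply contpos_pow, contpos_id|apply contpos_const]].
    rewrite expect_plus; [|exact Hr|apply contpos_pow, contpos_id|apply contpos_const].
    rewrite expect_const, expect_pow by exact Hr.
    apply Rmult_le_compat_l; [apply pow_le; lra|]. apply Rplus_le_compat_r.
    apply Rmult_le_compat; [left; now apply F_pos|left; apply Rinv_0_lt_compat; now apply F_pos|now apply HFn|].
    apply Rinv_le_contravar; [exact Hc|now apply HF].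
Qed.

Lemma inv_neg_lt lam a : 0 < a -> - / a < lam < 0 -> / lam < - a.
Proof.
  intros Ha Hl. apply (Rmult_lt_reg_r (- lam)); [lra|].
  replace (/ lam * - lam) with (-1) by (field; lra).
  assert (a * - / a < a * lam) by (apply Rmult_lt_compat_l; lra).
  replace (a * - / a) with (-1) in H by (field; lra). lra.
Qed.

Lemma profile_negative lam : lam < 0 -> profile lam u_init.
Proof.
  intros Hl. assert (Sg : lam / Rabs lam = -1) by (rewrite Rabs_left by exact Hl; field; lra).
  apply profile_of_kernel.
  - intros; lra.
  - intros _. now apply clock_bounded_neg.
  - intros p Hp Hc.
    destruct (moment_converges_neg lam p Hp) as [l HL].
    { replace (- 2 / (2 * p - 1)) with (2 / (1 - 2 * p)) by (field; lra). lra. }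
    exists l. intros eps Heps. apply (moment_near_top lam p (fun y => Rabs (y - l) < eps)); [lra|lra|].
    exact (proj1 (filterlim_locally _ _) HL (mkposreal _ Heps)).
  - intros p Hp [Hc|Hc]; [|lra]. intros M. apply (moment_near_top lam p (fun y => M < y)); [lra|lra|].
    now apply moment_diverges_neg.
  - intros Hc. apply (kernel_pow_bounded_neg lam 2 Hl); [|auto].
    replace (INR 2) with 2 by (simpl; ring). assert (H := inv_neg_lt lam (3 / 2)). replace (/ (3 / 2)) with (2 / 3) in H by field.
    assert (/ lam < - (3 / 2)) by (apply H; lra). lra.
  - intros [Hc|Hc]; [|lra]. intros M.
    assert (K : 0 < - (1 + 2 * lam)) by lra.
    apply (third_near_top lam (fun y => M < (1 + 2 * lam) * y)); [lra|]. rewrite Sg.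
    generalize (third_diverges_neg lam ltac:(lra) (M / - (1 + 2 * lam))). apply filter_imp. intros r H.
    apply (Rmult_lt_compat_l _ _ _ K) in H. replace (- (1 + 2 * lam) * (M / - (1 + 2 * lam))) with M in H by (field; lra). lra.
  - intros Hc M. assert (K : 0 < 1 + 2 * lam) by lra.
    apply (third_near_top lam (fun y => (1 + 2 * lam) * y < M)); [lra|]. rewrite Sg.
    generalize (third_diverges_neg lam ltac:(lra) (- M / (1 + 2 * lam))). apply filter_imp. intros r H.
    apply (Rmult_lt_compat_l _ _ _ K) in H. replace ((1 + 2 * lam) * (- M / (1 + 2 * lam))) with (- M) in H by (field; lra). lra.
  - intros Hc. destruct (kernel_pow_bounded_neg lam 3 Hl) as [M HM]; [|auto|].
    + replace (INR 3) with 3 by (simpl; ring). assert (H := inv_neg_lt lam (5 / 2)). replace (/ (5 / 2)) with (2 / 5) in H by field.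
      assert (/ lam < - (5 / 2)) by (apply H; lra). lra.
    + exists (Rabs (1 + 2 * lam) * M). intros e He De. rewrite Rabs_mult.
      apply Rmult_le_compat_l; [apply Rabs_pos|]. now apply HM.
Qed.

Lemma profile_large lam : 1 < lam -> profile lam u_init.
Proof.
  intros Hl. assert (Sg : lam / Rabs lam = 1) by (rewrite Rabs_pos_eq by lra; field; lra).
  apply profile_of_kernel; try (intros; lra).
  - intros _. now apply clock_bounded_large.
  - intros p Hp _ M. apply (moment_near_top lam p (fun y => M < y)); [lra|lra|].
    now apply moment_diverges_large.
  - intros _ M. assert (K : 0 < 1 + 2 * lam) by lra.
    apply (third_near_top lam (fun y => M < (1 + 2 * lam) * y)); [lra|]. rewrite Sg.
    generalize (third_diverges_large lam Hl (M / (1 + 2 * lam))). apply filter_imp. intros r H.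
    apply (Rmult_lt_compat_l _ _ _ K) in H. replace ((1 + 2 * lam) * (M / (1 + 2 * lam))) with M in H by (field; lra). lra.
Qed.

(** * The case [lam = 0] *)

Lemma dom_zero e : dom 0 e.
Proof. unfold dom. lra. Qed.

Lemma kerV_zero x e : kerV 0 x e = cs x - kap 0 e.
Proof.
  unfold kerV, spd, hq, jac. replace (- (2 * 0)) with 0 by ring.
  rewrite Rpower_O by (apply mom0_pos, dom_zero). replace (1 - 0 * e * cs x) with 1 by ring. field.
Qed.

Lemma wgt_zero x e : wgt 0 x e = exp (e * cs x).
Proof. unfold wgt. destruct (Req_EM_T 0 0); [reflexivity|lra]. Qed.

Lemma hq_zero x e : hq 0 x e = cs x.
Proof. unfold hq, jac. replace (1 - 0 * e * cs x) with 1 by ring. field. Qed.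

Lemma kap_zero_gap e : 1 - kap 0 e = RInt (fun x => (1 - cs x) * kerg 0 x e) 0 1.
Proof.
  rewrite (kap_integral 0 e (dom_zero e)).
  rewrite <- (kernel_mass 0 e (dom_zero e)) at 1.
  assert (C1 : forall x, continuous (fun x => kerg 0 x e) x) by (intros; apply kerg_cont, dom_zero).
  assert (C2 : forall x, continuous (fun x => hq 0 x e * kerg 0 x e) x).
  { intros x. apply (continuous_mult (fun x => hq 0 x e) (fun x => kerg 0 x e)); [|apply C1].
    apply (cont2d_fst (hq 0)). apply hq_cont, dom_zero. }
  rewrite (RInt_extR (fun x => (1 - cs x) * kerg 0 x e) (fun x => kerg 0 x e - hq 0 x e * kerg 0 x e)).
  - symmetry. apply (RInt_minus (V := R_CompleteNormedModule) (fun x => kerg 0 x e) (fun x => hq 0 x e * kerg 0 x e)); now apply ex_RInt_cont.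
  - intros x. rewrite hq_zero. ring.
Qed.

Lemma one_minus_cs_kerg_cont e x : continuous (fun x => (1 - cs x) * kerg 0 x e) x.
Proof.
  apply (continuous_mult (fun x => 1 - cs x) (fun x => kerg 0 x e)); [|apply kerg_cont, dom_zero].
  apply (continuous_minus (fun _ => 1) cs); [apply continuous_const|apply cs_cont].
Qed.

Lemma kap_zero_gap_nonneg e : 0 <= 1 - kap 0 e.
Proof.
  rewrite kap_zero_gap. apply RInt_ge_0; [lra| |].
  - apply ex_RInt_cont. apply one_minus_cs_kerg_cont.
  - intros x _. apply Rmult_le_pos; [generalize (cs_bound x); lra|left; apply kerg_pos, dom_zero].
Qed.

(* Laplace's method: the density [exp (e cs)] concentrates at the maximum of [cs]. *)
Lemma kap_zero_gap_le e : 4 <= e -> 1 - kap 0 e <= exp 32 / sqrt e.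
Proof.
  intros He. rewrite kap_zero_gap.
  assert (P := mom0_pos 0 e (dom_zero e)).
  assert (SP : 0 < sqrt e) by (apply sqrt_lt_R0; lra).
  assert (SS : sqrt e * sqrt e = e) by (apply sqrt_sqrt; lra).
  assert (S2 : 2 <= sqrt e) by nra.
  (* On the interval of length [1 / sqrt e] the bound [1 - cos <= 32 x^2] keeps the exponent within
     32 of its maximum [e]. *)
  assert (Low : exp (e - 32) / sqrt e <= mom 0 0 e).
  { unfold mom. set (f := fun x => wgt 0 x e * hq 0 x e ^ 0).
    assert (Cf : forall x, continuous f x) by (intros; apply (mom_integrand_cx 0 0), dom_zero).
    assert (Hf : forall x, f x = exp (e * cs x)) by (intros; unfold f; rewrite wgt_zero; simpl; ring).
    assert (Dl : 0 < / sqrt e <= 1).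
    { split; [now apply Rinv_0_lt_compat|]. rewrite <- Rinv_1. apply Rinv_le_contravar; lra. }
    assert (E : RInt f 0 (/ sqrt e) + RInt f (/ sqrt e) 1 = RInt f 0 1).
    { apply (RInt_Chasles (V := R_CompleteNormedModule)); now apply ex_RInt_cont. }
    assert (H1 : 0 <= RInt f (/ sqrt e) 1).
    { apply RInt_ge_0; [lra|now apply ex_RInt_cont|]. intros x _. rewrite Hf. left; apply exp_pos. }
    assert (H2 : exp (e - 32) / sqrt e <= RInt f 0 (/ sqrt e)).
    { assert (Ec : RInt (fun _ => exp (e - 32)) 0 (/ sqrt e) = (/ sqrt e - 0) * exp (e - 32)).
      { rewrite (RInt_const (V := R_CompleteNormedModule)). reflexivity. }
      replace (exp (e - 32) / sqrt e) with ((/ sqrt e - 0) * exp (e - 32)) by (unfold Rdiv; ring).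
      rewrite <- Ec. apply RInt_le; [lra|apply ex_RInt_const|now apply ex_RInt_cont|].
      intros x Hx. rewrite Hf. assert (e - 32 <= e * cs x).
      { assert (U := cs_upper x). assert (x * sqrt e <= 1).
        { apply (Rmult_le_reg_r (/ sqrt e)); [lra|]. rewrite Rmult_assoc, Rinv_r by lra. lra. }
        assert (0 <= x * sqrt e) by (apply Rmult_le_pos; lra).
        assert (e * x ^ 2 <= 1) by (rewrite <- SS; nra).
        assert (e * (1 - cs x) <= e * (32 * x ^ 2)) by (apply Rmult_le_compat_l; lra). lra. }
      destruct H as [H|H]; [left; now apply exp_increasing|right; now rewrite H]. }
    lra. }
  apply Rle_trans with (RInt (fun _ => exp 32 / sqrt e) 0 1).
  - apply RInt_le; [lra|apply ex_RInt_cont; apply one_minus_cs_kerg_cont|apply ex_RInt_const|].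
    intros x _. unfold kerg. rewrite wgt_zero.
    assert (B := cs_bound x).
    (* With [y = e (1 - cos)] this is [y exp (-y) <= 1]. Divided by the lower bound on the mass, it
       leaves [exp 32 / sqrt e]. *)
    assert (N : (1 - cs x) * exp (e * cs x) <= exp e / e).
    { set (y := e * (1 - cs x)). assert (Y : 0 <= y) by (apply Rmult_le_pos; lra).
      replace (e * cs x) with (e + - y) by (unfold y; ring). rewrite exp_plus, exp_Ropp.
      replace (1 - cs x) with (y / e) by (unfold y; field; lra).
      assert (Q : y * / exp y <= 1).
      { apply (Rmult_le_reg_r (exp y)); [apply exp_pos|]. rewrite Rmult_assoc, Rinv_l by (generalize (exp_pos y); lra).
        generalize (exp_ineq1_le y); lra. }
      assert (Q2 : 0 < exp e / e) by (apply Rdiv_lt_0_compat; [apply exp_pos|lra]).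
      replace (y / e * (exp e * / exp y)) with (exp e / e * (y * / exp y)) by (field; split; [generalize (exp_pos y); lra|lra]).
      rewrite <- (Rmult_1_r (exp e / e)) at 2. apply Rmult_le_compat_l; lra. }
    unfold Rdiv at 1. rewrite <- Rmult_assoc.
    apply Rle_trans with (exp e / e * / (exp (e - 32) / sqrt e)).
    + apply Rmult_le_compat; [apply Rmult_le_pos; [lra|left; apply exp_pos]|left; now apply Rinv_0_lt_compat|exact N|].
      apply Rinv_le_contravar; [apply Rdiv_lt_0_compat; [apply exp_pos|exact SP]|exact Low].
    + unfold Rminus. rewrite exp_plus, exp_Ropp. right.
      assert (E1 := exp_pos e). assert (E2 := exp_pos 32).
      set (w := exp 32) in *. rewrite <- SS at 2. field. repeat split; lra.
  - rewrite (RInt_const (V := R_CompleteNormedModule)). right.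
    unfold scal; simpl; unfold mult; simpl. to_R_eq. ring.
Qed.

Lemma kerV_zero_bound x e : Rabs (kerV 0 x e) <= 2.
Proof.
  rewrite kerV_zero. assert (B := cs_bound x). assert (G := kap_zero_gap_nonneg e).
  assert (- 1 <= kap 0 e).
  { rewrite (kap_integral 0 e (dom_zero e)).
    assert (M := kernel_mass 0 e (dom_zero e)).
    assert (C1 : forall x, continuous (fun x => kerg 0 x e) x) by (intros; apply kerg_cont, dom_zero).
    replace (-1) with (RInt (fun x => -1 * kerg 0 x e) 0 1).
    - apply RInt_le; [lra| | |].
      + apply ex_RInt_cont. intros y. apply (continuous_mult (fun _ => -1) (fun x => kerg 0 x e)); [apply continuous_const|apply C1].
      + apply ex_RInt_cont. intros y. apply (continuous_mult (fun x => hq 0 x e) (fun x => kerg 0 x e)); [|apply C1].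
        apply (cont2d_fst (hq 0)). apply hq_cont, dom_zero.
      + intros y _. rewrite hq_zero. apply Rmult_le_compat_r; [left; apply kerg_pos, dom_zero|]. apply cs_bound.
    - rewrite (RInt_scal (V := R_CompleteNormedModule) (fun x => kerg 0 x e)) by now apply ex_RInt_cont.
      rewrite M. apply Rmult_1_r. }
  apply Rabs_le. lra.
Qed.

(** Since [|V| <= 2], the [p]-th power costs only the factor [2^(p-1)] over [|V|]; and [|V|] is at
    most [(1 - cos) + (1 - kap)], whose mean is [2 (1 - kap)]. *)
Lemma kerN_zero_le p e : 1 <= p -> 0 <= kerN 0 p e <= Rpower 2 (p - 1) * (2 * (1 - kap 0 e)).
Proof.
  intros Hp. assert (C1 : forall x, continuous (fun x => rpow (Rabs (kerV 0 x e)) p * kerg 0 x e) x).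
  { intros x. apply (kerVg_cont 0 e (fun y => rpow (Rabs y) p)); [apply dom_zero|]. intros; apply continuous_rpow_abs; lra. }
  assert (C2 : forall c x, continuous (fun x => c * kerg 0 x e) x).
  { intros c x. apply (continuous_mult (fun _ => c) (fun x => kerg 0 x e)); [apply continuous_const|apply kerg_cont, dom_zero]. }
  assert (G := kap_zero_gap_nonneg e). assert (PP := Rpower_pos 2 (p - 1)).
  split.
  { apply RInt_ge_0; [lra|now apply ex_RInt_cont|]. intros x _.
    apply Rmult_le_pos; [apply rpow_nonneg|left; apply kerg_pos, dom_zero]. }
  assert (C3 : forall x, continuous (fun x => (1 - cs x) * kerg 0 x e + (1 - kap 0 e) * kerg 0 x e) x).
  { intros x. apply (continuous_plus (fun x => (1 - cs x) * kerg 0 x e)); [apply one_minus_cs_kerg_cont|apply C2]. }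
  apply Rle_trans with (RInt (fun x => Rpower 2 (p - 1) * ((1 - cs x) * kerg 0 x e + (1 - kap 0 e) * kerg 0 x e)) 0 1).
  - apply RInt_le; [lra|now apply ex_RInt_cont| |].
    + apply ex_RInt_cont. intros x. apply (continuous_mult (fun _ => Rpower 2 (p - 1))
        (fun x => (1 - cs x) * kerg 0 x e + (1 - kap 0 e) * kerg 0 x e)); [apply continuous_const|apply C3].
    + intros x _. rewrite <- Rmult_plus_distr_r, <- Rmult_assoc.
      apply Rmult_le_compat_r; [left; apply kerg_pos, dom_zero|].
      assert (B := kerV_zero_bound x e). assert (Bc := cs_bound x).
      assert (A : Rabs (kerV 0 x e) <= (1 - cs x) + (1 - kap 0 e)) by (rewrite kerV_zero; apply Rabs_le; lra).
      assert (Z := Rabs_pos (kerV 0 x e)). set (y := Rabs (kerV 0 x e)) in *.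
      apply Rle_trans with (Rpower 2 (p - 1) * y); [|apply Rmult_le_compat_l; lra].
      destruct Z as [Z|Z].
      * rewrite rpow_pos_eq by exact Z. replace p with ((p - 1) + 1) at 1 by ring. rewrite Rpower_plus, Rpower_1 by exact Z.
        apply Rmult_le_compat_r; [lra|]. apply Rle_Rpower_l; lra.
      * rewrite <- Z. unfold rpow. destruct (Rle_dec 0 0); lra.
  - rewrite (RInt_scal (V := R_CompleteNormedModule) (fun x => (1 - cs x) * kerg 0 x e + (1 - kap 0 e) * kerg 0 x e))
      by now apply ex_RInt_cont.
    apply Rmult_le_compat_l; [lra|]. right.
    rewrite (RInt_plus (V := R_CompleteNormedModule) (fun x => (1 - cs x) * kerg 0 x e) (fun x => (1 - kap 0 e) * kerg 0 x e));
      [|apply ex_RInt_cont; apply one_minus_cs_kerg_cont|now apply ex_RInt_cont].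
    rewrite (RInt_scal (V := R_CompleteNormedModule) (fun x => kerg 0 x e)) by (apply ex_RInt_cont; intros; apply kerg_cont, dom_zero).
    rewrite (kernel_mass 0 e (dom_zero e)), <- kap_zero_gap.
    unfold plus, scal; simpl; unfold mult; simpl. to_R_eq. ring.
Qed.

Lemma profile_zero : profile 0 u_init.
Proof.
  destruct (kernel_bounded 0 2 (fun e x _ _ => kerV_zero_bound x e)) as [B2 B3].
  apply profile_of_kernel; try (intros; lra).
  - intros _ M. exists (Rabs M + 1). assert (P := Rabs_pos M).
    split; [lra|]. split; [apply dom_zero|].
    (* At [lam = 0] the exponent [2 lam] vanishes and the clock runs at rate 1. *)
    assert (A := clock_ge 0 (Rabs M + 1) (fun s => s) (fun _ => 1) ltac:(lra) (dom_zero _)). cbv beta in A.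
    assert (Rabs M + 1 - 0 <= clock 0 (Rabs M + 1)).
    { apply A. intros s _. split; [apply (is_derive_id (K := R_AbsRing))|].
      rewrite Rmult_0_r, Rpower_O; [lra|]. apply mom0_pos, dom_zero. }
    generalize (Rle_abs M); lra.
  - intros p Hp _. exists 0. intros eps Heps.
    set (K := Rpower 2 (p - 1) * (2 * exp 32)).
    assert (KP : 0 < K) by (unfold K; repeat apply Rmult_lt_0_compat; try apply Rpower_pos; try apply exp_pos; lra).
    (* [sqrt e > q] makes [K / sqrt e < eps]; the summand 2 ensures the hypothesis [4 <= e] of
       [kap_zero_gap_le]. *)
    set (q := K / eps + 2). assert (Q : 2 < q) by (unfold q; assert (0 < K / eps) by (now apply Rdiv_lt_0_compat); lra).
    exists (q * q). split; [nra|]. split; [apply dom_zero|]. intros e He _.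
    assert (A := kerN_zero_le p e Hp).
    assert (G := kap_zero_gap_le e ltac:(nra)).
    assert (S : q < sqrt e).
    { rewrite <- (sqrt_square q) by lra. apply sqrt_lt_1_alt. nra. }
    rewrite Rminus_0_r, Rabs_pos_eq by lra.
    apply Rle_lt_trans with (K * / sqrt e).
    + eapply Rle_trans; [apply A|]. unfold K. rewrite Rmult_assoc. apply Rmult_le_compat_l; [left; apply Rpower_pos|].
      unfold Rdiv in G. lra.
    + apply (Rmult_lt_reg_r (sqrt e)); [lra|]. rewrite Rmult_assoc, Rinv_l by lra.
      assert (eps * q < eps * sqrt e) by (apply Rmult_lt_compat_l; lra).
      replace (eps * q) with (K + 2 * eps) in H by (unfold q; field; lra). lra.
  - intros p Hp Hc. exfalso. revert Hc. apply range_contradiction; lra.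
  - intros _. exact B2.
  - intros _. exact B3.
Qed.

(* At [lam = 1] the datum is a steady state. *)
Lemma profile_one : profile 1 u_init.
Proof.
  set (uxx := fun x (_ : R) => - (2 * PI) * sin (2 * PI * x)).
  assert (P := PI_RGT_0).
  assert (E2 : Int01 (fun x => cs x ^ 2) = 1 / 2).
  { assert (I : is_RInt (fun x => cs x ^ 2) 0 1 (1 / 2)).
    { replace (1 / 2) with (minus (1 / 2 + sin (2 * PI * 1) * cos (2 * PI * 1) / (4 * PI)) (0 / 2 + sin (2 * PI * 0) * cos (2 * PI * 0) / (4 * PI))).
      - apply (is_RInt_derive (fun x => x / 2 + sin (2 * PI * x) * cos (2 * PI * x) / (4 * PI)) (fun x => cs x ^ 2)).
        + intros x _. unfold cs. auto_derive; [auto|].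
          assert (Q := sin2_cos2 (2 * PI * x)). unfold Rsqr in Q.
          set (s := sin (2 * PI * x)) in *. set (c := cos (2 * PI * x)) in *.
          transitivity (1 / 2 + (c * c - s * s) / 2); [field; lra|]. replace (s * s) with (1 - c * c) by lra. field.
        + intros x _. apply (continuous_comp cs (fun y => y ^ 2)); [apply cs_cont|apply continuous_pow_id].
      - rewrite Rmult_1_r, sin_2PI, (Rmult_0_r (2 * PI)), sin_0. unfold minus, plus, opp; simpl. field. lra. }
    rewrite Int01_RInt by (eexists; exact I). now apply is_RInt_unique. }
  exists None, (fun x _ => u_init x), (fun x _ => cs x), uxx, (fun _ _ => 0).
  split.
  { split; [discriminate|]. split.
    { intros x t _ _. split; apply is_derive_Reals; [apply u_init_derive|apply cs_derive]. }
    split. { intros x t _ _. apply derivable_pt_lim_const. }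
    split.
    { apply cont_on_strip_of_cont2d. intros x t _ _. apply (cont2d_of_fst u_init).
      apply (ex_derive_continuous u_init). eexists. apply u_init_derive. }
    split.
    { apply cont_on_strip_of_cont2d. intros x t _ _. apply (cont2d_of_fst cs). apply cs_cont. }
    split.
    { apply cont_on_strip_of_cont2d. intros x t _ _. apply (cont2d_of_fst (fun x => - (2 * PI) * sin (2 * PI * x))).
      apply (ex_derive_continuous (fun x => - (2 * PI) * sin (2 * PI * x))). auto_derive; auto. }
    split.
    { intros x t _ _. unfold u_init. replace (2 * PI * (x + 1)) with (2 * PI * x + 2 * INR 1 * PI) by (simpl; ring).
      now rewrite sin_period. }
    split; [reflexivity|].
    (* The equation reduces to [- (sin^2 + cos^2) = -1], the mean of [cos^2] being [1/2]. *)
    intros x t _ _. rewrite E2. unfold u_init, uxx, cs.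
    assert (Q := sin2_cos2 (2 * PI * x)). unfold Rsqr in Q.
    replace (sin (2 * PI * x) / (2 * PI) * (- (2 * PI) * sin (2 * PI * x))) with (- (sin (2 * PI * x) * sin (2 * PI * x))) by (field; lra).
    lra. }
  split; [reflexivity|].
  split; [intros H; exfalso; apply H; lra|].
  split.
  { intros p _ _. exists (Lpnorm (fun x _ => cs x) p 0). intros eps Heps. exists 0.
    split; [lra|]. split; [exact I|]. intros t _ _. unfold Lpnorm. rewrite Rminus_diag, Rabs_R0. exact Heps. }
  split; [intros; lra|].
  split.
  { intros p Hp Hc. assert (0 < / p) by (apply Rinv_0_lt_compat; lra). unfold Rdiv in Hc. lra. }
  split; [intros; lra|].
  split.
  { intros _. exists (Rabs (1 / 2)). intros t _ _. unfold energy. rewrite E2. lra. }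
  exists (fun _ => 0). split.
  { intros t _ _. apply (derivable_pt_lim_const (Int01 (fun x => cs x ^ 2))). }
  split; [intros; lra|].
  split; [intros; lra|].
  split; [intros; lra|].
  intros _. exists 0. intros t _ _. rewrite Rabs_R0. lra.
Qed.

(** * Regularity of the datum, and the theorem *)

Lemma u_init_smooth : smooth u_init.
Proof.
  assert (P := PI_RGT_0).
  (* Each differentiation multiplies by [2 PI] and advances the phase by a quarter period. *)
  exists (fun n x => (2 * PI) ^ n / (2 * PI) * sin (2 * PI * x + INR n * (PI / 2))). split.
  - apply functional_extensionality. intros x. unfold u_init. simpl.
    rewrite Rmult_0_l, Rplus_0_r. field. lra.
  - intros n x. apply is_derive_Reals. auto_derive; [auto|]. rewrite S_INR.
    replace (2 * PI * x + (INR n + 1) * (PI / 2)) with (PI / 2 + (2 * PI * x + INR n * (PI / 2))) by ring.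
    rewrite <- cos_sin. simpl. field. lra.
Qed.

Lemma u_init_periodic : periodic1 u_init.
Proof.
  intros x. unfold u_init. replace (2 * PI * (x + 1)) with (2 * PI * x + 2 * INR 1 * PI) by (simpl; ring).
  now rewrite sin_period.
Qed.

Theorem mainTheorem3 :
  exists u0 : R -> R, smooth u0 /\ periodic1 u0 /\
  forall lam : R,
  exists (T : option R) (u ux uxx uxt : R -> R -> R),
    is_solution lam u0 T u ux uxx uxt /\
    (* t_* = +infinity (global solution) for lam in [0,1] *)
    (0 <= lam <= 1 -> T = None) /\
    (* finite L^infty blow-up time of u_x for lam outside [0,1] *)
    (~ (0 <= lam <= 1) -> exists s, T = Some s /\ 0 < s /\ Linf_blowup ux s) /\
    (* (1) *)
    (forall p, 1 <= p -> 2 / (1 - 2 * p) < lam <= 1 ->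
       lim_finite T (fun t => Lpnorm ux p t)) /\
    (* (2) *)
    (forall p, 1 < p -> (lam <= -2 \/ 1 < lam) ->
       lim_pinf T (fun t => Lpnorm ux p t)) /\
    (forall p, 1 < p -> -2 < lam <= -2 / p ->
       lim_pinf T (fun t => Lpnorm ux p t)) /\
    (* (3) energy *)
    ((lam <= -2/3 \/ 1 < lam) -> lim_pinf T (energy ux)) /\
    (-2/3 < lam <= 1 -> bounded_on T (energy ux)) /\
    (* (3) derivative of the energy *)
    (exists dE : R -> R,
       (forall t, 0 < t -> before T t -> derivable_pt_lim (energy ux) t (dE t)) /\
       ((lam < -1/2 \/ 1 < lam) -> lim_pinf T dE) /\
       (lam = -1/2 -> forall t, 0 < t -> before T t -> dE t = 0) /\
       (-1/2 < lam <= -2/5 -> lim_minf T dE) /\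
       (-2/5 < lam <= 1 ->
          exists M, forall t, 0 < t -> before T t -> Rabs (dE t) <= M)).
Proof.
  exists u_init. split; [exact u_init_smooth|]. split; [exact u_init_periodic|].
  intros lam. change (profile lam u_init).
  destruct (Rtotal_order lam 0) as [H|[->|H]]; [now apply profile_negative|exact profile_zero|].
  destruct (Rtotal_order lam 1) as [H1|[->|H1]]; [apply profile_between; lra|exact profile_one|now apply profile_large].
Qed.
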